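(* Let $\Omega\subseteq\mathbb{R}^N$, $N\ge 2$, be a bounded domain with $C^2$-boundary $\partial\Omega$. Let $1<p<q<N$ with $\frac{q}{p}<1+\frac1N$, and let $\mu\colon\overline{\Omega}\to[0,\infty)$ be Lipschitz continuous. Let $g\colon\Omega\times\mathbb{R}\times\mathbb{R}^N\to\mathbb{R}$ be a Carathéodory function satisfying $$|g(x,s,\xi)|\le c_1|\xi|^{p\frac{r-1}{r}}+c_2|s|^{r-1}+c_3$$ for a.a. $x\in\Omega$, for all $s\in\mathbb{R}$ and for all $\xi\in\mathbb{R}^N$, with positive constants $c_1,c_2,c_3$ and an exponent $r$ with $q<r\le p^*$, where $p^*=\frac{Np}{N-p}$. Then each weak solution $u\in W^{1,\mathcal{H}}_0(\Omega)$ of the problem $$-\operatorname{div}\left(|\nabla u|^{p-2}\nabla u+\mu(x)|\nabla u|^{q-2}\nabla u\right)=g(x,u,\nabla u)\ \text{ in }\Omega,\qquad u=0\ \text{ on }\partial\Omega,$$ belongs to $L^\infty(\Omega)$.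
   Context: Function spaces: let $\mathcal{H}(x,t)=t^p+\mu(x)t^q$ for $x\in\Omega$, $t\ge0$. The Musielak–Orlicz space $L^{\mathcal{H}}(\Omega)$ consists of all measurable $u\colon\Omega\to\mathbb{R}$ with $\rho_{\mathcal{H}}(u):=\int_\Omega\mathcal{H}(x,|u|)\,dx<+\infty$, with the Luxemburg norm $\|u\|_{\mathcal{H}}=\inf\{\tau>0:\rho_{\mathcal{H}}(u/\tau)\le1\}$. The space $W^{1,\mathcal{H}}(\Omega)=\{u\in L^{\mathcal{H}}(\Omega):|\nabla u|\in L^{\mathcal{H}}(\Omega)\}$ has the norm $\|u\|_{1,\mathcal{H}}=\||\nabla u|\|_{\mathcal{H}}+\|u\|_{\mathcal{H}}$, and $W^{1,\mathcal{H}}_0(\Omega)$ is the completion of $C_0^\infty(\Omega)$ in $W^{1,\mathcal{H}}(\Omega)$. Carathéodory function: $x\mapsto g(x,s,\xi)$ is measurable for all $(s,\xi)\in\mathbb{R}\times\mathbb{R}^N$, and $(s,\xi)\mapsto g(x,s,\xi)$ is continuous for a.a. $x\in\Omega$. Weak solution: $u\in W^{1,\mathcal{H}}_0(\Omega)$ is a weak solution of the problem if $$\int_\Omega\left(|\nabla u|^{p-2}\nabla u+\mu(x)|\nabla u|^{q-2}\nabla u\right)\cdot\nabla v\,dx=\int_\Omega g(x,u,\nabla u)\,v\,dx$$ for all $v\in W^{1,\mathcal{H}}_0(\Omega)$. *)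

(* Defs.v *)
From HB Require Import structures.
From mathcomp Require Import all_boot all_order all_algebra.
From mathcomp Require Import all_classical all_reals all_analysis.

Set Implicit Arguments.
Unset Strict Implicit.
Unset Printing Implicit Defensive.

Import Order.TTheory GRing.Theory Num.Def Num.Theory.
Import numFieldNormedType.Exports.

Local Open Scope classical_set_scope.
Local Open Scope ring_scope.

(** * Lebesgue measure on R^N

    R^N is ['rV[R]_N].  The measure is the Caratheodory restriction of the
    Lebesgue outer measure, so the measurable sets are the Lebesgue
    measurable ones, not just the Borel ones: with the Borel sigma-algebra,
    [x |-> g x (u x) (Du x)] could fail to be measurable for a Caratheodory
    function [g], which is continuous only for almost all [x]. *)

Section lebesgue_outer_measure.
Variables (R : realType) (N : nat).

(** [None] stands for the empty box, so that finite covers are covers: in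
    R^0 every [Some] box is a point of volume 1. *)
Definition box (c : option ('rV[R]_N * 'rV[R]_N)) : set 'rV[R]_N :=
  if c is Some ab then [set x | forall i, ab.1 0 i < x 0 i <= ab.2 0 i]
  else set0.

Definition box_volume (c : option ('rV[R]_N * 'rV[R]_N)) : R :=
  if c is Some ab then \prod_i maxr 0 (ab.2 0 i - ab.1 0 i) else 0.

Local Open Scope ereal_scope.

Definition lebesgue_outer (A : set 'rV[R]_N) : \bar R :=
  ereal_inf [set \sum_(k <oo) (box_volume (B k))%:E |
    B in [set B : (option ('rV[R]_N * 'rV[R]_N))^nat |
          A `<=` \bigcup_k box (B k)]].

Lemma box_volume_ge0 c : 0 <= (box_volume c)%:E.
Proof.
rewrite lee_fin; case: c => [ab|//].
by apply: prodr_ge0 => i _; rewrite le_max lexx.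
Qed.

Lemma lebesgue_outer_ge0 A : 0 <= lebesgue_outer A.
Proof.
apply: le_ereal_inf_tmp => _ [B _ <-].
by apply: nneseries_ge0 => k _ _; exact: box_volume_ge0.
Qed.

Lemma le_lebesgue_outer : {homo lebesgue_outer : A B / A `<=` B >-> A <= B}.
Proof.
move=> A B AB; apply: ereal_inf_le_tmp => _ [C BC <-].
by exists C => //; exact: subset_trans BC.
Qed.

Lemma lebesgue_outer0 : lebesgue_outer set0 = 0.
Proof.
apply/eqP; rewrite eq_le lebesgue_outer_ge0 andbT.
apply: ereal_inf_lbound; exists (fun=> None); first by [].
by rewrite eseries0.
Qed.

Lemma lebesgue_outer_sigma_subadditive : sigma_subadditive lebesgue_outer.
Proof.
move=> A; have [[i ioo]|] := pselect (exists i, lebesgue_outer (A i) = +oo).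
  rewrite (eseries_pinfty _ _ ioo) ?leey// => n _.
  by rewrite -ltNye (lt_le_trans _ (lebesgue_outer_ge0 _)).
rewrite -forallNE => Aoo.
apply/lee_addgt0Pr => e e0.
rewrite (le_trans _ (epsilon_trick _ _ (ltW e0)))//; last first.
  by move=> n; exact: lebesgue_outer_ge0.
pose P n (B : (option ('rV[R]_N * 'rV[R]_N))^nat) :=
  A n `<=` \bigcup_k box (B k) /\
  \sum_(k <oo) (box_volume (B k))%:E <=
    lebesgue_outer (A n) + (e / (2 ^ n.+1)%:R)%:E.
have [G PG] : {G : ((option ('rV[R]_N * 'rV[R]_N))^nat)^nat &
               forall n, P n (G n)}.
  apply: (@choice _ _ P) => n.
  have en1 : (0 < e / (2 ^ n.+1)%:R)%R by rewrite divr_gt0.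
  have fA : lebesgue_outer (A n) \is a fin_num.
    by rewrite ge0_fin_numE ?lebesgue_outer_ge0// ltey; apply/eqP/Aoo.
  have [_ [B AB <-] BA] := lb_ereal_inf_adherent en1 fA.
  by exists B; split=> //; exact: ltW.
pose v (nk : nat * nat) : \bar R := (box_volume (G nk.1 nk.2))%:E.
have v0 nk : 0 <= v nk by exact: box_volume_ge0.
apply: (@le_trans _ _ (\esum_(i in setT) v i)).
  apply: ereal_inf_lbound => /=.
  have /card_esym/ppcard_eqP[f] := card_nat2.
  exists (fun k => G (f k).1 (f k).2).
    move=> t [i _ /((PG i).1)[j _ tij]].
    by exists (f^-1%FUN (i, j)) => //=; rewrite invK ?inE.
  rewrite -[LHS](esum_pred_image v _ xpredT) ?[fun=> _]set_true//.
  by rewrite image_eq.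
rewrite (_ : esum _ _ = \sum_(i <oo) \sum_(j <oo) v (i, j)); last first.
  pose J : nat -> set (nat * nat) := fun i => [set (i, j) | j in setT].
  rewrite (_ : setT = \bigcup_k J k); last first.
    by rewrite predeqE => -[a b]; split => // _; exists a => //; exists b.
  rewrite esum_bigcupT //=; last first.
    apply/trivIsetP => i j _ _ ij.
    rewrite predeqE => -[n m] /=; split => //= -[] [_] _ [<-{n} _].
    by move=> [m' _] [] /esym/eqP; rewrite (negbTE ij).
  rewrite -(image_id [set: nat]) -fun_true esum_pred_image//; last first.
    by move=> n _; exact: esum_ge0.
  apply: eq_eseriesr => /= j _.
  rewrite -(esum_pred_image v (pair j) predT)//=; last first.
    by move=> ? ? _ _; exact: (@can_inj _ _ _ snd).
  by congr esum; rewrite predeqE => -[a b]; split; move=> [i _ <-]; exists i.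
apply: lee_nneseries => n _; first by move=> _; apply: nneseries_ge0.
exact: (PG n).2.
Qed.

HB.instance Definition _ := isOuterMeasure.Build R _ lebesgue_outer
  lebesgue_outer0 lebesgue_outer_ge0 le_lebesgue_outer
  lebesgue_outer_sigma_subadditive.

End lebesgue_outer_measure.

Notation lebesgue_space R N := (caratheodory_type (@lebesgue_outer R N)).

Section lebesgue_measure_rV.
Variables (R : realType) (N : nat).

Definition lebesgue : set (lebesgue_space R N) -> \bar R :=
  @lebesgue_outer R N.

HB.instance Definition _ := isMeasure.Build _ _ _ lebesgue
  (@caratheodory_measure0 _ _ (@lebesgue_outer R N))
  (@caratheodory_measure_ge0 _ _ (@lebesgue_outer R N))
  (@caratheodory_measure_sigma_additive _ _ (@lebesgue_outer R N)).

End lebesgue_measure_rV.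

Arguments lebesgue {R N}.

(** * Calculus on R^N *)

Section calculus.
Variables (R : realType) (N : nat).
Implicit Types (x y : 'rV[R]_N) (f : 'rV[R]_N -> R).

Definition dotv x y : R := \sum_i x 0 i * y 0 i.

(** The library norm on ['rV[R]_N] is the sup norm. *)
Definition enorm x : R := Num.sqrt (dotv x x).

Definition partial (i : 'I_N) f : 'rV[R]_N -> R := 'D_(delta_mx 0 i) f.

Definition partials (s : seq 'I_N) f : 'rV[R]_N -> R := foldr partial f s.

Definition grad f x : 'rV[R]_N := \row_i partial i f x.

(** ['D_v f x] is total, hence the separate derivability clause. *)
Definition C_k (k : nat) f : Prop :=
  (forall s : seq 'I_N, (size s <= k)%N -> continuous (partials s f)) /\
  (forall (s : seq 'I_N) (i : 'I_N) x, (size s < k)%N ->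
     derivable (partials s f) x (delta_mx 0 i)).

Definition smooth f : Prop := forall k, C_k k f.

End calculus.

Section domains.
Variables (R : realType) (N : nat).
Implicit Type Omega : set 'rV[R]_N.

Definition is_domain Omega : Prop :=
  [/\ open Omega, connected Omega & Omega !=set0].

(** Near each boundary point, and in the orthonormal coordinates
    [y = x *m Q], [Omega] is the part of R^N above the graph of a C^2
    function of the coordinates other than the [i]-th. *)
Definition has_C2_boundary Omega : Prop :=
  forall z, (closure Omega `\` interior Omega) z ->
  exists (Q : 'M[R]_N) (i : 'I_N) (gamma : 'rV[R]_N.-1 -> R) (rho : R),
    [/\ Q *m Q^T = 1%:M, C_k 2 gamma, 0 < rho &
        forall x, enorm (x - z) < rho ->
          Omega x <-> gamma (col' i (x *m Q)) < (x *m Q) 0 i].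

Definition test_function Omega (phi : 'rV[R]_N -> R) : Prop :=
  let supp := closure [set x | phi x != 0] in
  [/\ smooth phi, compact supp & supp `<=` Omega].

End domains.

(** * Musielak-Orlicz and Musielak-Orlicz-Sobolev spaces

    Functions on [Omega] are represented by functions on R^N whose values
    outside [Omega] are irrelevant. *)

Section musielak_orlicz.
Variables (R : realType) (N : nat) (Omega : set 'rV[R]_N).
Variables (p q : R) (mu : 'rV[R]_N -> R).
Implicit Types (u v : 'rV[R]_N -> R) (Du Dv : 'rV[R]_N -> 'rV[R]_N).

Definition calH (x : 'rV[R]_N) (t : R) : R := t `^ p + mu x * t `^ q.

Definition modular u : \bar R :=
  (\int[lebesgue]_(x in Omega) (calH x `|u x|)%:E)%E.

Definition in_LH u : Prop :=
  measurable_fun (Omega : set (lebesgue_space R N)) u /\ (modular u < +oo)%E.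

Definition normH u : \bar R :=
  ereal_inf [set tau%:E | tau in
    [set tau : R | 0 < tau /\ (modular (fun x => (u x / tau)%R) <= 1)%E]].

Definition weak_gradient u Du : Prop :=
  forall (phi : 'rV[R]_N -> R) (i : 'I_N), test_function Omega phi ->
    (\int[lebesgue]_(x in Omega) (u x * partial i phi x)%:E =
     - \int[lebesgue]_(x in Omega) (Du x 0 i * phi x)%:E)%E.

(** [u] belongs to W^{1,H}(Omega), with weak gradient [Du]. *)
Definition in_W1H u Du : Prop :=
  [/\ in_LH u,
      forall i, measurable_fun (Omega : set (lebesgue_space R N))
                  (fun x => Du x 0 i),
      in_LH (fun x => enorm (Du x)) &
      weak_gradient u Du].

Definition norm1H u Du : \bar R :=
  (normH (fun x => enorm (Du x)) + normH u)%E.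

(** [u] belongs to W^{1,H}_0(Omega), the closure of the test functions in
    W^{1,H}(Omega), with weak gradient [Du]. *)
Definition in_W1H0 u Du : Prop :=
  in_W1H u Du /\
  exists phi : nat -> 'rV[R]_N -> R,
    (forall n, test_function Omega (phi n)) /\
    norm1H (fun x => phi n x - u x) (fun x => grad (phi n) x - Du x)
      @[n --> \oo] --> 0%E.

(** For [a < 2] and [xi = 0] the convention [0 `^ (a - 2) = 0] is harmless,
    as the power multiplies the null vector. *)
Definition flux (x xi : 'rV[R]_N) : 'rV[R]_N :=
  enorm xi `^ (p - 2) *: xi + (mu x * enorm xi `^ (q - 2)) *: xi.

(** The equation is between extended reals, so it also says that its
    right-hand side is finite whenever the left-hand side is. *)
Definition weak_solution (g : 'rV[R]_N -> R -> 'rV[R]_N -> R) u : Prop :=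
  exists2 Du, in_W1H0 u Du &
    forall v Dv, in_W1H0 v Dv ->
      (\int[lebesgue]_(x in Omega) (dotv (flux x (Du x)) (Dv x))%:E =
       \int[lebesgue]_(x in Omega) (g x (u x) (Du x) * v x)%:E)%E.

End musielak_orlicz.

Section caratheodory_functions.
Variables (R : realType) (N : nat) (Omega : set 'rV[R]_N).

Definition caratheodory_function (g : 'rV[R]_N -> R -> 'rV[R]_N -> R) : Prop :=
  (forall s xi, measurable_fun (Omega : set (lebesgue_space R N))
                  (fun x => g x s xi)) /\
  {ae lebesgue, forall x, Omega x ->
     continuous (fun sxi : R * 'rV[R]_N => g x sxi.1 sxi.2)}.

(** [u] belongs to L^infty(Omega), that is, its extension by zero belongs to
    L^infty(R^N). *)
Definition in_Linfty (u : 'rV[R]_N -> R) : Prop :=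
  (u \_ Omega : lebesgue_space R N -> R) \in Lfun lebesgue +oo%E.

End caratheodory_functions.

(* Main.v *)
(* On W^{1,H}_0 the integrand H dominates t^p, so the classical Sobolev inequality
   with exponent s = Np/(N-p) applies to the functions of this space.  Let v be a
   smooth truncation of u at a level k >= 1, of one sign; it lies in W^{1,H}_0
   because u is a fast limit of test functions.  With v as test function, Young's
   inequality absorbs the gradient part of g and leaves the Caccioppoli estimate
     int |grad v|^p <= C Z(k),  where  Z(k) = int_{u > k} |u|^s.
   Together with Sobolev's inequality it gives Z(k_(n+1)) <= A b^n Z(k_n)^(s/p)
   along levels k_n increasing from K to 2K.  As s/p > 1 and Z(K) tends to 0 when
   K grows, De Giorgi's iteration yields Z(2K) = 0, that is, u <= 2K almost
   everywhere; the same holds for -u.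

   Sobolev's inequality for test functions follows from the Gagliardo-Nirenberg
   inequality, proved by induction on the coordinates for iterated one-dimensional
   integrals; these compute the Lebesgue integral of R^N as both agree on boxes. *)

From HB Require Import structures.
Require Import Defs.
From mathcomp Require Import all_boot all_order all_algebra.
From mathcomp Require Import all_classical all_reals all_analysis.
From mathcomp Require Import measurable_realfun ess_sup_inf ring lra.
Set Implicit Arguments.
Unset Strict Implicit.
Unset Printing Implicit Defensive.
Import Order.TTheory GRing.Theory Num.Def Num.Theory.
Import numFieldNormedType.Exports.
Local Open Scope classical_set_scope.
Local Open Scope ring_scope.

(** * Iterated integrals *)

(** The exponent r may be critical, r = s, so the starting point is only |u|^s in L^1. This is why
    the iteration runs on the integral of |u|^s itself over superlevel sets: after Young's
    inequality the growth of g produces exactly this quantity, and dominated convergence alone makes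
    it small. Membership in W^{1,H}_0 means approximation by test functions. A truncation that is
    smooth and vanishes at 0 maps test functions to test functions, so the truncated approximants
    approximate the truncated function and no mollification is involved. The price is a derivative
    strictly between 0 and 1 just above the level; the truncation is shaped so that its value is
    still controlled by |u| times that derivative, which is what the absorption of the gradient term
    requires. The Lebesgue sigma-algebra is complete and hence not a product of one-dimensional
    ones. Tonelli's theorem is therefore used on the sigma-algebra generated by the boxes, and
    carried over to Lebesgue measure by uniqueness of measures. *)

Notation borel_rV R N := (g_sigma_algebraType (range (@box R N))).

Section borel_rV.
Variables (R : realType) (N : nat).
Local Notation borel_rV := (borel_rV R N).

Lemma measurable_box c : measurable (box c : set borel_rV).
Proof. by apply: sub_sigma_algebra; exists c. Qed.

Lemma measurable_fun_borel_rV d (T : measurableType d) (f : T -> borel_rV) :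
  (forall c, measurable (f @^-1` box c)) -> measurable_fun setT f.
Proof.
move=> fbox; apply: (@measurability _ _ _ borel_rV setT f (range (@box R N))) => //.
by move=> _ [_ [c _ <-] <-]; rewrite setTI.
Qed.

Lemma coord_bound (x : 'rV[R]_N) : exists k : nat, forall j, `|x 0 j| < k%:R.
Proof.
pose m j := Num.bound `|x 0 j|.
exists (\max_(j < N) m j)%N => j.
apply: (@lt_le_trans _ _ (m j)%:R); last by rewrite ler_nat leq_bigmax.
exact: archi_boundP.
Qed.

Lemma measurable_coord (i : 'I_N) :
  measurable_fun setT (fun x : borel_rV => x 0 i).
Proof.
apply: (measurability (@RGenOInfty.G R)).
  exact: RGenOInfty.measurableE.
move=> _ [_ [c ->] <-]; rewrite setTI.
rewrite (_ : _ @^-1` _ = \bigcup_k (box (Some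
   (\row_j (if j == i then c else - k%:R), const_mx k%:R)) : set borel_rV)).
  by apply: bigcupT_measurable => k; exact: measurable_box.
apply/seteqP; split=> [x /= |x [k _] /= /(_ i)]; last first.
  by rewrite !mxE eqxx in_itv/= andbT => /andP[].
rewrite in_itv/= andbT => cx.
have [k xk] := coord_bound x.
exists k => // j; rewrite !mxE.
have := xk j; rewrite ltr_norml => /andP[h1 h2].
by case: eqP => [->|_]; rewrite ?h1 ?(ltW h2)// cx; have := xk i;
  rewrite ltr_norml => /andP[_ /ltW ->].
Qed.

Definition upd (x : 'rV[R]_N) (i : 'I_N) (t : R) : 'rV[R]_N :=
  \row_j (if j == i then t else x 0 j).

Lemma upd_upd x i s t : upd (upd x i s) i t = upd x i t.
Proof. by apply/rowP => j; rewrite !mxE; case: (j == i). Qed.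

Lemma updC x i j s t : i != j -> upd (upd x i s) j t = upd (upd x j t) i s.
Proof.
move=> ij; apply/rowP => k; rewrite !mxE.
case: ifP => // /eqP ->; case: ifP => // /eqP ji.
by rewrite ji eqxx in ij.
Qed.

Lemma upd_id x i : upd x i (x 0 i) = x.
Proof. by apply/rowP => j; rewrite !mxE; case: eqP => [->|]. Qed.

Lemma measurable_upd d (T : measurableType d) (i : 'I_N) (f : T -> borel_rV)
    (g : T -> R) : measurable_fun setT f -> measurable_fun setT g ->
  measurable_fun setT (fun z => upd (f z) i (g z) : borel_rV).
Proof.
move=> mf mg; apply: measurable_fun_borel_rV => -[[a b]|]; last first.
  by rewrite /= preimage_set0.
rewrite (_ : _ @^-1` _ = \big[setI/setT]_(j : 'I_N)
    ((fun z => if j == i then g z else f z 0 j) @^-1` `]a 0 j, b 0 j]%classic)).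
  apply: bigsetI_measurable => j _; rewrite -[X in measurable X]setTI.
  have : measurable_fun setT (fun z => if j == i then g z else f z 0 j).
    case: (j == i) => //.
    exact: (measurableT_comp (measurable_coord j)).
  by apply.
apply/seteqP; split=> [z /= zab|z].
  rewrite -bigcap_seq => j _ /=; rewrite in_itv/=.
  by have := zab j; rewrite !mxE.
rewrite -bigcap_seq => zab j; have := zab j; rewrite !mxE/= in_itv/=.
by apply; rewrite mem_index_enum.
Qed.

End borel_rV.

Section tonelli_swap.
Context d1 d2 (T1 : measurableType d1) (T2 : measurableType d2) (R : realType).
Variable m1 : {sigma_finite_measure set T1 -> \bar R}.
Variable m2 : {sigma_finite_measure set T2 -> \bar R}.
Local Open Scope ereal_scope.

Lemma tonelli_swap (f : T1 -> T2 -> \bar R) :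
  measurable_fun setT (fun z : T1 * T2 => f z.1 z.2) ->
  (forall t u, 0 <= f t u) ->
  \int[m1]_t \int[m2]_u f t u = \int[m2]_u \int[m1]_t f t u.
Proof.
move=> mf f0; exact: (@fubini_tonelli _ _ _ _ _ m1 m2 _ mf (fun=> f0 _ _)).
Qed.

End tonelli_swap.

Section iterated_integral.
Variables (R : realType) (N : nat).
Local Notation T := (borel_rV R N).
Local Notation RM := (measurableTypeR R).
Variable leb : {sigma_finite_measure set (measurableTypeR R) -> \bar R}.
Local Open Scope ereal_scope.
Implicit Types (i j : 'I_N) (s : seq 'I_N) (x : T) (F G : T -> \bar R).

(** The result stays a function of all N coordinates, constant in the i-th one, so that successive
    integrations never change the dimension. *)
Definition int1 i F x : \bar R := \int[leb]_t F (upd x i t).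

(* Integration along the coordinates listed in [s], the others being frozen at
   their value in [x]: for [s] an enumeration of all the coordinates this is the
   integral over R^N, for [s] empty the evaluation at [x]. *)
Definition iter_int s F : T -> \bar R := foldr int1 F s.

Lemma int1_ge0 i F : (forall x, 0 <= F x) -> forall x, 0 <= int1 i F x.
Proof. by move=> F0 x; apply: integral_ge0. Qed.

Lemma measurable_upd2 x i j :
  measurable_fun [set: RM * RM] (fun z => upd (upd x i z.1) j z.2 : T).
Proof.
by do ! apply: measurable_upd => //.
Qed.

Lemma measurable_upd1 x i : measurable_fun setT (fun t : R => upd x i t : T).
Proof. exact: measurable_upd. Qed.

Lemma measurable_int1 i F : (forall x, 0 <= F x) -> measurable_fun setT F ->
  measurable_fun setT (int1 i F).
Proof.
move=> F0 mF; apply: (@measurable_fun_fubini_tonelli_F _ _ _ _ _ leb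
   (fun z : T * R => F (upd z.1 i z.2))) => //.
by apply: (measurableT_comp mF); exact: measurable_upd.
Qed.

Lemma measurable_upd_comp x i F : measurable_fun setT F ->
  measurable_fun setT (fun t : R => F (upd x i t)).
Proof. by move=> mF; apply: (measurableT_comp mF); exact: measurable_upd1. Qed.

Lemma iter_int_ge0 s F : (forall x, 0 <= F x) -> forall x, 0 <= iter_int s F x.
Proof. by move=> F0; elim: s => //= i s IH; exact: int1_ge0. Qed.

Lemma measurable_iter_int s F : (forall x, 0 <= F x) ->
  measurable_fun setT F -> measurable_fun setT (iter_int s F).
Proof.
move=> F0 mF; elim: s => //= i s IH; apply: measurable_int1 => //.
exact: iter_int_ge0.
Qed.

Lemma int1_upd i F x t : int1 i F (upd x i t) = int1 i F x.
Proof. by apply: eq_integral => u _; rewrite upd_upd. Qed.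

Lemma int1C i j F x : i != j -> (forall x, 0 <= F x) -> measurable_fun setT F ->
  int1 i (int1 j F) x = int1 j (int1 i F) x.
Proof.
move=> ij F0 mF.
have mG : measurable_fun [set: RM * RM] (fun z => F (upd (upd x i z.1) j z.2)).
  by apply: (measurableT_comp mF); exact: measurable_upd2.
have fubini := @tonelli_swap _ _ _ _ _ leb leb
  (fun t u => F (upd (upd x i t) j u)) mG (fun t u => F0 _).
rewrite /int1; apply: etrans fubini _.
by apply: eq_integral => u _; apply: eq_integral => t _; rewrite updC.
Qed.

Lemma iter_int1C s i F x : i \notin s -> (forall x, 0 <= F x) ->
  measurable_fun setT F -> iter_int s (int1 i F) x = int1 i (iter_int s F) x.
Proof.
move=> + F0 mF; elim: s x => //= j s IH x; rewrite inE negb_or => /andP[ij si].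
rewrite -int1C ?(eq_sym j)//; last 2 first.
- exact: iter_int_ge0.
- exact: measurable_iter_int.
by apply: eq_integral => t _; rewrite IH.
Qed.

Lemma iter_int_nneseries s (F : (T -> \bar R)^nat) x :
  (forall n x, 0 <= F n x) -> (forall n, measurable_fun setT (F n)) ->
  iter_int s (fun x => \sum_(n <oo) F n x) x = \sum_(n <oo) iter_int s (F n) x.
Proof.
move=> F0 mF; elim: s x => //= i s IH x.
rewrite /int1; under eq_integral do rewrite IH.
rewrite integral_nneseries// => n.
  by apply: measurable_upd_comp; exact: measurable_iter_int.
by move=> t _; exact: iter_int_ge0.
Qed.

Lemma iter_int0 s x : iter_int s (cst 0) x = 0.
Proof.
by elim: s x => //= i s IH x; rewrite /int1; under eq_integral do rewrite IH;
  rewrite integral0.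
Qed.

Lemma iter_intZ s (k : R) F x : (0 <= k)%R -> (forall x, 0 <= F x) ->
  measurable_fun setT F ->
  iter_int s (fun x => k%:E * F x) x = k%:E * iter_int s F x.
Proof.
move=> k0 F0 mF; elim: s x => //= i s IH x.
rewrite /int1; under eq_integral do rewrite IH.
rewrite ge0_integralZl//.
- by apply: measurable_upd_comp; exact: measurable_iter_int.
- by move=> t _; exact: iter_int_ge0.
Qed.

Lemma eq_iter_int s F G x : F =1 G -> iter_int s F x = iter_int s G x.
Proof. by move=> /funext ->. Qed.

Lemma iter_int_fsum s (I : choiceType) (A : set I) (F : I -> T -> \bar R) x :
  finite_set A -> (forall k x, 0 <= F k x) ->
  (forall k, measurable_fun setT (F k)) ->
  iter_int s (fun x => \sum_(k \in A) F k x) x = \sum_(k \in A) iter_int s (F k) x.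
Proof.
move=> Afin F0 mF; elim: s x => //= i s IH x.
rewrite /int1; under eq_integral do rewrite IH.
rewrite ge0_integral_fsum// => k.
  by apply: measurable_upd_comp; exact: measurable_iter_int.
by move=> t _; exact: iter_int_ge0.
Qed.

Lemma le_iter_int s F G x : (forall x, 0 <= F x) -> measurable_fun setT F ->
  (forall x, 0 <= G x) -> measurable_fun setT G ->
  (forall x, F x <= G x) -> iter_int s F x <= iter_int s G x.
Proof.
move=> F0 mF G0 mG FG; elim: s x => //= i s IH x.
apply: ge0_le_integral => //.
- by move=> t _; exact: iter_int_ge0.
- by apply: measurable_upd_comp; exact: measurable_iter_int.
- by apply: measurable_upd_comp; exact: measurable_iter_int.
Qed.

Lemma cvg_iter_int s (F : (T -> \bar R)^nat) G x :
  (forall n x, 0 <= F n x) -> (forall n, measurable_fun setT (F n)) ->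
  (forall x, nondecreasing_seq (F ^~ x)) ->
  (forall x, F n x @[n --> \oo] --> G x) ->
  iter_int s (F n) x @[n --> \oo] --> iter_int s G x.
Proof.
move=> F0 mF ndF FG; elim: s x => //= i s IH x.
have -> : int1 i (iter_int s G) x =
    \int[leb]_t limn (fun n => iter_int s (F n) (upd x i t)).
  by apply: eq_integral => t _; apply/esym/cvg_lim => //; exact: IH.
apply: cvg_monotone_convergence => //.
- by move=> n; apply: measurable_upd_comp; exact: measurable_iter_int.
- by move=> n t _; exact: iter_int_ge0.
- by move=> t _ m n mn; apply: le_iter_int => // y; exact: ndF.
Qed.

(** When [s] omits coordinates, this measures the slice of [A] through [x] parallel to the
    coordinates in [s]. *)
Definition iter_measure s x (A : set T) : \bar R :=
  iter_int s (fun y => (\1_A y)%:E) x.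

Section iter_measure_is_measure.
Variables (s : seq 'I_N) (x : T).

Let m0 : iter_measure s x set0 = 0.
Proof.
rewrite /iter_measure -(iter_int0 s x); apply: eq_iter_int => y.
by rewrite indic0.
Qed.

Let m_ge0 A : 0 <= iter_measure s x A.
Proof. by apply: iter_int_ge0 => y; rewrite lee_fin. Qed.

Let m_sigma_additive : semi_sigma_additive (iter_measure s x).
Proof.
move=> F mF tF mUF.
rewrite /iter_measure.
under [in X in _ --> X]eq_iter_int do rewrite indic_bigcup//.
rewrite iter_int_nneseries//.
- by apply: is_cvg_nneseries => n _ _; apply: iter_int_ge0 => y; rewrite lee_fin.
by move=> n; apply/measurable_EFinP; exact: measurable_indic.
Qed.

HB.instance Definition _ := isMeasure.Build _ _ _ (iter_measure s x)
  m0 m_ge0 m_sigma_additive.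

End iter_measure_is_measure.

Import HBNNSimple.

Lemma iter_int_nnsfun s x (f : {nnsfun T >-> R}) :
  iter_int s (EFin \o f) x = \int[iter_measure s x]_y (f y)%:E.
Proof.
rewrite integralT_nnsfun sintegralE.
have fE y : (f y)%:E = \sum_(r \in range f) r%:E * (\1_(f @^-1` [set r]) y)%:E.
  by rewrite {1}fimfunE -fsumEFin//; under eq_fsbigr do rewrite EFinM.
have mf r : measurable_fun setT (fun y => (\1_(f @^-1` [set r]) y)%:E).
  by apply/measurable_EFinP; exact: measurable_indic.
rewrite (eq_iter_int s x fE) iter_int_fsum//.
- by apply: eq_fsbigr => r; rewrite inE => -[y _ <-]; rewrite iter_intZ.
- move=> r y; exact: nnfun_muleindic_ge0.
- by move=> r; exact: measurable_funeM.
Qed.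

(** For indicators this is the definition of [iter_measure]; linearity and monotone convergence,
    valid on both sides, extend it to simple functions and then to nonnegative ones. Results on
    measures, such as Hölder's inequality, thereby apply to iterated integrals. *)
Lemma iter_intE s x F : (forall x, 0 <= F x) -> measurable_fun setT F ->
  iter_int s F x = \int[iter_measure s x]_y F y.
Proof.
move=> F0 mF; pose f := nnsfun_approx measurableT mF.
have mf n : measurable_fun setT (EFin \o f n) by apply/measurable_EFinP.
have f0 n y : 0 <= (EFin \o f n) y by rewrite lee_fin.
have ndf y : nondecreasing_seq (fun n => (EFin \o f n) y).
  by move=> m n mn; rewrite lee_fin; exact/lefP/nd_nnsfun_approx.
have fF y : (EFin \o f n) y @[n --> \oo] --> F y.
  exact: cvg_nnsfun_approx.
have /cvg_lim <- // := @cvg_iter_int s _ F x f0 mf ndf fF.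
under eq_fun do rewrite iter_int_nnsfun.
rewrite -monotone_convergence//.
- by apply: eq_integral => y _; apply/cvg_lim => //; exact: fF.
- by move=> n y _; exact: f0.
- by move=> y _; exact: ndf.
Qed.

End iterated_integral.

(** * Comparison with the Lebesgue measure of R^N *)

Section box_measure.
Variables (R : realType) (N : nat).
Local Notation leb := (@lebesgue_measure R :
  {sigma_finite_measure set (measurableTypeR R) -> \bar R}).
Local Notation T := (borel_rV R N).
Local Notation RM := (measurableTypeR R).
Local Open Scope ereal_scope.

(** The general [s] serves the induction: a coordinate not yet integrated contributes an indicator,
    which its own integration turns into a side length. *)
Lemma iter_measure_box (s : seq 'I_N) (a b : 'rV[R]_N) x : uniq s ->
  iter_measure leb s x (box (Some (a, b))) =
  ((\prod_(i <- s) maxr 0 (b 0 i - a 0 i)) *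
   \prod_(i | i \notin s) \1_(`]a 0 i, b 0 i]%classic) (x 0 i))%:E.
Proof.
rewrite /iter_measure; elim: s x => [x _|i s IH x /= /andP[i_s us]].
  rewrite /= big_nil mul1r; congr EFin.
  rewrite indicE; have [xab|xab] := pselect (box (Some (a, b)) x).
    rewrite mem_set//.
    rewrite big1// => i _; rewrite indicE mem_set//= in_itv/=.
    exact: xab.
  have [i xi] : exists i, ~ (a 0 i < x 0 i <= b 0 i)%R.
    by apply/not_existsP => xi; apply: xab => i; apply: contrapT; exact: xi.
  rewrite memNset// (bigD1 i)//= indicE memNset ?mul0r//= in_itv/=.
rewrite /int1; under eq_integral do rewrite IH//.
pose c := (\prod_(j <- s) maxr 0 (b 0 j - a 0 j) *
   \prod_(j | j \notin i :: s) \1_(`]a 0 j, b 0 j]%classic) (x 0 j))%R.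
transitivity (\int[leb]_t (c%:E * (\1_(`]a 0%R i, b 0%R i]%classic) t)%:E)).
  apply: eq_integral => t _; rewrite -EFinM; congr EFin.
  rewrite (bigD1 i)//= mxE eqxx [RHS]mulrAC -mulrA; congr (_ * (_ * _))%R.
  by apply: eq_big => [j|j /andP[_ /negbTE ji]];
    rewrite ?inE ?negb_or 1?andbC// mxE ji.
rewrite ge0_integralZl//; last 2 first.
- by apply/measurable_EFinP; exact: measurable_indic.
- rewrite lee_fin mulr_ge0//; apply: prodr_ge0 => j _ //.
  by rewrite le_max lexx.
rewrite integral_indic// setIT.
rewrite [X in c%:E * X](_ : _ = lebesgue_measure `]a 0%R i, b 0%R i]%classic)//.
rewrite lebesgue_measure_itv/= lte_fin.
rewrite big_cons -mulrA -/c mulrC -EFinD.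
case: ifPn => ab; first by rewrite -EFinM max_r// subr_ge0 ltW.
by rewrite max_l ?mulr0 ?mule0// subr_le0 leNgt.
Qed.

End box_measure.

Section lebesgue_borel.
Variables (R : realType) (N : nat).
Local Notation T := (borel_rV R N).
Local Notation leb := (@lebesgue_measure R :
  {sigma_finite_measure set (measurableTypeR R) -> \bar R}).
Local Open Scope ereal_scope.

Lemma iter_measure_boxE (s : seq 'I_N) c x : perm_eq s (enum 'I_N) ->
  iter_measure leb s x (box c) = (box_volume c)%:E.
Proof.
move=> sN; have us : uniq s by rewrite (perm_uniq sN) enum_uniq.
have smem i : i \in s by rewrite (perm_mem sN) mem_enum.
case: c => [[a b]|]; last by rewrite /= measure0.
rewrite iter_measure_box// [X in (_ * X)%R]big1 ?mulr1; last first.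
  by move=> i; rewrite smem.
by rewrite (perm_big _ sN)/= big_enum.
Qed.

(** The nontrivial inequality bounds the volume of a box by that of a countable cover. No
    compactness argument is involved: [iter_measure] is a measure that gives each box its volume,
    and measures are countably subadditive. *)
Lemma lebesgue_outer_box (c : option ('rV[R]_N * 'rV[R]_N)) :
  lebesgue_outer (box c) = (box_volume c)%:E.
Proof.
apply/eqP; rewrite eq_le; apply/andP; split.
  apply: ereal_inf_lbound; exists (fun k => if k == 0%N then c else None).
    by move=> x cx; exists 0%N.
  rewrite (nneseries_split 0 1); last by move=> k _; exact: box_volume_ge0.
  by rewrite add0n big_nat1 eseries0 ?adde0// => -[].
apply: le_ereal_inf_tmp => _ [B cB <-].
pose m := iter_measure leb (enum 'I_N) (0%R : T).
have mE c' : (box_volume c')%:E = m (box c') by rewrite /m iter_measure_boxE.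
rewrite mE; under eq_eseriesr do rewrite mE.
apply: measure_sigma_subadditive => //.
- by move=> k; exact: measurable_box.
- exact: measurable_box.
Qed.

(** A hyperplane cuts each box of a cover into two boxes whose volumes add up, so a cover of [X]
    splits into covers of its two parts with the same total volume. *)
Lemma caratheodory_halfspace (i : 'I_N) (c : R) :
  measurable ([set x | (x 0 i <= c)%R] : set (lebesgue_space R N)).
Proof.
apply: le_caratheodory_measurable => X /=.
apply: le_ereal_inf_tmp => _ [B XB <-].
pose lo (c' : option ('rV[R]_N * 'rV[R]_N)) := if c' is Some (a, b) then
   Some (a, \row_j (if j == i then minr (b 0 i) c else b 0 j)%R) else None.
pose hi (c' : option ('rV[R]_N * 'rV[R]_N)) := if c' is Some (a, b) then
   Some (\row_j (if j == i then maxr (a 0 i) c else a 0 j)%R, b) else None.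
have volE c' : (box_volume c' = box_volume (lo c') + box_volume (hi c'))%R.
  case: c' => [[a b]|]/=; last by rewrite addr0.
  rewrite (bigD1 i)//= [X in (_ = X + _)%R](bigD1 i)//=.
  rewrite [X in (_ = _ + X)%R](bigD1 i)//= !mxE eqxx.
  under [X in (_ = _ * X + _)%R]eq_bigr => j /negbTE ji do rewrite mxE ji.
  under [X in (_ = _ + _ * X)%R]eq_bigr => j /negbTE ji do rewrite mxE ji.
  rewrite -mulrDl; congr (_ * _)%R.
  rewrite /minr /maxr; do ! case: ifPn; rewrite -?leNgt; lra.
under eq_eseriesr do rewrite volE EFinD.
rewrite nneseriesD; last 2 first.
- by move=> k _ _; exact: box_volume_ge0.
- by move=> k _ _; exact: box_volume_ge0.
apply: leeD.
- apply: ereal_inf_lbound; exists (lo \o B) => // x [Xx /= xc].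
  have [k _ Bx] := XB x Xx; exists k => //=; move: Bx.
  case: (B k) => [[a b] /= + j|//]; move=> /(_ j); rewrite mxE.
  by case: eqP => [->|//]; rewrite le_min xc andbT.
- apply: ereal_inf_lbound; exists (hi \o B) => // x [Xx /= /negP xc].
  have [k _ Bx] := XB x Xx; exists k => //=; move: Bx.
  case: (B k) => [[a b] /= + j|//]; move=> /(_ j); rewrite mxE.
  by case: eqP => [->|//]; rewrite gt_max (ltNge c) xc andbT.
Qed.

Lemma measurable_lebesgue_box (c : option ('rV[R]_N * 'rV[R]_N)) :
  measurable (box c : set (lebesgue_space R N)).
Proof.
case: c => [[a b]|]; last exact: measurable0.
rewrite (_ : box _ = \big[setI/(setT : set 'rV[R]_N)]_(i < N)
  (~` [set x : 'rV[R]_N | (x 0 i <= a 0 i)%R] `&`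
   [set x : 'rV[R]_N | (x 0 i <= b 0 i)%R])).
  apply: (@bigsetI_measurable _ (lebesgue_space R N)) => i _.
  apply: measurableI; last exact: caratheodory_halfspace.
  by apply: measurableC; exact: caratheodory_halfspace.
apply/seteqP; split=> [x /= xab|x]; rewrite -bigcap_seq.
  by move=> i _ /=; have /andP[/lt_geF -> ->] := xab i.
move=> xab i; have [|/= /negP] := xab i; first by rewrite /= mem_index_enum.
by rewrite -ltNge => ->.
Qed.

Lemma measurable_lebesgue_borel (A : set 'rV[R]_N) :
  measurable (A : set T) -> measurable (A : set (lebesgue_space R N)).
Proof.
apply: smallest_sub; first exact: sigma_algebra_measurable.
by move=> _ [c _ <-]; exact: measurable_lebesgue_box.
Qed.

Lemma measurable_fun_lebesgue_borel d (Y : sigmaRingType d) (f : 'rV[R]_N -> Y) :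
  measurable_fun (setT : set T) f ->
  measurable_fun (setT : set (lebesgue_space R N)) f.
Proof.
move=> mf _ A mA; rewrite setTI; apply: measurable_lebesgue_borel.
by rewrite -[X in measurable X]setTI; exact: mf.
Qed.

(** The two measures to be compared live on different sigma-algebras; pushing [lebesgue] forward
    along this identity brings it to the Borel one. *)
Let id_borel : lebesgue_space R N -> T := idfun.

Let measurable_id_borel : measurable_fun setT id_borel.
Proof.
by move=> _ A mA; rewrite setTI; exact: measurable_lebesgue_borel.
Qed.

(** Boxes are stable under intersection, both measures give them their volume, and the cubes [g k]
    exhaust the space with finite measure: uniqueness of measures applies. *)
Lemma lebesgue_iter_measure s x (A : set T) : perm_eq s (enum 'I_N) ->
  measurable A -> lebesgue A = iter_measure leb s x A.
Proof.
move=> sN mA.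
pose g (k : nat) : set T := box (Some (const_mx (- k%:R)%R, const_mx k%:R%R)).
apply: (@measure_unique _ R T (range (@box R N)) g _ _ _ _
   (pushforward lebesgue id_borel) (iter_measure leb s x)) => //.
- move=> _ _ [[[a b]|] _ <-] [[[c d]|] _ <-]; last 3 first.
  + by exists None => //=; rewrite setI0.
  + by exists None => //=; rewrite set0I.
  + by exists None => //=; rewrite set0I.
  exists (Some (\row_i maxr (a 0 i) (c 0 i), \row_i minr (b 0 i) (d 0 i)))%R => //=.
  apply/seteqP; split=> [y /= ycd|y [/= yab ycd] i]; last first.
    by rewrite !mxE gt_max le_min; have /andP[-> ->] := yab i; exact: ycd.
  by split=> i; have := ycd i; rewrite !mxE gt_max le_min =>
    /andP[/andP[ai ci] /andP[bi di]]; apply/andP.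
- apply/seteqP; split=> // y _; have [k yk] := coord_bound y.
  exists k => // i; rewrite !mxE; have := yk i.
  by rewrite ltr_norml => /andP[-> /ltW ->].
- move=> _ [c _ <-]; apply: etrans (lebesgue_outer_box c) _.
  exact/esym/iter_measure_boxE.
- move=> k; have /= := lebesgue_outer_box
    (Some (const_mx (- k%:R)%R, const_mx k%:R%R) : option ('rV[R]_N * 'rV[R]_N)).
  by rewrite /pushforward /lebesgue => ->; rewrite ltry.
Qed.

(** The order of the coordinates is free, and the one listed last is integrated first; any chosen
    variable can thus be made the innermost. *)
Lemma integral_lebesgue_iter s x (F : 'rV[R]_N -> \bar R) :
  perm_eq s (enum 'I_N) -> (forall y, 0 <= F y) ->
  measurable_fun (setT : set T) F ->
  \int[lebesgue]_y F y = iter_int leb s F x.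
Proof.
move=> sN F0 mF; rewrite iter_intE//.
transitivity (\int[pushforward lebesgue id_borel]_(y in (setT : set T)) F y).
  by rewrite ge0_integral_pushforward.
apply: eq_measure_integral => A mA _.
exact: lebesgue_iter_measure.
Qed.

End lebesgue_borel.

(** * The Gagliardo-Nirenberg inequality *)

Section ge0_hoelder.
Context d (T : measurableType d) (R : realType).
Variable mu : {measure set T -> \bar R}.
Local Open Scope ereal_scope.

Lemma le_poweR (x y : \bar R) a : (0 <= a)%R -> 0 <= x -> x <= y ->
  x `^ a <= y `^ a.
Proof.
move=> a0 x0 xy; apply: gt0_ler_poweR => //; rewrite in_itv/= ?leey ?x0//.
by rewrite (le_trans x0 xy).
Qed.

Lemma measurable_EFin_powR (f : T -> R) a D : measurable_fun D f ->
  measurable_fun D (fun y => (f y `^ a)%:E).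
Proof.
move=> mf; apply/measurable_EFinP.
exact: (measurableT_comp (measurable_powR a) mf).
Qed.

Lemma ge0_hoelder (f h : T -> R) (a b : R) :
  measurable_fun setT f -> measurable_fun setT h ->
  (forall y, 0 <= f y)%R -> (forall y, 0 <= h y)%R ->
  (0 < a)%R -> (0 < b)%R -> (a^-1 + b^-1 = 1)%R ->
  \int[mu]_y (f y * h y)%:E <=
  (\int[mu]_y (f y `^ a)%:E) `^ a^-1 * (\int[mu]_y (h y `^ b)%:E) `^ b^-1.
Proof.
move=> mf mh f0 h0 a0 b0 ab.
have E1 : \int[mu]_y (f y * h y)%:E = Lnorm mu 1 (EFin \o (f \* h)%R).
  by rewrite Lnorm1; apply: eq_integral => y _ /=; rewrite ger0_norm ?mulr_ge0.
have E2 (g : T -> R) c : (forall y, 0 <= g y)%R ->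
    (\int[mu]_y (g y `^ c)%:E) `^ c^-1 = Lnorm mu c%:E (EFin \o g).
  move=> g0; rewrite unlock; apply: (congr1 (fun z => z `^ c^-1)).
  by apply: eq_integral => y _ /=; rewrite ger0_norm.
by rewrite E1 !E2//; exact: hoelder.
Qed.

End ge0_hoelder.

Section gagliardo_nirenberg.
Variables (R : realType) (N : nat).
Local Notation T := (borel_rV R N).
Variable leb : {sigma_finite_measure set (measurableTypeR R) -> \bar R}.
Variables (psi : T -> R) (S : 'I_N -> T -> R).
Hypotheses (mpsi : measurable_fun setT psi) (psi0 : forall x, 0 <= psi x).
Hypotheses (mS : forall i, measurable_fun setT (S i)).
Hypothesis S0 : forall i x, 0 <= S i x.
Local Open Scope ereal_scope.
(** All that is kept from calculus: when [S i] is the absolute value of the i-th partial derivative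
    of a compactly supported [psi], the fundamental theorem of calculus along a line gives this
    bound. *)
Hypothesis psiS : forall i x, (psi x)%:E <= int1 leb i (EFin \o S i) x.

Let sumS (s : seq 'I_N) x : \bar R := \sum_(i <- s) (S i x)%:E.

Let sumS_ge0 s x : 0 <= sumS s x.
Proof. by apply: sume_ge0 => i _; rewrite lee_fin. Qed.

Let msumS s : measurable_fun setT (sumS s).
Proof.
by apply: emeasurable_sum => i; apply/measurable_EFinP; exact: mS.
Qed.

Lemma iter_int_hoelder (s : seq 'I_N) x (f h : T -> R) (a b : R) :
  measurable_fun setT f -> measurable_fun setT h ->
  (forall y, 0 <= f y)%R -> (forall y, 0 <= h y)%R ->
  (0 < a)%R -> (0 < b)%R -> (a^-1 + b^-1 = 1)%R ->
  iter_int leb s (fun y => (f y * h y)%:E) x <=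
  iter_int leb s (fun y => (f y `^ a)%:E) x `^ a^-1 *
  iter_int leb s (fun y => (h y `^ b)%:E) x `^ b^-1.
Proof.
move=> mf mh f0 h0 a0 b0 ab.
rewrite !iter_intE; last 6 first.
- by move=> y; rewrite lee_fin powR_ge0.
- exact: measurable_EFin_powR.
- by move=> y; rewrite lee_fin powR_ge0.
- exact: measurable_EFin_powR.
- by move=> y; rewrite lee_fin mulr_ge0.
- by apply/measurable_EFinP; exact: measurable_funM.
exact: ge0_hoelder.
Qed.

(* Duality form of the inequality in the variables [s]; its case [h = psi^(1/k)],
   integrated in one more variable [i], gives the exponent [(k + 1) / k]. *)
Let dual_bound (s : seq 'I_N) := forall x (h : T -> R),
  measurable_fun setT h -> (forall y, 0 <= h y)%R ->
  iter_int leb s (fun y => (psi y * h y)%:E) x <=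
  iter_int leb s (sumS s) x *
  iter_int leb s (fun y => (h y `^ (size s)%:R)%:E) x `^ (size s)%:R^-1.

Let iter_sumS_ge0 s t x : 0 <= iter_int leb s (sumS t) x.
Proof. exact: iter_int_ge0. Qed.

(** The integral of [S i] over a line bounds [psi] at every point of that line, so it factors
    out. *)
Let dual_bound1 i : dual_bound [:: i].
Proof.
move=> x h mh h0 /=; rewrite invr1 poweRe1; last first.
  by apply: int1_ge0 => y; rewrite lee_fin powR_ge0.
have mh' : measurable_fun setT (fun y => (h y `^ 1)%:E).
  exact: measurable_EFin_powR.
rewrite -ge0_integralZl//; last 3 first.
- exact: (measurable_upd_comp x i mh').
- by move=> t _; rewrite lee_fin powR_ge0.
- exact: int1_ge0.
have mph : measurable_fun setT (fun y => (psi y * h y)%:E).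
  by apply/measurable_EFinP; exact: measurable_funM.
apply: ge0_le_integral => //.
- by move=> t _; rewrite lee_fin mulr_ge0.
- exact: (measurable_upd_comp x i mph).
- by apply: measurable_funeM; exact: (measurable_upd_comp x i mh').
- move=> t _; rewrite EFinM powRr1//; apply: lee_wpmul2r; first by rewrite lee_fin.
  rewrite (_ : sumS [:: i] = EFin \o S i); last first.
    by apply/funext => y; rewrite /sumS big_seq1.
  by rewrite -(int1_upd leb i _ x t); exact: psiS.
Qed.

Let gn_step i s x : (0 < size s)%N -> i \notin s -> dual_bound s ->
  iter_int leb (i :: s) (fun y => (psi y `^ ((size s).+1%:R / (size s)%:R))%:E) x
  <= iter_int leb (i :: s) (sumS (i :: s)) x `^ ((size s).+1%:R / (size s)%:R).
Proof.
move=> s0 si ds.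
set k := (size s)%:R : R.
have k0 : (0 < k)%R by rewrite ltr0n.
have kE : ((size s).+1%:R / k = 1 + k^-1)%R.
  by rewrite -natr1 -/k mulrDl divff ?gt_eqF// mul1r.
have k'0 : (0 < k^-1)%R by rewrite invr_gt0.
have mSi : measurable_fun setT (EFin \o S i) by apply/measurable_EFinP; exact: mS.
have Si0 y : 0 <= (EFin \o S i) y by rewrite lee_fin S0.
have mpsi' : measurable_fun setT (fun y => (psi y)%:E) by apply/measurable_EFinP.
have psi'0 y : 0 <= (psi y)%:E by rewrite lee_fin.
pose A := iter_int leb (i :: s) (sumS (i :: s)) x.
pose B := iter_int leb (i :: s) (EFin \o S i) x.
have B0 : 0 <= B by exact: iter_int_ge0.
have mEs : measurable_fun setT (iter_int leb s (sumS s)).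
  exact: measurable_iter_int.
(* With h = psi^(1/k) the last factor of the dual bound is a power of the integral of [psi] over
   [s]. By [psiS] that integral is at most [B], which does not depend on t. Afterwards both factors
   are enlarged to [A], and the exponents 1 and 1/k add up. *)
apply: (@le_trans _ _
    (\int[leb]_t (iter_int leb s (sumS s) (upd x i t) * B `^ k^-1))).
  apply: ge0_le_integral => //.
  - by move=> t _; apply: iter_int_ge0 => y; rewrite lee_fin powR_ge0.
  - apply: measurable_upd_comp; apply: measurable_iter_int => //.
      by move=> y; rewrite lee_fin powR_ge0.
    exact: measurable_EFin_powR.
  - by apply: emeasurable_funM => //; exact: measurable_upd_comp.
  move=> t _.
  have := ds (upd x i t) (fun y => psi y `^ k^-1)%R.
  rewrite (_ : (fun y => _) = (fun y => (psi y `^ ((size s).+1%:R / k))%:E)); last first.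
    apply/funext => y; rewrite kE powRD ?powRr1//.
    by rewrite gt_eqF ?implybT// addr_gt0.
  move=> /(_ _ _)/le_trans; apply.
  - exact: (measurableT_comp (measurable_powR _) mpsi).
  - by move=> y; exact: powR_ge0.
  - apply: lee_wpmul2l => //.
    apply: le_poweR; first exact: ltW.
      by apply: iter_int_ge0 => y; rewrite lee_fin powR_ge0.
    rewrite /B /= -(int1_upd leb i _ x t) -iter_int1C//.
    apply: le_iter_int => //.
    + by move=> y; rewrite lee_fin powR_ge0.
    + apply: measurable_EFin_powR; exact: (measurableT_comp (measurable_powR _) mpsi).
    + exact: int1_ge0.
    + exact: measurable_int1.
    + by move=> y; rewrite -powRrM mulVf ?gt_eqF// powRr1.
rewrite ge0_integralZr//; last 2 first.
- exact: measurable_upd_comp.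
- exact: poweR_ge0.
have A0 : 0 <= A by exact: iter_int_ge0.
rewrite kE poweRD; last by rewrite add_neq0_poweRD_def// gt_eqF// addr_gt0.
rewrite poweRe1//; apply: lee_pmul => //.
- by apply: integral_ge0 => t _.
- exact: poweR_ge0.
- apply: (@le_iter_int _ _ leb (i :: s)) => // y.
  by rewrite /sumS big_cons leeDr// lee_fin S0.
- apply: le_poweR => //; first exact: ltW.
  apply: (@le_iter_int _ _ leb (i :: s)) => // y.
  by rewrite /sumS big_cons leeDl// sume_ge0// => j _; rewrite lee_fin.
Qed.

(** The induction alternates two forms. The dual bound in k variables gives the power inequality in
    k + 1 variables; Hölder's inequality with the conjugate exponents (k + 1)/k and k + 1 turns the
    latter into the dual bound in k + 1 variables. *)
Let dual_boundP s : uniq s -> (0 < size s)%N -> dual_bound s.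
Proof.
elim: s => // i [_ _ _|j s IH /andP[ijs ujs] _]; first exact: dual_bound1.
have {}IH := IH ujs isT.
move=> x h mh h0; have gn := gn_step x (isT : (0 < size (j :: s))%N) ijs IH.
move: gn; set k := size (j :: s).
rewrite [size (i :: _)]/= -/k => gn.
have k0 : (0 < k%:R :> R)%R by rewrite ltr0n.
pose a : R := (k.+1%:R / k%:R)%R.
have a0 : (0 < a)%R by rewrite divr_gt0.
have ab : (a^-1 + k.+1%:R^-1 = 1)%R.
  by rewrite invf_div -[X in (_ + X)%R]mul1r -mulrDl natr1 divff.
have := @iter_int_hoelder (i :: j :: s) x psi h a k.+1%:R mpsi mh psi0 h0 a0.
move=> /(_ _ ab)/le_trans; apply; first by rewrite ltr0n.
apply: lee_wpmul2r; first exact: poweR_ge0.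
have A0 : 0 <= iter_int leb [:: i, j & s] (sumS [:: i, j & s]) x.
  exact: iter_int_ge0.
have -> : iter_int leb [:: i, j & s] (sumS [:: i, j & s]) x =
    (iter_int leb [:: i, j & s] (sumS [:: i, j & s]) x `^ a) `^ a^-1.
  by rewrite -poweRrM divff ?lt0r_neq0// poweRe1.
apply: le_poweR gn; first by rewrite invr_ge0 ltW.
by apply: iter_int_ge0 => z; rewrite lee_fin powR_ge0.
Qed.

(** At least two variables are required, as the exponent n/(n - 1) is infinite for n = 1. *)
Theorem gagliardo_nirenberg s x (k : nat) : uniq s -> size s = k.+2 ->
  iter_int leb s (fun y => (psi y `^ (k.+2%:R / k.+1%:R))%:E) x
  <= iter_int leb s (sumS s) x `^ (k.+2%:R / k.+1%:R).
Proof.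
case: s => // i s /andP[si us] [sk].
by rewrite -sk; apply: gn_step; rewrite ?sk//; apply: dual_boundP; rewrite ?sk.
Qed.

End gagliardo_nirenberg.

(** * Smooth functions and truncations *)

Section slices.
Variables (R : realType) (V : normedModType R).
Implicit Types (f : V -> R) (x v : V).

(** Restricting to a line reduces the chain rule for directional derivatives to one variable,
    without Fréchet differentiability of [f]. *)
Lemma is_derive_slice f x v (d : R) :
  is_derive x v f d <-> is_derive (0 : R) 1 (fun h : R => f (h *: v + x)) d.
Proof.
have E : (fun h : R => h^-1 *: ((f \o shift x) (h *: v) - f x)) =
   (fun h : R => h^-1 *: (((fun h : R => f (h *: v + x)) \o shift 0) (h *: 1)
      - f (0 *: v + x))).
  by apply/funext => h /=; rewrite addr0 scale0r add0r [_%:A]mulr1.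
by split=> -[df <-]; constructor; rewrite /derivable /derive/= -?E// E.
Qed.

Lemma is_derive_comp f (G : R -> R) x v (d D : R) :
  is_derive x v f d -> is_derive (f x) 1 G D -> is_derive x v (G \o f) (D * d).
Proof.
move=> /is_derive_slice df dG; apply/is_derive_slice.
apply: (@is_derive1_comp _ G (fun h : R => f (h *: v + x))) => //.
by rewrite scale0r add0r.
Qed.

End slices.

Section C_k_calculus.
Variables (R : realType) (N : nat).
Implicit Types (f g : 'rV[R]_N -> R) (k : nat) (G : R -> R).

(** A recursion for proofs by induction on k. In [partials s f] the last index of [s] acts first on
    [f], hence the decomposition of [s] from its right end. *)
Lemma C_kSP k f : C_k k.+1 f <->
  [/\ continuous f, forall i x, derivable f x (delta_mx 0 i) &
      forall i, C_k k (partial i f)].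
Proof.
split=> [[cf df]|[cf df pf]].
  split; first exact: (cf [::]).
    by move=> i x; exact: (df [::] i x).
  move=> i; split=> [s sk|s j x sk].
    rewrite (_ : partials s _ = partials (rcons s i) f).
      by apply: cf; rewrite size_rcons.
    by rewrite /partials foldr_rcons.
  rewrite (_ : partials s _ = partials (rcons s i) f).
    by apply: df; rewrite size_rcons.
  by rewrite /partials foldr_rcons.
split=> [s|s j x]; case/lastP: s => [_|s i]; rewrite ?size_rcons ?ltnS => //.
- rewrite /partials foldr_rcons => sk; exact: (pf i).1.
- rewrite /partials foldr_rcons => sk; exact: (pf i).2.
Qed.

Lemma C_k0 f : continuous f -> C_k 0 f.
Proof. by move=> cf; split=> // -[]. Qed.

Lemma C_k_continuous k f : C_k k f -> continuous f.
Proof. by move=> [cf _]; exact: (cf [::]). Qed.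

Lemma C_kW k f : C_k k.+1 f -> C_k k f.
Proof.
move=> [cf df]; split=> [s sk|s i x sk]; first by apply: cf; exact: leqW.
by apply: df; exact: leqW.
Qed.

Lemma C_kD k f g : C_k k f -> C_k k g -> C_k k (f \+ g).
Proof.
elim: k f g => [|k IH] f g Cf Cg.
  by apply: C_k0 => x; apply: continuousD; exact: (@C_k_continuous 0).
have /C_kSP[cf df pf] := Cf; have /C_kSP[cg dg pg] := Cg.
apply/C_kSP; split=> [x|i x|i].
- by apply: continuousD; [exact: cf|exact: cg].
- exact: derivableD.
- rewrite (_ : partial i _ = partial i f \+ partial i g); first exact: IH.
  by apply/funext => x; rewrite /partial/= deriveD.
Qed.

Lemma C_kM k f g : C_k k f -> C_k k g -> C_k k (f \* g).
Proof.
elim: k f g => [|k IH] f g Cf Cg.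
  by apply: C_k0 => x; apply: continuousM; exact: (@C_k_continuous 0).
have /C_kSP[cf df pf] := Cf; have /C_kSP[cg dg pg] := Cg.
apply/C_kSP; split=> [x|i x|i].
- by apply: continuousM; [exact: cf|exact: cg].
- exact: derivableM.
- rewrite (_ : partial i _ = (f \* partial i g) \+ (g \* partial i f)).
    by apply: C_kD; apply: IH => //; exact: C_kW.
  by apply/funext => x; rewrite /partial/= deriveM.
Qed.

Lemma partial_comp i f G (dG : R -> R) x :
  derivable f x (delta_mx 0 i) -> is_derive (f x) 1 G (dG (f x)) ->
  partial i (G \o f) x = dG (f x) * partial i f x.
Proof.
move=> /derivableP df /(is_derive_comp df) [_ <-] //.
Qed.

Lemma smooth_continuous f : smooth f -> continuous f.
Proof. by move=> /(_ 0%N)/C_k_continuous. Qed.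

Lemma smooth_derivable f i x : smooth f -> derivable f x (delta_mx 0 i).
Proof. by move=> /(_ 1%N)/C_kSP[]. Qed.

Lemma smooth_partial f i : smooth f -> smooth (partial i f).
Proof. by move=> sf k; have /C_kSP[_ _] := sf k.+1; exact. Qed.

Lemma smoothM f g : smooth f -> smooth g -> smooth (f \* g).
Proof. by move=> sf sg k; exact: C_kM. Qed.

Lemma partialM i f g x : smooth f -> smooth g ->
  partial i (f \* g) x = f x * partial i g x + g x * partial i f x.
Proof.
by move=> sf sg; rewrite /partial deriveM//; exact: smooth_derivable.
Qed.

(** A smooth function of one variable given with all its derivatives: [G n] is the n-th derivative
    of [G 0]. *)
Definition derivative_chain (G : nat -> R -> R) : Prop :=
  forall n (s : R), is_derive s 1 (G n) (G n.+1 s).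

Lemma derivative_chain_continuous (G : nat -> R -> R) n : derivative_chain G ->
  continuous (G n).
Proof.
move=> dG s; have [Gs _] := dG n s.
by apply: differentiable_continuous; apply/derivable1_diffP.
Qed.

Lemma smooth_comp (G : nat -> R -> R) f : derivative_chain G -> smooth f ->
  smooth (G 0%N \o f).
Proof.
(* All members of the chain are treated together, since differentiating [G n \o f] brings in
   [G n.+1]. *)
move=> dG sf k; suff : forall n, C_k k (G n \o f) by exact.
elim: k => [|k IH] n.
  apply: C_k0 => x; apply: continuous_comp; first exact: smooth_continuous.
  exact: derivative_chain_continuous.
apply/C_kSP; split=> [x|i x|i].
- apply: continuous_comp; first exact: smooth_continuous.
  exact: derivative_chain_continuous.
- have /derivableP df : derivable f x (delta_mx 0 i) by exact: smooth_derivable.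
  by have [] := is_derive_comp df (dG n (f x)).
- rewrite (_ : partial i _ = (G n.+1 \o f) \* partial i f).
    by apply: C_kM; [exact: IH|exact: smooth_partial].
  apply/funext => x /=; apply: partial_comp; first exact: smooth_derivable.
  exact: dG.
Qed.

End C_k_calculus.

Section test_functions.
Variables (R : realType) (N : nat) (Omega : set 'rV[R]_N).
Implicit Types phi chi : 'rV[R]_N -> R.

Let test_function_sub phi chi : test_function Omega phi -> smooth chi ->
  [set x | chi x != 0] `<=` closure [set x | phi x != 0] ->
  test_function Omega chi.
Proof.
move=> [sphi cphi phiO] schi phichi.
have cl : closure [set x | chi x != 0] `<=` closure [set x | phi x != 0].
  by rewrite [X in _ `<=` X](closure_id _).1; [exact: closure_subset|exact: closed_closure].
split=> //; last exact: subset_trans phiO.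
by apply: (subclosed_compact _ cphi) => //; exact: closed_closure.
Qed.

Lemma test_functionM phi chi : test_function Omega phi ->
  test_function Omega chi -> test_function Omega (phi \* chi).
Proof.
move=> tphi tchi; apply: (test_function_sub tphi).
  by apply: smoothM; [case: tphi|case: tchi].
move=> x /= phichi; apply: subset_closure => /=.
by apply: contra phichi => /eqP ->; rewrite mul0r.
Qed.

Lemma test_function_comp (G : nat -> R -> R) phi : derivative_chain G ->
  G 0%N 0 = 0 -> test_function Omega phi -> test_function Omega (G 0%N \o phi).
Proof.
move=> dG G0 tphi; apply: (test_function_sub tphi).
  by apply: smooth_comp => //; case: tphi.
move=> x /= Gphi; apply: subset_closure => /=.
by apply: contra Gphi => /eqP ->; rewrite G0.
Qed.

Lemma test_function_notin phi x : test_function Omega phi -> ~ Omega x ->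
  phi x = 0.
Proof.
move=> [_ _ phiO] Ox; apply/eqP; apply: contrapT => /negP phix.
by apply: Ox; apply: phiO; exact: subset_closure.
Qed.

Lemma test_function_partial phi i : test_function Omega phi ->
  test_function Omega (partial i phi).
Proof.
move=> tphi; apply: (test_function_sub tphi).
  by apply: smooth_partial; case: tphi.
move=> x /= /eqP pphi; apply: contrapT => xphi; apply: pphi.
have phi0 : \forall y \near x, 0 = phi y.
  have := open_nbhs_nbhs (conj (closed_openC (@closed_closure _ [set x | phi x != 0])) xphi).
  apply: filterS => y yphi; apply/esym/eqP; apply: contrapT => /negP phiy.
  by apply: yphi; exact: subset_closure.
by rewrite /partial -(near_eq_derive (f := cst 0) _ phi0) derive_cst.
Qed.

Lemma test_function_support phi : test_function Omega phi ->
  exists2 M : R, 0 < M & forall (x : 'rV[R]_N) i, M <= `|x 0 i| -> phi x = 0.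
Proof.
move=> [_ /compact_bounded [M [_ phiM]] _].
(* On the support |x| is at most |M| + 1; one more unit makes the contradiction strict. *)
exists (`|M| + 2) => [|x i Mx]; first by rewrite ltr_wpDl.
apply/eqP; apply: contrapT => /negP phix.
have : `|x| <= `|M| + 1.
  apply: phiM; last exact: subset_closure.
  by rewrite (le_lt_trans (ler_norm M))// ltrDl.
have : `|x 0 i| <= `|x|.
  by rewrite /Num.norm/= mx_normrE; apply: (le_trans _ (le_bigmax _ _ (0, i))).
lra.
Qed.

Lemma test_function_bounded phi : test_function Omega phi ->
  exists2 M : R, 0 < M & forall x, `|phi x| <= M.
Proof.
move=> [sphi cphi _].
have /compact_bounded [M [_ phiM]] : compact (phi @` closure [set x | phi x != 0]).
  apply: continuous_compact => //; apply: continuous_subspaceT.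
  exact: smooth_continuous.
exists (`|M| + 1) => [|x]; first by rewrite ltr_wpDl.
have [->|phix] := eqVneq (phi x) 0; first by rewrite normr0 addr_ge0.
apply: phiM; first by rewrite (le_lt_trans (ler_norm M))// ltrDl.
by exists x => //; exact: subset_closure.
Qed.

End test_functions.

(** * Powers of the absolute value and a flat smooth function *)

Section real_derivatives.
Variable R : realType.
Implicit Types (f w : R -> R) (a s : R).

Lemma is_derive_at0 f w : f 0 = 0 ->
  (\forall h \near (0 : R), `|f h| <= `|h| * w h) -> w h @[h --> (0:R)] --> (0 : R) ->
  is_derive (0 : R) 1 f 0.
Proof.
move=> f0 fw w0.
have cv : (fun h : R => h^-1 *: ((f \o shift 0) (h *: 1) - f 0)) @ 0^' --> (0 : R).
  apply/cvgr0Pnorm_le => e e0.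
  near=> h.
  rewrite /= addr0 [_ *: 1]mulr1 f0 subr0 normrZ normfV.
  have h0 : h != 0 by near: h; exact: nbhs_dnbhs_neq.
  rewrite ler_pdivrMl ?normr_gt0//.
  apply: (@le_trans _ _ (`|h| * w h)).
    by near: h; apply: nbhs_dnbhs.
  apply: ler_wpM2l => //; apply: le_trans (ler_norm _) _.
  by near: h; apply: nbhs_dnbhs; exact: (cvgr0_norm_le _ w0 _ e0).
by constructor; [apply/cvg_ex; exists 0|exact: cvg_lim cv].
Unshelve. all: by end_near. Qed.

Lemma powR_norm_cvg0 a : 0 < a -> `|h| `^ a @[h --> (0:R)] --> (0 : R).
Proof.
move=> a0; apply/cvgr0Pnorm_le => e e0; near=> h.
rewrite ger0_norm ?powR_ge0//.
have he : `|h| <= e `^ a^-1.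
  by near: h; apply: (@cvgr0_norm_le _ _ _ _ _ id) => //; rewrite powR_gt0.
rewrite (le_trans (ge0_ler_powR (ltW a0) _ _ he)) ?nnegrE ?powR_ge0//.
by rewrite -powRrM mulVf ?gt_eqF// powRr1// ltW.
Unshelve. all: by end_near. Qed.

Lemma continuous_powR_norm a : 0 < a -> continuous (fun s : R => `|s| `^ a).
Proof.
move=> a0 s; have [->|s0] := eqVneq s 0.
  by rewrite /continuous_at normr0 powR0 ?gt_eqF//; exact: powR_norm_cvg0.
apply: (@continuous_comp _ _ _ (@normr R R) (fun t => t `^ a)).
  exact: norm_continuous.
have [] := @is_derive1_powR R a `|s|; first by rewrite normr_gt0.
by move=> /derivable1_diffP /differentiable_continuous.
Qed.

Definition dpowR_norm a s : R := a * (`|s| `^ (a - 1) * Num.sg s).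

Lemma is_derive_powR_norm a s : 1 < a ->
  is_derive s 1 (fun s => `|s| `^ a) (dpowR_norm a s).
Proof.
move=> a1; have a0 : 0 < a by lra.
rewrite /dpowR_norm; case: (ltgtP s 0) => [s0|s0|->]; last first.
- rewrite sgr0 !mulr0; apply: (@is_derive_at0 _ (fun h => `|h| `^ (a - 1))).
  + by rewrite normr0 powR0 ?gt_eqF.
  + by near=> h; rewrite ger0_norm ?powR_ge0// mulr_powRB1.
  + by apply: powR_norm_cvg0; lra.
- rewrite gtr0_sg// mulr1 gtr0_norm//.
  apply: near_eq_is_derive (is_derive1_powR a s0).
  by near=> t; rewrite gtr0_norm//; near: t; exact: lt_nbhsr.
- rewrite ltr0_sg// ltr0_norm//.
  have dN : is_derive s (1 : R) (-%R : R -> R) (-1).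
    by apply: is_deriveN.
  have s0' : 0 < - s by rewrite oppr_gt0.
  have := @is_derive1_comp R (fun x => x `^ a) (-%R : R -> R) s _ _
    (is_derive1_powR a s0') dN.
  rewrite -mulrA => dd; apply: near_eq_is_derive dd.
  by near=> t; rewrite /= ltr0_norm//; near: t; exact: lt_nbhsl.
Unshelve. all: by end_near. Qed.

Lemma continuous_dpowR_norm a : 1 < a -> continuous (dpowR_norm a).
Proof.
move=> a1 s; have [->|s0] := eqVneq s 0.
  have a0 : 0 < a - 1 by rewrite subr_gt0.
  have a0' : 0 < a - 1 by rewrite subr_gt0.
  rewrite /continuous_at {2}/dpowR_norm sgr0 !mulr0.
  apply/cvgr0Pnorm_le => e e0.
  have cv : a * `|h| `^ (a - 1) @[h --> (0 : R)] --> (0 : R).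
    by rewrite -[X in _ --> X](mulr0 a); apply: cvgMr; exact: powR_norm_cvg0.
  near=> h; rewrite /dpowR_norm mulrA normrM.
  apply: (@le_trans _ _ (`|a * `|h| `^ (a - 1)| * 1)).
    rewrite ler_wpM2l// normr_sg; case: (h != 0) => //=.
  by rewrite mulr1; near: h; exact: cvgr0_norm_le cv _ e0.
rewrite /continuous_at /dpowR_norm; apply: cvgMr; apply: cvgM.
  by apply: continuous_powR_norm; rewrite subr_gt0.
apply: cvg_near_cst; move: s0; rewrite neq_lt => /orP[s0|s0]; near=> t.
- by rewrite !ltr0_sg//; near: t; exact: lt_nbhsl.
- by rewrite !gtr0_sg//; near: t; exact: lt_nbhsr.
Unshelve. all: by end_near. Qed.

End real_derivatives.

Section flat_function.
Variable R : realType.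
Implicit Types (P : {poly R}) (s : R).

(* [P = 1] gives [s exp(-1/s)] for [s > 0]; the derivative of [flat P] is again
   of this form, with [P] replaced by [dflat P]. *)
Definition flat P s : R := if 0 < s then s * P.[s^-1] * expR (- s^-1) else 0.

Definition dflat P : {poly R} := 'X * P - 'X^2 * P^`() + 'X^2 * P.

Lemma horner_norm_le P (y : R) : 1 <= y ->
  `|P.[y]| <= (\sum_(i < size P) `|P`_i|) * y ^+ size P.
Proof.
move=> y1; rewrite horner_coef mulr_suml; apply: le_trans (ler_norm_sum _ _ _) _.
apply: ler_sum => i _; rewrite normrM ler_wpM2l// normrX ger0_norm ?(le_trans _ y1)//.
by rewrite ler_weXn2l// ltnW.
Qed.

(** With y = 1/s and m the size of [P], |P(y)| is at most a constant times y^m, while exp y is at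
    least y^(m+1)/(m+1)!. This gains one power of s beyond the outer factor: [flat P] is
    quadratically small at 0, hence has derivative 0 there. *)
Lemma flat_bound P : exists2 C, 0 <= C & forall s, `|s| <= 1 -> `|flat P s| <= `|s| * (C * `|s|).
Proof.
pose m := size P; pose C := (\sum_(i < m) `|P`_i|) * (m.+1`!)%:R.
have C0 : 0 <= C by rewrite mulr_ge0// sumr_ge0.
exists C => // s s1; rewrite /flat; case: ifPn => [s0|_]; last first.
  by rewrite normr0 mulr_ge0// mulr_ge0.
rewrite -mulrA normrM ler_wpM2l//.
have y1 : 1 <= s^-1 by rewrite -[leLHS]invr1 lef_pV2 ?posrE//; rewrite gtr0_norm in s1.
rewrite normrM [`|expR _|]ger0_norm ?expR_ge0//.
have y0 : 0 < s^-1 by rewrite invr_gt0.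
have ey : (s^-1) ^+ m.+1 / (m.+1)`!%:R <= expR s^-1.
  by apply: le_trans (expR_ge1Dxn m (ltW y0)); rewrite lerDr.
rewrite expRN ler_pdivrMr ?expR_gt0//.
apply: le_trans (horner_norm_le P y1) _; rewrite -/m gtr0_norm//.
rewrite /C -!mulrA ler_wpM2l ?sumr_ge0//.
have f0 : 0 < (m.+1)`!%:R :> R by rewrite ltr0n fact_gt0.
rewrite -ler_pdivrMl// -ler_pdivrMl//.
apply: le_trans ey; rewrite exprS -mulrA ler_wpM2l ?(ltW y0)//.
by rewrite [leRHS]mulrC.
Qed.

Lemma is_derive_flat P s : is_derive s 1 (flat P) (flat (dflat P) s).
Proof.
case: (ltgtP s 0) => [s0|s0|->].
- rewrite [X in is_derive _ _ _ X]/flat ltNge ltW//=.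
  apply: (@near_eq_is_derive _ _ _ (cst 0)).
    by near=> t; rewrite /flat ltNge ltW//; near: t; exact: lt_nbhsl.
- rewrite [X in is_derive _ _ _ X]/flat s0.
  apply: (@near_eq_is_derive _ _ _ (fun s => s * P.[s^-1] * expR (- s^-1))).
    by near=> t; rewrite /flat ifT//; near: t; exact: lt_nbhsr.
  have sn0 : s != 0 by rewrite gt_eqF.
  have dV : is_derive s (1 : R) (fun t : R => t^-1) (- s ^- 2).
    apply: is_derive_eq; first exact: (@is_deriveV _ id s 1 1 sn0).
    by rewrite [_ *: _]mulr1.
  have dPV := is_derive1_comp (is_derive_poly P s^-1) dV.
  have dN : is_derive s (1:R) (fun t : R => - t^-1) (- - s ^- 2).
    exact: is_deriveN.
  have dE := @is_derive1_comp _ expR (fun t => - t^-1) s _ _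
    (is_derive_expR (- s^-1)) dN.
  have dd := is_deriveM (is_deriveM (is_derive_id s 1) dPV) dE.
  apply: (is_derive_eq dd); rewrite /= /dflat !hornerE /GRing.scale/=.
  rewrite (_ : (id * (horner P \o GRing.inv)) s = s * P.[s^-1])//.
  by field.
- rewrite [X in is_derive _ _ _ X]/flat ltxx.
  have [C C0 flatC] := flat_bound P.
  apply: (@is_derive_at0 _ _ (fun h => C * `|h|)).
  + by rewrite /flat ltxx.
  + near=> h; apply: flatC; near: h.
    exact: (@cvgr0_norm_le _ _ _ _ _ id).
  + rewrite -[X in _ --> X](mulr0 C); apply: cvgMr.
    by rewrite -[X in _ --> X](@normr0 _ R); exact: norm_continuous.
Unshelve. all: by end_near. Qed.

End flat_function.

Lemma derivative_chain_lipschitz (R : realType) (G : nat -> R -> R) s t :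
  derivative_chain G -> (forall x, `|G 1%N x| <= 1) ->
  `|G 0%N s - G 0%N t| <= `|s - t|.
Proof.
move=> dG G1; wlog st : s t / s <= t.
  by move=> H; have [/H//|/ltW/H] := leP s t; rewrite distrC [leRHS]distrC.
have [c _ E] := @MVT_segment R (G 0%N) (G 1%N) s t st (fun c _ => dG 0%N c)
  (continuous_subspaceT (@derivative_chain_continuous _ G 0%N dG)).
by rewrite distrC E normrM distrC ler_piMl.
Qed.

(** * Smooth truncation at a level *)

Section truncation.
Variable R : realType.
Variables (sg k d : R).
Hypotheses (sg1 : sg ^+ 2 = 1) (k0 : 0 <= k) (d0 : 0 < d).
Implicit Type s : R.

(* [trunc s = (s - sg k) exp(-d / (sg s - k))] where [sg s > k] and [0] elsewhere:
   a smooth substitute for the truncation at level [k] of the values of sign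
   [sg], which maps test functions to test functions. *)
Definition trunc_chain n s : R :=
  sg * d * (sg / d) ^+ n * flat (iter n (@dflat R) 1) ((sg * s - k) / d).

Lemma derivative_chain_trunc : derivative_chain trunc_chain.
Proof.
move=> n s; rewrite /trunc_chain exprSr.
have dz : is_derive s (1 : R) (fun s => (sg * s - k) / d) (sg / d).
  have dd := is_deriveM (is_deriveB (is_deriveM (is_derive_cst sg s 1)
    (is_derive_id s 1)) (is_derive_cst k s 1)) (is_derive_cst d^-1 s 1).
  by apply: (is_derive_eq dd); rewrite /GRing.scale/=; ring.
have dF := @is_derive1_comp R _ (fun s => (sg * s - k) / d) s _ _
  (is_derive_flat (iter n (@dflat R) 1) _) dz.
have dd := is_deriveM (is_derive_cst (sg * d * (sg / d) ^+ n) s 1) dF.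
by apply: (is_derive_eq dd); rewrite /GRing.scale/=; ring.
Qed.

Definition trunc := trunc_chain 0.
Definition dtrunc := trunc_chain 1.

Let sg_norm : `|sg| = 1.
Proof.
by apply/eqP; rewrite -(@eqrXn2 _ 2)// ?normr_ge0// expr1n -normrX sg1 normr1.
Qed.

Let flat1 (z : R) : 0 < z -> flat 1 z = z * expR (- z^-1).
Proof. by move=> z0; rewrite /flat z0 hornerC mulr1. Qed.

Let dflat1 (z : R) : 0 < z -> flat (dflat 1) z = (1 + z^-1) * expR (- z^-1).
Proof.
move=> z0; have zn0 : z != 0 by rewrite gt_eqF.
rewrite /flat z0 /dflat derivC mulr0 subr0 !mulr1 !hornerE.
by congr (_ * _); field.
Qed.

Let truncE s : trunc s = sg * d * flat 1 ((sg * s - k) / d).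
Proof. by rewrite /trunc /trunc_chain expr0 mulr1. Qed.

Let dtruncE s : dtrunc s = flat (dflat 1) ((sg * s - k) / d).
Proof.
rewrite /dtrunc /trunc_chain expr1 /= (_ : sg * d * (sg / d) = 1) ?mul1r//.
have dn0 : d != 0 by rewrite gt_eqF.
by rewrite mulrACA -expr2 sg1 mul1r divff.
Qed.

Let gt0_flat s : k < sg * s -> 0 < (sg * s - k) / d.
Proof. by move=> ks; rewrite divr_gt0// subr_gt0. Qed.

Let le0_flat P s : sg * s <= k -> flat P ((sg * s - k) / d) = 0.
Proof.
by move=> sk; rewrite /flat ltNge pmulr_lle0 ?invr_gt0// subr_le0 sk.
Qed.

Lemma trunc_out s : sg * s <= k -> trunc s = 0.
Proof. by move=> sk; rewrite truncE le0_flat// mulr0. Qed.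

Lemma dtrunc_out s : sg * s <= k -> dtrunc s = 0.
Proof. by move=> sk; rewrite dtruncE le0_flat. Qed.

Lemma trunc0 : trunc 0 = 0.
Proof. by rewrite trunc_out// mulr0. Qed.

Lemma dtrunc_ge0 s : 0 <= dtrunc s.
Proof.
have [sk|ks] := leP (sg * s) k; first by rewrite dtrunc_out.
rewrite dtruncE dflat1 ?gt0_flat// mulr_ge0 ?expR_ge0//.
by rewrite addr_ge0// invr_ge0 ltW// gt0_flat.
Qed.

(** With y = d/(sg s - k) the derivative is (1 + y) exp(-y), and exp y is at least 1 + y. The
    truncation is thus a contraction. *)
Lemma dtrunc_le1 s : dtrunc s <= 1.
Proof.
have [sk|ks] := leP (sg * s) k; first by rewrite dtrunc_out.
rewrite dtruncE dflat1 ?gt0_flat// expRN ler_pdivrMr ?expR_gt0// mul1r.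
exact: expR_ge1Dx.
Qed.

(* Testing the equation with [trunc u] produces [|grad u| ^ (p (r-1)/r) |trunc u|];
   this bound makes it absorbable by [dtrunc u * |grad u| ^ p]. *)
Lemma trunc_le_dtrunc s : `|trunc s| <= `|s| * dtrunc s.
Proof.
have [sk|ks] := leP (sg * s) k; first by rewrite trunc_out// dtrunc_out// normr0 mulr0.
have z0 := gt0_flat ks.
rewrite truncE dtruncE flat1// dflat1// -mulrA normrM sg_norm mul1r ger0_norm; last first.
  by apply: mulr_ge0; rewrite ?(ltW d0)// mulr_ge0 ?expR_ge0 ?(ltW z0).
have dn0 : d != 0 by rewrite gt_eqF.
rewrite mulrA [d * _]mulrC divfK// mulrA ler_wpM2r ?expR_ge0//.
have s0 : sg * s <= `|s|.
  by rewrite (le_trans (ler_norm _))// normrM sg_norm mul1r.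
apply: (@le_trans _ _ `|s|); first by rewrite (le_trans _ s0)// lerBlDr lerDl.
by rewrite ler_peMr// lerDl invr_ge0 ltW.
Qed.

(** The exponent -d/(sg s - k) is at least -1 there: from distance d above the level on, smoothing
    costs at most a factor e. *)
Lemma trunc_ge s : k + d <= sg * s -> (sg * s - k) * expR (- 1) <= `|trunc s|.
Proof.
move=> kds; have ks : k < sg * s by rewrite (lt_le_trans _ kds)// ltrDl.
have z0 := gt0_flat ks.
rewrite truncE flat1// -mulrA normrM sg_norm mul1r ger0_norm; last first.
  by apply: mulr_ge0; rewrite ?(ltW d0)// mulr_ge0 ?expR_ge0 ?(ltW z0).
have dn0 : d != 0 by rewrite gt_eqF.
rewrite mulrA [d * _]mulrC divfK// ler_wpM2l ?subr_ge0 ?(ltW ks)// ler_expR lerN2.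
by rewrite invf_le1// ler_pdivlMr// mul1r lerBrDl.
Qed.

Lemma continuous_dtrunc : continuous dtrunc.
Proof. exact: derivative_chain_continuous derivative_chain_trunc. Qed.

Lemma continuous_trunc : continuous trunc.
Proof. exact: derivative_chain_continuous derivative_chain_trunc. Qed.

End truncation.

(** * Integrals of test functions and Sobolev inequality *)

Section borel_open.
Variables (R : realType) (N : nat).
Local Notation T := (borel_rV R N).

Lemma open_borel (U : set 'rV[R]_N) : open U -> measurable (U : set T).
Proof.
move=> oU.
pose rv (a : 'rV[rat]_N) : 'rV[R]_N := map_mx ratr a.
(* A countable family indexed by all pairs of rational corners; a box that is not contained in U is
   replaced by the empty set. *)
pose F (ab : 'rV[rat]_N * 'rV[rat]_N) : set T :=
  if `[< box (Some (rv ab.1, rv ab.2)) `<=` U >]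
  then box (Some (rv ab.1, rv ab.2)) else set0.
have -> : U = \bigcup_ab F ab.
  apply/seteqP; split=> [x Ux|x [ab _]]; last first.
    by rewrite /F; case: asboolP => // + xab; exact.
  have : nbhs x U by exact: open_nbhs_nbhs.
  rewrite -nbhs_ballE => -[e /= e0 xeU].
  have lo i : {q : rat | x 0 i - e < ratr q < x 0 i}.
    apply: cid; have [q qq] := @rat_in_itvoo R (x 0 i - e) (x 0 i) (ltac:(by rewrite ltrBlDr ltrDl)).
    by exists q; move: qq; rewrite in_itv.
  have hi i : {q : rat | x 0 i < ratr q < x 0 i + e}.
    apply: cid; have [q qq] := @rat_in_itvoo R (x 0 i) (x 0 i + e) (ltac:(by rewrite ltrDl)).
    by exists q; move: qq; rewrite in_itv.
  exists (\row_i sval (lo i), \row_i sval (hi i)) => //.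
  rewrite /F; case: asboolP => [_ i|[]].
    by rewrite /= !mxE; case: (lo i) => /= a /andP[_ ->]; case: (hi i) => /= b /andP[/ltW ->].
  move=> y /= xy; apply: xeU; split=> // i j; rewrite ord1.
  have := xy j; rewrite !mxE; case: (lo j) => /= a /andP[a1 a2]; case: (hi j) => /= b /andP[b1 b2].
  move=> /andP[ay yb]; rewrite /ball/= ltr_norml; apply/andP; split; lra.
apply: countable_bigcupT_measurable; first exact: countableP.
by move=> ab; rewrite /F; case: ifP => _ //; exact: measurable_box.
Qed.

Lemma open_continuous_borel (D : set 'rV[R]_N) (f : 'rV[R]_N -> R) :
  open D -> {in D, continuous f} -> measurable_fun (D : set T) f.
Proof.
move=> oD cf.
apply: (@measurability _ _ T _ D f _ (RGenOpens.measurableE R)).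
move=> _ [_ [a [b ->] <-]]; apply: open_borel; rewrite openE => x [Dx abfx].
apply: filterI; first exact: open_nbhs_nbhs.
by apply: (cf x (mem_set Dx)); apply: open_nbhs_nbhs; split=> //; exact: interval_open.
Qed.

Lemma continuous_borel (f : 'rV[R]_N -> R) : continuous f ->
  measurable_fun (setT : set T) f.
Proof.
by move=> cf; apply: open_continuous_borel => //; exact: openT.
Qed.

Lemma continuous_lebesgue (f : 'rV[R]_N -> R) : continuous f ->
  measurable_fun (setT : set (lebesgue_space R N)) f.
Proof. by move=> /continuous_borel; exact: measurable_fun_lebesgue_borel. Qed.

End borel_open.

Section slices.
Variables (R : realType) (N : nat).
Implicit Types (f : 'rV[R]_N -> R) (x : 'rV[R]_N) (i : 'I_N).

Lemma updE x i t : upd x i t = (t - x 0 i) *: delta_mx 0 i + x.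
Proof.
apply/rowP => j; rewrite !mxE eqxx/=; case: eqP => [->|_].
  by rewrite mulr1 subrK.
by rewrite mulr0 add0r.
Qed.

Lemma upd_shift x i t h : upd x i (h + t) = h *: delta_mx 0 i + upd x i t.
Proof.
by apply/rowP => j; rewrite !mxE eqxx/=; case: eqP => _; rewrite ?mulr1 ?mulr0 ?add0r.
Qed.

Lemma continuous_upd x i : continuous (upd x i : R -> 'rV[R]_N).
Proof.
rewrite (_ : upd x i = fun t => (t - x 0 i) *: delta_mx 0 i + x); last first.
  by apply/funext => t; rewrite updE.
move=> t; apply: cvgD; last exact: cvg_cst.
by apply: cvgZr_tmp; apply: cvgB; [exact: cvg_id|exact: cvg_cst].
Qed.

Lemma is_derive_upd f i x t : derivable f (upd x i t) (delta_mx 0 i) ->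
  is_derive t 1 (fun t => f (upd x i t)) (partial i f (upd x i t)).
Proof.
move=> /derivableP /is_derive_slice df; apply/is_derive_slice.
rewrite (_ : (fun h : R => _) = (fun h : R => f (h *: delta_mx 0 i + upd x i t)))//.
by apply/funext => h; rewrite [h *: 1]mulr1 upd_shift.
Qed.

End slices.

Section ftc_compact_support.
Variable R : realType.
Local Notation leb := (@lebesgue_measure R).
Variables (h dh : R -> R) (M : R).
Hypotheses (hdh : forall t, is_derive t (1 : R) h (dh t)) (cdh : continuous dh).
Hypotheses (h0 : forall t, M <= `|t| -> h t = 0).
Local Open Scope ereal_scope.

Let ch : continuous h.
Proof.
move=> t; have [dt _] := hdh t.
by apply: differentiable_continuous; apply/derivable1_diffP.
Qed.

Let mdh D : measurable_fun D dh.
Proof. by apply: measurable_funTS; exact: continuous_measurable_fun. Qed.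

Let ftc a b : (a < b)%R ->
  \int[leb]_(t in `[a, b]) (dh t)%:E = (h b)%:E - (h a)%:E.
Proof.
move=> ab; apply: continuous_FTC2 => //.
- exact: continuous_subspaceT.
- split.
  + by move=> t _; have [] := hdh t.
  + by apply: cvg_at_right_filter; exact: ch.
  + by apply: cvg_at_left_filter; exact: ch.
- by move=> t _; rewrite derive1E; have [_ ->] := hdh t.
Qed.

Lemma le_integral_norm_derive t :
  (`|h t|)%:E <= \int[leb]_t (`|dh t|)%:E.
Proof.
(* A point to the left of t at which [h] vanishes, so that h t is the integral of [dh] from a to
   t. *)
pose a : R := (- (`|M| + `|t| + 1))%R.
have at' : (a < t)%R.
  rewrite /a; have := ler_norm (- t)%R; rewrite normrN; have := normr_ge0 M; lra.
have ha : h a = 0%R.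
  apply: h0; rewrite /a normrN ger0_norm ?addr_ge0//.
  by have := ler_norm M; have := normr_ge0 t; lra.
have := ftc at'; rewrite ha sube0 => /(congr1 abse) /= <-.
apply: (le_trans (le_abse_integral leb _ _)) => //.
  by apply/measurable_EFinP; exact: mdh.
apply: ge0_subset_integral => //.
by apply/measurable_EFinP; apply: measurableT_comp => //; exact: mdh.
Qed.

Hypothesis dh0 : forall t, (M <= `|t|)%R -> dh t = 0%R.

(** The integral of [dh] vanishes. The two parts are kept separate because the comparison with
    iterated integrals concerns nonnegative functions. *)
Lemma integral_derive_pos_neg :
  \int[leb]_t (EFin \o dh)^\+ t = \int[leb]_t (EFin \o dh)^\- t.
Proof.
pose a : R := (`|M| + 1)%R.
have a0 : (0 < a)%R by rewrite /a ltr_wpDl.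
have Ma : (M <= a)%R by rewrite (le_trans (ler_norm M))// lerDl.
pose I : set R := `[(- a)%R, a]%classic.
have out (f : R -> \bar R) : (forall t, dh t = 0%R -> f t = 0) ->
    \int[leb]_t f t = \int[leb]_(t in I) f t.
  move=> f0; rewrite [RHS]integral_mkcond; apply: eq_integral => t _.
  rewrite patchE; case: ifPn => //; rewrite notin_setE /I/= in_itv/= => It.
  apply: f0; apply: dh0; apply: (le_trans Ma); apply: ltW; rewrite ltNge.
  by apply/negP => ta; apply: It; rewrite -ler_norml.
have idh : leb.-integrable I (EFin \o dh).
  apply: continuous_compact_integrable; first exact: segment_compact.
  exact: continuous_subspaceT.
have /ftc : (- a < a)%R by lra.
rewrite !h0 ?normrN ?gtr0_norm// sube0 integralE => /eqP.
rewrite sube_eq ?add0e.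
- move=> /eqP E; rewrite !out; first exact: E.
  + by move=> t dt; rewrite funenegE /= dt oppr0 maxxx.
  + by move=> t dt; rewrite funeposE /= dt maxxx.
- exact: integrable_pos_fin_num.
- by rewrite fin_num_adde_defl// integrable_neg_fin_num.
Qed.

End ftc_compact_support.

Section enorm.
Variables (R : realType) (N : nat).
Implicit Types x : 'rV[R]_N.

Lemma dotvv_ge0 x : 0 <= dotv x x.
Proof. by apply: sumr_ge0 => i _; rewrite -expr2 sqr_ge0. Qed.

Lemma enorm_ge0 x : 0 <= enorm x. Proof. exact: sqrtr_ge0. Qed.

Lemma enorm_sqr x : enorm x ^+ 2 = dotv x x.
Proof. by rewrite sqr_sqrtr ?dotvv_ge0. Qed.

Lemma coord_le_enorm x i : `|x 0 i| <= enorm x.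
Proof.
rewrite -sqrtr_sqr; apply: ler_wsqrtr; rewrite /dotv (bigD1 i)//= -expr2 lerDl.
by apply: sumr_ge0 => j _; rewrite -expr2 sqr_ge0.
Qed.

Lemma measurable_enorm d (Y : measurableType d) (D : set Y) (F : Y -> 'rV[R]_N) :
  (forall i, measurable_fun D (fun y => F y 0 i)) ->
  measurable_fun D (fun y => enorm (F y)).
Proof.
move=> mF; apply: (measurableT_comp (f := @Num.sqrt R)).
  by apply: continuous_measurable_fun; exact: sqrt_continuous.
by apply: measurable_sum => i; exact: measurable_funM.
Qed.

End enorm.

Section test_function_integrals.
Variables (R : realType) (N : nat) (Omega : set 'rV[R]_N).
Hypothesis oOmega : open Omega.
Local Notation T := (borel_rV R N).
Local Notation leb := (@lebesgue_measure R :
  {sigma_finite_measure set (measurableTypeR R) -> \bar R}).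
Implicit Types (phi chi : 'rV[R]_N -> R) (i : 'I_N).

Lemma measurable_Omega : measurable (Omega : set (lebesgue_space R N)).
Proof. by apply: measurable_lebesgue_borel; exact: open_borel. Qed.

Lemma test_function_continuous phi : test_function Omega phi -> continuous phi.
Proof. by case=> /smooth_continuous. Qed.

Lemma test_function_slice phi i x : test_function Omega phi ->
  exists2 M : R, 0 < M & forall t, M <= `|t| -> phi (upd x i t) = 0.
Proof.
move=> /test_function_support[M M0 phiM]; exists M => // t Mt.
by apply: (phiM _ i); rewrite mxE eqxx.
Qed.

Local Open Scope ereal_scope.

Lemma integral_Omega (f : 'rV[R]_N -> \bar R) :
  (forall x, ~ Omega x -> f x = 0) ->
  \int[lebesgue]_(x in Omega) f x = \int[lebesgue]_x f x.
Proof.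
move=> f0; rewrite integral_mkcond; apply: eq_integral => x _.
by rewrite patchE; case: ifPn => //; rewrite notin_setE => /f0.
Qed.

Lemma integral_bounded_support_lty (f : 'rV[R]_N -> R) (K M : R) :
  measurable_fun (setT : set T) f -> (forall x, 0 <= f x <= K)%R ->
  (forall (x : 'rV[R]_N) i, M <= `|x 0%R i| -> f x = 0)%R ->
  \int[lebesgue]_x (f x)%:E < +oo.
Proof.
move=> mf fK f0.
pose B := box (Some (const_mx (- M)%R, const_mx M)) : set 'rV[R]_N.
have mB : measurable (B : set (lebesgue_space R N)) by exact: measurable_lebesgue_box.
apply: (@le_lt_trans _ _ (\int[lebesgue]_x (K * \1_B x)%:E)).
  apply: ge0_le_integral => //.
  - by move=> x _; rewrite lee_fin; have /andP[] := fK x.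
  - by apply/measurable_EFinP; exact: measurable_fun_lebesgue_borel.
  - by apply/measurable_EFinP; apply: measurable_funM.
  - move=> x _; rewrite lee_fin indicE.
    have [xB|xB] := pselect (B x); first by rewrite mem_set// mulr1; have /andP[] := fK x.
    rewrite memNset// mulr0; have [i xi] : exists i, ~ (- M < x 0%R i <= M)%R.
      apply/not_existsP => xi; apply: xB => i; rewrite !mxE.
      by apply: contrapT; exact: xi.
    rewrite (f0 x i)//; rewrite leNgt; apply/negP; rewrite ltr_norml => /andP[h1 h2].
    by apply: xi; rewrite h1 ltW.
have -> : \int[lebesgue]_x (K * \1_B x)%:E = K%:E * (box_volume (Some (const_mx (- M)%R : 'rV[R]_N, const_mx M)))%:E.
  under eq_integral do rewrite EFinM.
  rewrite ge0_integralZl//.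
  - by rewrite integral_indic// setIT; congr (_ * _); exact: lebesgue_outer_box.
  - by apply/measurable_EFinP; exact: measurable_indic.
  - by have /andP[f1 f2] := fK 0%R; rewrite lee_fin (le_trans f1).
by rewrite -EFinM ltry.
Qed.

Lemma integrable_test_function phi : test_function Omega phi ->
  lebesgue.-integrable setT (EFin \o phi).
Proof.
move=> tphi; have cphi := test_function_continuous tphi.
have [K K0 phiK] := test_function_bounded tphi.
have [M M0 phiM] := test_function_support tphi.
apply/integrableP; split.
  by apply/measurable_EFinP; exact: continuous_lebesgue.
apply: (@integral_bounded_support_lty (fun x => `|phi x|)%R K M).
- apply: measurableT_comp => //; exact: continuous_borel.
- by move=> x; rewrite normr_ge0 phiK.
- by move=> x i xi; rewrite (phiM _ _ xi) normr0.
Qed.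

Lemma integral_partial_eq0 phi i : test_function Omega phi ->
  \int[lebesgue]_(x in Omega) (partial i phi x)%:E = 0.
Proof.
move=> tphi; have tp := test_function_partial i tphi.
rewrite integral_Omega; last by move=> x /(test_function_notin tp) ->.
have ip : lebesgue.-integrable setT (EFin \o partial i phi).
  exact: integrable_test_function tp.
have mp : measurable_fun (setT : set T) (EFin \o partial i phi).
  by apply/measurable_EFinP; apply: continuous_borel; exact: test_function_continuous.
rewrite integralE; apply/eqP; rewrite sube_eq; last 2 first.
- exact: integrable_pos_fin_num.
- by rewrite fin_num_adde_defl// integrable_neg_fin_num.
rewrite add0e; apply/eqP.
(* With i listed last, its integral is the innermost, and there the positive and negative parts
   already agree. *)
have sN : perm_eq (rcons (rem i (enum 'I_N)) i) (enum 'I_N).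
  by rewrite perm_rcons perm_sym perm_to_rem// mem_enum.
rewrite !(integral_lebesgue_iter 0%R sN)//; last 2 first.
- exact: measurable_funeneg.
- exact: measurable_funepos.
rewrite /iter_int !foldr_rcons; congr (foldr _ _ _ _); apply/funext => x.
have [M M0 phiM] := test_function_slice i x tphi.
have [M' M'0 phiM'] := test_function_slice i x tp.
have := @integral_derive_pos_neg R (fun t => phi (upd x i t))
  (fun t => partial i phi (upd x i t)) (maxr M M').
rewrite /int1 => H.
transitivity (\int[leb]_t (EFin \o (fun t => partial i phi (upd x i t)))^\+ t).
  by apply: eq_integral => t _; rewrite !funeposE.
transitivity (\int[leb]_t (EFin \o (fun t => partial i phi (upd x i t)))^\- t).
  apply: H.
  - by move=> t; apply: is_derive_upd; apply: smooth_derivable; case: tphi.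
  - move=> t; apply: continuous_comp; first exact: continuous_upd.
    exact: test_function_continuous tp _.
  - by move=> t; rewrite ge_max => /andP[/phiM].
  - by move=> t; rewrite ge_max => /andP[_ /phiM'].
by apply: eq_integral => t _; rewrite !funenegE.
Qed.

Lemma integral_by_parts phi chi i : test_function Omega phi ->
  test_function Omega chi ->
  \int[lebesgue]_(x in Omega) (phi x * partial i chi x)%:E =
  - \int[lebesgue]_(x in Omega) (partial i phi x * chi x)%:E.
Proof.
move=> tphi tchi.
have int_test f : test_function Omega f -> lebesgue.-integrable Omega (EFin \o f).
  move=> tf; apply: (@integrableS _ _ _ _ setT) => //; first exact: measurable_Omega.
  exact: integrable_test_function.
have t1 := test_functionM tphi (test_function_partial i tchi).
have t2 := test_functionM (test_function_partial i tphi) tchi.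
have := integral_partial_eq0 i (test_functionM tphi tchi).
under eq_integral => x _.
  rewrite partialM; [|by case: tphi|by case: tchi].
  rewrite [(chi x * _)%R]mulrC EFinD; over.
rewrite integralD//; last 3 first.
- exact: measurable_Omega.
- exact: (int_test _ t1).
- exact: (int_test _ t2).
have := integrable_fin_num measurable_Omega (int_test _ t2) => /=.
move: (\int[_]_(x in _) _) (\int[_]_(x in _) _) => [a| |] [b| |]//= _.
by rewrite -EFinD => -[] /eqP; rewrite addr_eq0 => /eqP ->.
Qed.

End test_function_integrals.

(** * Sobolev's inequality for test functions *)

Lemma powR_absorb (R : realType) (a b c x y nu theta : R) :
  0 <= a -> 0 <= b -> 0 <= c -> 0 < theta -> theta + x * nu = 1 ->
  a <= (c * (a `^ x * b `^ y)) `^ nu ->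
  a <= c `^ (nu / theta) * b `^ (y * nu / theta).
Proof.
move=> a0 b0 c0 th0 E ab; have [->|an0] := eqVneq a 0.
  by rewrite mulr_ge0// powR_ge0.
have agt0 : 0 < a by rewrite lt0r an0.
have : a `^ theta <= c `^ nu * b `^ (y * nu).
  rewrite -(ler_pM2r (powR_gt0 (x * nu) agt0)) -powRD; last by rewrite an0 implybT.
  rewrite E powRr1//; apply: (le_trans ab).
  by rewrite !powRM ?mulr_ge0 ?powR_ge0// -!powRrM mulrA mulrAC.
move=> /(ge0_ler_powR (_ : 0 <= theta^-1)).
rewrite invr_ge0 (ltW th0) !nnegrE mulr_ge0 ?powR_ge0// => /(_ isT isT isT).
by rewrite powRM ?powR_ge0// -!powRrM divff ?gt_eqF// powRr1.
Qed.

(** [A] stands on both sides, with exponent x nu < 1 on the right. Dividing by that power, which is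
    legitimate for finite [A], leaves A^theta. An infinite [B] makes the right-hand side
    infinite. *)
Lemma poweR_absorb (R : realType) (A B : \bar R) (c x y nu theta : R) :
  (0 <= A)%E -> (A < +oo)%E -> (0 <= B)%E -> 0 < c -> 0 < theta ->
  theta + x * nu = 1 -> 0 < y * nu / theta ->
  (A <= (c%:E * (A `^ x * B `^ y)) `^ nu)%E ->
  (A <= (c `^ (nu / theta))%:E * B `^ (y * nu / theta))%E.
Proof.
move=> A0 Aoo B0 c0 th0 E t0; case: B B0 => [b b0| _ _|//]; last first.
  rewrite poweRyr ?gt_eqF// gt0_muley ?leey// lte_fin; exact: powR_gt0.
case: A A0 Aoo => [a a0 _|//|//].
rewrite lee_fin => H; rewrite -[leRHS]/(_ * _)%:E lee_fin.
by apply: powR_absorb (ltW c0) th0 E _; rewrite -?lee_fin.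
Qed.

Section sobolev_exponents.
Variables (R : realType) (p n : R).
Hypotheses (p1 : 1 < p) (pn : p < n).

Let p0 : 0 < p. Proof. by move: p1; lra. Qed.
Let n1 : 0 < n - 1. Proof. by move: p1 pn; lra. Qed.
Let np : 0 < n - p. Proof. by move: p1 pn; lra. Qed.
Let pp : 0 < p - 1. Proof. by move: p1 pn; lra. Qed.
Let neqs := (lt0r_neq0 p0, lt0r_neq0 n1, lt0r_neq0 np, lt0r_neq0 pp).

Lemma sobolev_gam_gt1 : 1 < p * (n - 1) / (n - p).
Proof.
rewrite ltr_pdivlMr//; have : 0 < (p - 1) * n.
  by rewrite mulr_gt0//; move: n1; lra.
by move: p1 pn; lra.
Qed.

Lemma sobolev_exponent_gt0 : 0 < n * p / (n - p).
Proof. by rewrite divr_gt0 ?mulr_gt0//; move: n1; lra. Qed.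

Lemma sobolev_exponentE1 :
  n * p / (n - p) = p * (n - 1) / (n - p) * (n / (n - 1)).
Proof. by field; rewrite !neqs. Qed.

Lemma sobolev_exponentE2 :
  (p * (n - 1) / (n - p) - 1) * (p / (p - 1)) = n * p / (n - p).
Proof. by field; rewrite !neqs. Qed.

Lemma conjugate_exponentE : (p / (p - 1))^-1 + p^-1 = 1.
Proof. by rewrite invf_div; field; rewrite neqs. Qed.

Lemma sobolev_exponentE3 :
  n / (n - 1) / ((n - p) / (p * (n - 1))) = n * p / (n - p).
Proof. by field; rewrite !neqs. Qed.

Lemma sobolev_exponentE4 :
  p^-1 * (n / (n - 1)) / ((n - p) / (p * (n - 1))) = n * p / (n - p) / p.
Proof. by field; rewrite !neqs. Qed.

Lemma sobolev_exponentE5 :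
  (n - p) / (p * (n - 1)) + (p - 1) / p * (n / (n - 1)) = 1.
Proof. by field; rewrite !neqs. Qed.

End sobolev_exponents.

Section sobolev_test.
Variables (R : realType) (N : nat) (Omega : set 'rV[R]_N) (p n : R).
Hypotheses (N2 : (2 <= N)%N) (nE : N%:R = n).
Hypotheses (p1 : 1 < p) (pn : p < n).
Local Notation T := (borel_rV R N).
Local Notation leb := (@lebesgue_measure R :
  {sigma_finite_measure set (measurableTypeR R) -> \bar R}).

(** The exponent for which gam n/(n - 1) and (gam - 1) p/(p - 1) both equal s: the left-hand side of
    Gagliardo-Nirenberg for |phi|^gam and the factor that Hölder's inequality splits off are then
    the same integral. *)
Let gam : R := p * (n - 1) / (n - p).
Let s : R := n * p / (n - p).

Let n2 : 2 <= n. Proof. by rewrite -nE ler_nat. Qed.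

Let gam1 : 1 < gam.
Proof.
exact: sobolev_gam_gt1.
Qed.

Let measurable_borel_powR (f : 'rV[R]_N -> R) a :
  measurable_fun (setT : set T) f ->
  measurable_fun (setT : set T) (fun x => f x `^ a).
Proof. by move=> mf; exact: (measurableT_comp (measurable_powR a) mf). Qed.

Section fixed_phi.
Variable phi : 'rV[R]_N -> R.
Hypothesis tphi : test_function Omega phi.

Let cphi : continuous phi. Proof. exact: test_function_continuous tphi. Qed.

Let mphi : measurable_fun (setT : set T) (fun x => `|phi x|).
Proof. by apply: measurableT_comp => //; exact: continuous_borel. Qed.

Let mgrad : measurable_fun (setT : set T) (fun x => enorm (grad phi x)).
Proof.
apply: measurable_enorm => i.
rewrite (_ : (fun x => _) = partial i phi); last by apply/funext => x; rewrite mxE.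
apply: continuous_borel; exact: test_function_continuous (test_function_partial i tphi).
Qed.

Let psi (x : T) : R := `|phi x| `^ gam.
Let S i (x : T) : R := `|dpowR_norm gam (phi x) * partial i phi x|.

Let cS i : continuous (fun x => dpowR_norm gam (phi x) * partial i phi x).
Proof.
have c : continuous ((dpowR_norm gam \o phi) \* partial i phi).
  move=> x; apply: continuousM.
    apply: continuous_comp; first exact: cphi.
    exact: continuous_dpowR_norm gam1 _.
  exact: test_function_continuous (test_function_partial i tphi) _.
exact: c.
Qed.

Let psiS i x : ((psi x)%:E <= int1 leb i (EFin \o S i) x)%E.
Proof.
have [M M0 phiM] := test_function_slice i x tphi.
pose h t := psi (upd x i t).
pose dh t := dpowR_norm gam (phi (upd x i t)) * partial i phi (upd x i t).
have -> : psi x = `|h (x 0 i)| by rewrite /h upd_id ger0_norm// powR_ge0.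
apply: (@le_integral_norm_derive R h dh M) => [t|t|t Mt].
- apply: (@is_derive1_comp _ (fun s => `|s| `^ gam) (fun t => phi (upd x i t))).
    exact: is_derive_powR_norm gam1.
  by apply: is_derive_upd; apply: smooth_derivable; case: tphi.
- apply: (@continuous_comp _ _ _ (upd x i) (fun x => dpowR_norm gam (phi x) * partial i phi x)).
    exact: continuous_upd.
  exact: cS.
- by rewrite /h /psi phiM// normr0 powR0// gt_eqF// (lt_trans _ gam1).
Qed.

Local Open Scope ereal_scope.

Let A := \int[lebesgue]_x (`|phi x| `^ s)%:E.
Let B := \int[lebesgue]_x (enorm (grad phi x) `^ p)%:E.

(** Bounded support gives this finiteness, which the absorption of [A] relies on. *)
Let A_lty : A < +oo.
Proof.
have [K K0 phiK] := test_function_bounded tphi.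
have [M M0 phiM] := test_function_support tphi.
have s0 : (0 < s)%R by exact: sobolev_exponent_gt0.
apply: (@integral_bounded_support_lty _ _ _ (K `^ s)%R M).
- exact: measurable_borel_powR.
- by move=> x; rewrite powR_ge0 ge0_ler_powR ?nnegrE ?(ltW s0) ?(ltW K0).
- by move=> x i xi; rewrite (phiM _ _ xi) normr0 powR0// gt_eqF.
Qed.

Let B_ge0 : 0 <= B.
Proof. by apply: integral_ge0 => x _; rewrite lee_fin powR_ge0. Qed.

Let S_le i x : (S i x <= gam * (`|phi x| `^ (gam - 1) * enorm (grad phi x)))%R.
Proof.
rewrite /S /dpowR_norm -mulrA normrM gtr0_norm ?(lt_trans _ gam1)//.
rewrite ler_wpM2l ?(ltW (lt_trans _ gam1))// normrM ler_pM//.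
  rewrite normrM (ger0_norm (powR_ge0 _ _)) ler_piMr ?powR_ge0// normr_sg.
  by case: (_ != _).
by have := coord_le_enorm (grad phi x) i; rewrite mxE.
Qed.

(** Gagliardo-Nirenberg is applied to |phi|^gam, whose partial derivatives are at most gam
    |phi|^(gam - 1) |grad phi|; Hölder's inequality then separates phi from its gradient. The factor
    n counts the partial derivatives. *)
Let gn_phi : A <= ((n * gam)%:E * (A `^ ((p - 1) / p) * B `^ p^-1)) `^ (n / (n - 1)).
Proof.
have n0 : (0 < n)%R by rewrite (lt_le_trans _ n2).
have c0 : (0 <= n * gam)%R by rewrite mulr_ge0// ltW// (lt_trans _ gam1).
have [k Nk] : exists k, N = k.+2 by case: N N2 => [|[|k]] // _; exists k.
have Nk1 : (n - 1 = k.+1%:R)%R by rewrite -nE Nk -natr1 addrK.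
have mS i : measurable_fun (setT : set T) (S i).
  by apply: measurableT_comp => //; apply: continuous_borel; exact: cS.
have mpsi : measurable_fun (setT : set T) psi by exact: measurable_borel_powR.
have S0 i x : (0 <= S i x)%R by exact: normr_ge0.
have psi0 x : (0 <= psi x)%R by exact: powR_ge0.
have := @gagliardo_nirenberg R N leb psi S mpsi psi0 mS S0 psiS (enum 'I_N) 0%R k
  (enum_uniq _).
rewrite size_enum_ord => /(_ Nk).
rewrite -!(integral_lebesgue_iter _ (perm_refl _))//; last 4 first.
- by move=> y; apply: sume_ge0 => i _; rewrite lee_fin.
- by apply: emeasurable_sum => i; apply/measurable_EFinP.
- by move=> y; rewrite lee_fin powR_ge0.
- exact: measurable_EFin_powR.
rewrite -Nk1 (_ : k.+2%:R = n) -?nE ?Nk// nE => gn.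
have AE : A = \int[lebesgue]_y (psi y `^ (n / (n - 1)))%:E.
  apply: eq_integral => y _; rewrite /psi -powRrM; congr (_ `^ _)%:E.
  exact: sobolev_exponentE1.
rewrite {1}AE; apply: (le_trans gn); apply: le_poweR.
- by rewrite divr_ge0// ltW// subr_gt0 (lt_trans p1).
- by apply: integral_ge0 => y _; apply: sume_ge0 => i _; rewrite lee_fin.
pose F (x : 'rV[R]_N) : R := (`|phi x| `^ (gam - 1) * enorm (grad phi x))%R.
have mF : measurable_fun (setT : set T) F.
  by apply: measurable_funM => //; exact: measurable_borel_powR.
have F0 x : (0 <= F x)%R by rewrite mulr_ge0 ?powR_ge0// enorm_ge0.
have mF' : measurable_fun (setT : set (lebesgue_space R N)) (fun x => (F x)%:E).
  by apply/measurable_EFinP; exact: measurable_fun_lebesgue_borel.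
apply: (@le_trans _ _ ((n * gam)%:E * \int[lebesgue]_x (F x)%:E)).
  rewrite -ge0_integralZl//; last by move=> x _; rewrite lee_fin.
  apply: ge0_le_integral; first exact: measurableT.
  - by move=> y _; apply: sume_ge0 => i _; rewrite lee_fin.
  - apply: emeasurable_sum => i; apply/measurable_EFinP.
    exact: measurable_fun_lebesgue_borel.
  - exact: measurable_funeM.
  - move=> x _; rewrite sumEFin -EFinM lee_fin.
    apply: (@le_trans _ _ (\sum_(i <- enum 'I_N) gam * F x)%R).
      by apply: ler_sum => i _; exact: S_le.
    by rewrite big_enum/= sumr_const card_ord -mulr_natl nE mulrA.
apply: lee_wpmul2l; first by rewrite lee_fin.
have mP : measurable_fun (setT : set (lebesgue_space R N))
    (fun x => `|phi x| `^ (gam - 1))%R.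
  by apply: measurable_fun_lebesgue_borel; exact: measurable_borel_powR.
have mG : measurable_fun (setT : set (lebesgue_space R N))
    (fun x => enorm (grad phi x)).
  exact: measurable_fun_lebesgue_borel.
have pp0 : (0 < p / (p - 1))%R by rewrite divr_gt0 ?subr_gt0// (lt_trans _ p1).
have p0 : (0 < p)%R by rewrite (lt_trans _ p1).
have := @ge0_hoelder _ _ _ lebesgue _ _ _ _ mP mG
  (fun=> powR_ge0 _ _) (fun=> enorm_ge0 _) pp0 p0 (conjugate_exponentE p1).
have -> : \int[lebesgue]_y ((`|phi y| `^ (gam - 1)) `^ (p / (p - 1)))%:E = A.
  by apply: eq_integral => y _; rewrite -powRrM sobolev_exponentE2.
by rewrite invf_div.
Qed.

Lemma sobolev_test_phi : \int[lebesgue]_(x in Omega) (`|phi x| `^ s)%:E <=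
  ((n * gam) `^ (n * p / (n - p)))%:E *
  (\int[lebesgue]_(x in Omega) (enorm (grad phi x) `^ p)%:E) `^ (s / p).
Proof.
have s0 : (0 < s)%R by exact: sobolev_exponent_gt0.
have p0 : (0 < p)%R by rewrite (lt_trans _ p1).
have n0 : (0 < n)%R by rewrite (lt_trans _ pn).
have pN0 : p != 0%R by rewrite gt_eqF.
have -> : \int[lebesgue]_(x in Omega) (`|phi x| `^ s)%:E = A.
  apply: (@integral_Omega _ _ _ (fun x => (`|phi x| `^ s)%:E)) => x Ox.
  by rewrite (test_function_notin tphi Ox) normr0 powR0// gt_eqF.
have -> : \int[lebesgue]_(x in Omega) (enorm (grad phi x) `^ p)%:E = B.
  apply: (@integral_Omega _ _ _ (fun x => (enorm (grad phi x) `^ p)%:E)) => x Ox.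
  rewrite (_ : grad phi x = 0%R).
    by rewrite /enorm /dotv big1 ?sqrtr0 ?powR0// => i _; rewrite mxE mul0r.
  apply/rowP => i; rewrite !mxE.
  exact: test_function_notin (test_function_partial i tphi) Ox.
have A0 : 0 <= A by apply: integral_ge0 => x _; rewrite lee_fin powR_ge0.
(* The exponent left on [A] after absorption of the product of (p - 1)/p and n/(n - 1); it is
   positive because p < n. *)
have th0 : (0 < (n - p) / (p * (n - 1)))%R.
  by rewrite divr_gt0 ?mulr_gt0 ?subr_gt0// (lt_trans p1).
have c0 : (0 < n * gam)%R by rewrite mulr_gt0// (lt_trans _ gam1).
have := @poweR_absorb R A B _ _ _ _ _ A0 A_lty B_ge0 c0 th0
  (sobolev_exponentE5 p1 pn) _ gn_phi.
by rewrite sobolev_exponentE3// sobolev_exponentE4//; apply; rewrite divr_gt0.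
Qed.

End fixed_phi.

End sobolev_test.

(** * Modulars and approximation in W^{1,H}_0 *)

Lemma ae_lebesgue_filter (R : realType) (N : nat) :
  Filter (almost_everywhere (@lebesgue R N)).
Proof. exact: ae_filter_ringOfSetsType. Qed.
#[local] Existing Instance ae_lebesgue_filter.

Section integral_over_domain.
Variables (R : realType) (N : nat) (Omega : set 'rV[R]_N).
Hypothesis mOmega : measurable (Omega : set (lebesgue_space R N)).
Implicit Types f g h : 'rV[R]_N -> R.
Local Open Scope ereal_scope.

Definition mfun_on f := measurable_fun (Omega : set (lebesgue_space R N)) f.

Definition int_on f : \bar R := \int[lebesgue]_(x in Omega) (f x)%:E.

Lemma int_on_ge0 f : (forall x, Omega x -> (0 <= f x)%R) -> 0 <= int_on f.
Proof. by move=> f0; apply: integral_ge0 => x Ox; rewrite lee_fin f0. Qed.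

Lemma mfun_on_EFin f : mfun_on f ->
  measurable_fun (Omega : set (lebesgue_space R N)) (EFin \o f).
Proof. by move=> mf; apply/measurable_EFinP. Qed.

Lemma le_int_on f g : mfun_on f -> mfun_on g ->
  (forall x, Omega x -> (0 <= f x)%R) -> (forall x, Omega x -> (f x <= g x)%R) ->
  int_on f <= int_on g.
Proof.
move=> mf mg f0 fg; apply: ge0_le_integral.
- exact: mOmega.
- by move=> x Ox; rewrite lee_fin f0.
- exact: mfun_on_EFin.
- exact: mfun_on_EFin.
- by move=> x Ox; rewrite lee_fin fg.
Qed.

Lemma int_onD f g : mfun_on f -> mfun_on g ->
  (forall x, Omega x -> (0 <= f x)%R) -> (forall x, Omega x -> (0 <= g x)%R) ->
  int_on (fun x => (f x + g x)%R) = int_on f + int_on g.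
Proof.
move=> mf mg f0 g0; rewrite /int_on -ge0_integralD.
- by apply: eq_integral => x _; rewrite EFinD.
- exact: mOmega.
- by move=> x Ox; rewrite lee_fin f0.
- exact: mfun_on_EFin.
- by move=> x Ox; rewrite lee_fin g0.
- exact: mfun_on_EFin.
Qed.

Lemma int_onZ c f : mfun_on f -> (0 <= c)%R ->
  (forall x, Omega x -> (0 <= f x)%R) ->
  int_on (fun x => (c * f x)%R) = c%:E * int_on f.
Proof.
move=> mf c0 f0; rewrite /int_on -ge0_integralZl_EFin.
- by apply: eq_integral => x _; rewrite EFinM.
- exact: mOmega.
- by move=> x Ox; rewrite lee_fin f0.
- exact: mfun_on_EFin.
- exact: c0.
Qed.

Lemma int_on_cst c : int_on (fun=> c) = c%:E * lebesgue (Omega : set (lebesgue_space R N)).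
Proof. exact: integral_cst. Qed.

Lemma int_on_integrable f : mfun_on f -> (forall x, Omega x -> (0 <= f x)%R) ->
  int_on f < +oo ->
  lebesgue.-integrable (Omega : set (lebesgue_space R N)) (EFin \o f).
Proof.
move=> mf f0 foo; apply/integrableP; split; first exact: mfun_on_EFin.
rewrite [X in X < _](_ : _ = int_on f)//; apply: eq_integral => x /set_mem Ox.
by rewrite /= ger0_norm ?f0.
Qed.

Lemma integrable_int_on f :
  lebesgue.-integrable (Omega : set (lebesgue_space R N)) (EFin \o f) ->
  int_on (fun x => `|f x|%R) < +oo.
Proof. by move=> /integrableP[]. Qed.

Lemma eq_int_on f g : (forall x, Omega x -> f x = g x) -> int_on f = int_on g.
Proof. by move=> fg; apply: eq_integral => x /set_mem /fg ->. Qed.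

Lemma mfun_onD f g : mfun_on f -> mfun_on g -> mfun_on (fun x => (f x + g x)%R).
Proof. exact: measurable_funD. Qed.

Lemma mfun_onB f g : mfun_on f -> mfun_on g -> mfun_on (fun x => (f x - g x)%R).
Proof. exact: measurable_funB. Qed.

Lemma mfun_onM f g : mfun_on f -> mfun_on g -> mfun_on (fun x => (f x * g x)%R).
Proof. exact: measurable_funM. Qed.

Lemma mfun_on_norm f : mfun_on f -> mfun_on (fun x => `|f x|%R).
Proof. by move=> mf; apply: measurableT_comp mf. Qed.

Lemma mfun_on_cst c : mfun_on (fun=> c).
Proof. exact: measurable_cst. Qed.

Lemma mfun_on_comp (G : R -> R) f : continuous G -> mfun_on f ->
  mfun_on (fun x => G (f x)).
Proof.
move=> cG mf; apply: (measurableT_comp (f := G)) => //.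
exact: continuous_measurable_fun.
Qed.

Lemma mfun_on_powR f a : mfun_on f -> mfun_on (fun x => (f x `^ a)%R).
Proof.
move=> mf; exact: (measurableT_comp (measurable_powR a) mf).
Qed.

(** Dominated convergence with [h] as majorant. The weights are later the differences |G'(psi k) -
    G'(u)| and the indicators of superlevel sets. *)
Lemma cvg_integral_weight (lam : nat -> 'rV[R]_N -> R) h :
  (forall k, mfun_on (lam k)) -> mfun_on h ->
  (forall k x, Omega x -> (0 <= lam k x <= 1)%R) ->
  (forall x, Omega x -> (0 <= h x)%R) -> int_on h < +oo ->
  {ae lebesgue, forall x, Omega x -> lam k x @[k --> \oo] --> (0 : R)%R} ->
  int_on (fun x => (lam k x * h x)%R) @[k --> \oo] --> 0.
Proof.
move=> mlam mh lam01 h0 hoo lamcv.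
have mlh k : mfun_on (fun x => (lam k x * h x)%R) by exact: mfun_onM.
have cvh : {ae lebesgue, forall x, Omega x ->
    (fun k => (lam k x * h x)%:E) @ \oo --> (0 : \bar R)}.
  apply: filterS lamcv => x lamx Ox; apply: cvg_EFin; first exact: nearW.
  by rewrite -[X in _ --> X](mul0r (h x)); apply: cvgMl; exact: lamx.
have [] := @dominated_convergence _ _ _ lebesgue _ mOmega
  (fun k x => (lam k x * h x)%:E) (cst 0) (EFin \o h)
  (fun k => mfun_on_EFin (mlh k)) (measurable_cst _) cvh (int_on_integrable mh h0 hoo) _.
  apply: aeW => x k Ox; rewrite lee_fin ger0_norm.
    by rewrite ler_piMl ?h0//; have /andP[] := lam01 k x Ox.
  by rewrite mulr_ge0 ?h0//; have /andP[] := lam01 k x Ox.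
by move=> _ _; rewrite integral0.
Qed.

Lemma cvg_integral_mulr (a : nat -> 'rV[R]_N -> R) f g (M : R) :
  (forall k, lebesgue.-integrable (Omega : set (lebesgue_space R N)) (EFin \o a k)) ->
  lebesgue.-integrable (Omega : set (lebesgue_space R N)) (EFin \o f) ->
  mfun_on g -> (forall x, Omega x -> (`|g x| <= M)%R) ->
  int_on (fun x => `|a k x - f x|%R) @[k --> \oo] --> 0 ->
  \int[lebesgue]_(x in Omega) (a k x * g x)%:E @[k --> \oo] -->
  \int[lebesgue]_(x in Omega) (f x * g x)%:E.
Proof.
move=> ia if_ mg gM af.
have mO := mOmega.
have igf h : lebesgue.-integrable (Omega : set (lebesgue_space R N)) (EFin \o h) ->
    lebesgue.-integrable (Omega : set (lebesgue_space R N)) (fun x => (h x * g x)%:E).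
  move=> ih; have mh : mfun_on h by apply/measurable_EFinP; case/integrableP: ih.
  have : lebesgue.-integrable (Omega : set (lebesgue_space R N)) (fun x => M%:E * (`|h x|)%:E).
    by apply: integrableZl => //; exact: integrable_norm.
  apply: le_integrable => //.
    by apply: mfun_on_EFin; exact: mfun_onM.
  move=> x Ox; rewrite -EFinM !abse_EFin lee_fin !normrM normr_id mulrC.
  rewrite ler_wpM2r// (le_trans (gM x Ox))// ler_norm//.
have mdiff k : mfun_on (fun x => `|a k x - f x|%R).
  apply: mfun_on_norm; apply: mfun_onB; apply/measurable_EFinP.
    by case/integrableP: (ia k).
  by case/integrableP: if_.
have bound k : `| \int[lebesgue]_(x in Omega) (a k x * g x)%:E -
    \int[lebesgue]_(x in Omega) (f x * g x)%:E | <=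
    `|M|%:E * int_on (fun x => `|a k x - f x|%R).
  rewrite -integralB//; [|exact: igf (ia k)|exact: igf if_].
  have mB : measurable_fun (Omega : set (lebesgue_space R N))
      (fun x => (a k x * g x)%:E - (f x * g x)%:E).
    apply: emeasurable_funB.
      by case/integrableP: (igf _ (ia k)).
    by case/integrableP: (igf _ if_).
  apply: (le_trans (le_abse_integral lebesgue mO mB)).
  rewrite -int_onZ//.
  rewrite [X in X <= _](_ : _ = int_on (fun x => `|a k x - f x| * `|g x|)%R); last first.
    apply: eq_integral => x _.
    by rewrite -EFinB abse_EFin -mulrBl normrM.
  apply: le_int_on.
  - by apply: mfun_onM => //; exact: mfun_on_norm.
  - by apply: mfun_onM => //; exact: mfun_on_cst.
  - by move=> x _; rewrite mulr_ge0.
  - move=> x Ox; rewrite mulrC ler_wpM2r// (le_trans (gM x Ox))// ler_norm//.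
have fin := integrable_fin_num mO (igf _ if_).
apply/(sube_cvg0 _ fin)/cvg_abse0P.
apply: (@squeeze_cvge _ _ _ _ (cst 0) _ (fun k => `|M|%:E * int_on (fun x => `|a k x - f x|%R))).
- by apply: nearW => k; rewrite abse_ge0 bound.
- exact: cvg_cst.
- by rewrite -[X in _ --> X](mule0 `|M|%:E); apply: cvgeZl.
Qed.

(** A Borel-Cantelli argument: the integrals are summable, so the series of the [f k] is finite
    almost everywhere and its tails tend to 0. *)
Lemma ae_eventually_le1 (f : nat -> 'rV[R]_N -> R) :
  (forall k, mfun_on (f k)) -> (forall k x, Omega x -> (0 <= f k x)%R) ->
  (forall k, int_on (f k) <= ((2^-1) ^+ k)%:E) ->
  {ae lebesgue, forall x, Omega x -> \forall k \near \oo, (f k x <= 1)%R}.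
Proof.
move=> mf f0 fk.
have S : \int[lebesgue]_(x in Omega) (\sum_(k <oo) (f k x)%:E) < +oo.
  rewrite integral_nneseries; last 3 first.
  - exact: mOmega.
  - by move=> k; exact: mfun_on_EFin.
  - by move=> k x Ox; rewrite lee_fin f0.
  apply: (@le_lt_trans _ _ (\sum_(k <oo) ((2^-1) ^+ k)%:E)).
    apply: lee_nneseries => k _; last exact: fk.
    by move=> _; exact: int_on_ge0 (f0 k).
  apply: (@le_lt_trans _ _ (1 * (1 - 2^-1)^-1)%:E); last exact: ltry.
  apply: lime_le.
    by apply: is_cvg_nneseries => k _ _; rewrite lee_fin exprn_ge0// invr_ge0.
  apply: nearW => n; rewrite sumEFin lee_fin.
  have := @geometric_le_lim R n 1 2^-1; rewrite /series/=.
  under eq_bigr do rewrite mul1r.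
  have h0 : (0 < 2^-1 :> R)%R by rewrite invr_gt0 ltr0n.
  have h1 : (`|2^-1| < 1 :> R)%R by rewrite gtr0_norm// invf_lt1// ltr1n.
  by move/(_ ler01 h0 h1).
have iS : lebesgue.-integrable (Omega : set (lebesgue_space R N))
    (fun x => \sum_(k <oo) (f k x)%:E).
  apply/integrableP; split.
    apply: ge0_emeasurable_sum => k; [|by move=> _; exact: mfun_on_EFin].
    by move=> x Ox _; rewrite lee_fin f0.
  rewrite [X in X < _](_ : _ = \int[lebesgue]_(x in Omega) (\sum_(k <oo) (f k x)%:E))//.
  apply: eq_integral => x /set_mem Ox; rewrite gee0_abs//.
  by apply: nneseries_ge0 => k _ _; rewrite lee_fin f0.
have := integrable_ae mOmega iS.
apply: filterS => x fin Ox; have {}fin := fin Ox.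
have tail : \sum_(n <= k <oo) (f k x)%:E @[n --> \oo] --> 0.
  apply: nneseries_tail_cvg => [|k _]; last by rewrite lee_fin f0.
  by rewrite ltey_eq fin.
have tail1 : \forall n \near \oo, \sum_(n <= k <oo) (f k x)%:E < 1%:E.
  have nb1 : nbhs (0 : \bar R) [set y | y < 1%:E].
    by apply: open_ereal_lt'; rewrite lte_fin.
  exact: tail nb1.
apply: filterS tail1 => n tn; rewrite -lee_fin; apply: le_trans (ltW tn).
have := @nneseries_lim_ge R (fun k => (f k x)%:E) xpredT n n.+1.
rewrite big_nat1; apply => k _ _; rewrite lee_fin; exact: f0.
Qed.

End integral_over_domain.

Section euclidean_norm.
Variables (R : realType) (N : nat).
Implicit Types x y : 'rV[R]_N.

Lemma dotvZl a x y : dotv (a *: x) y = a * dotv x y.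
Proof.
by rewrite /dotv mulr_sumr; apply: eq_bigr => i _; rewrite !mxE mulrA.
Qed.

Lemma dotvC x y : dotv x y = dotv y x.
Proof. by apply: eq_bigr => i _; rewrite mulrC. Qed.

Lemma dotvDl x y z : dotv (x + y) z = dotv x z + dotv y z.
Proof.
by rewrite /dotv -big_split/=; apply: eq_bigr => i _; rewrite !mxE mulrDl.
Qed.

Lemma enormZ a x : enorm (a *: x) = `|a| * enorm x.
Proof.
rewrite /enorm dotvZl dotvC dotvZl mulrA -expr2 sqrtrM ?sqr_ge0//.
by rewrite sqrtr_sqr.
Qed.

Lemma dotv_le_enorm x y : dotv x y <= enorm x * enorm y.
Proof.
have [x0|x0] := eqVneq (enorm x) 0.
  rewrite x0 mul0r /dotv big1// => i _; have := coord_le_enorm x i.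
  by rewrite x0 normr_le0 => /eqP ->; rewrite mul0r.
have [y0|y0] := eqVneq (enorm y) 0.
  rewrite y0 mulr0 /dotv big1// => i _; have := coord_le_enorm y i.
  by rewrite y0 normr_le0 => /eqP ->; rewrite mulr0.
have xy : 0 < enorm x * enorm y by rewrite mulr_gt0// lt0r ?x0 ?y0 enorm_ge0.
have := dotvv_ge0 (enorm y *: x + (- enorm x) *: y).
rewrite dotvDl !dotvZl ![dotv _ (_ + _)]dotvC !dotvDl !dotvZl -!enorm_sqr.
rewrite [dotv y x]dotvC => H.
have {H} : 0 <= (2 * (enorm x * enorm y)) * (enorm x * enorm y - dotv x y).
  have E (a b c : R) : 2 * (a * b) * (a * b - c) =
      b * (b * a ^+ 2 + - a * c) + - a * (b * c + - a * b ^+ 2) by ring.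
  by rewrite E.
by rewrite pmulr_rge0 ?subr_ge0// mulr_gt0.
Qed.

Lemma ler_enormD x y : enorm (x + y) <= enorm x + enorm y.
Proof.
rewrite -(@ler_pXn2r _ 2)// ?nnegrE ?addr_ge0 ?enorm_ge0//.
rewrite enorm_sqr dotvDl ![dotv _ (_ + _)]dotvC !dotvDl -!enorm_sqr.
have := dotv_le_enorm x y; rewrite [dotv y x]dotvC sqrrD; lra.
Qed.

End euclidean_norm.

Lemma bounded_lebesgue_lty (R : realType) (N : nat) (Omega : set 'rV[R]_N) :
  bounded_set Omega -> (lebesgue (Omega : set (lebesgue_space R N)) < +oo)%E.
Proof.
move=> [M [_ OM]].
pose A := (`|M| + 1)%R.
(* Boxes are open on their lower side, hence the extra unit there. *)
have sub : Omega `<=` box (Some (const_mx (- (A + 1)) : 'rV[R]_N, const_mx A)).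
  move=> x Ox i; rewrite !mxE.
  have : `|x| <= A by apply: OM => //; rewrite /A (le_lt_trans (ler_norm M))// ltrDl.
  have : `|x 0 i| <= `|x|.
    by rewrite /Num.norm/= mx_normrE; apply: (le_trans _ (le_bigmax _ _ (0, i))).
  move=> h1 h2; have := le_trans h1 h2; rewrite ler_norml => /andP[h3 ->]; rewrite andbT.
  by apply: lt_le_trans h3; lra.
apply: le_lt_trans (le_lebesgue_outer sub) _.
by rewrite lebesgue_outer_box ltry.
Qed.

Lemma lipschitz_mfun_on (R : realType) (N : nat) (Omega : set 'rV[R]_N)
    (f : 'rV[R]_N -> R) :
  open Omega -> [lipschitz f x | x in closure Omega] -> mfun_on Omega f.
Proof.
move=> oO lf.
have mfb : measurable_fun (Omega : set (borel_rV R N)) f.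
  apply: open_continuous_borel => // x /set_mem Ox.
  have [M [_ fM]] := lf.
  pose K := (`|M| + 1)%R.
  have K0 : 0 < K by rewrite ltr_wpDl.
  have fK y : Omega y -> `|f x - f y| <= K * `|x - y|.
    move=> Oy; have := fM K; rewrite /K (le_lt_trans (ler_norm M)) ?ltrDl// => /(_ isT).
    move=> /(_ (x, y)); apply; split; exact: subset_closure.
  apply: (proj2 (@cvgrPdist_le _ _ _ (nbhs x) (nbhs_filter x) f (f x))) => e e0.
  have eK : 0 < e / K by rewrite divr_gt0.
  have nO : nbhs x Omega by exact: open_nbhs_nbhs.
  apply: (@filterS2 _ (nbhs x) (nbhs_filter x) _ _ _ _ nO (nbhsx_ballx x _ eK)) => y Oy.
  rewrite -ball_normE /= => /ltW xy; apply: (le_trans (fK y Oy)).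
  by rewrite mulrC -ler_pdivlMr.
by move=> _ B mB; apply: measurable_lebesgue_borel; apply: mfb => //; exact: open_borel.
Qed.

(** * The double phase integrand and its modular *)

Section double_phase.
Variables (R : realType) (N : nat) (Omega : set 'rV[R]_N) (p q : R).
Variable mu : 'rV[R]_N -> R.
Hypotheses (p1 : 1 < p) (pq : p < q).
Hypothesis mu0 : forall x, Omega x -> 0 <= mu x.
Hypothesis mmu : mfun_on Omega mu.
Local Notation H := (calH p q mu).

Let q1 : 1 < q. Proof. exact: lt_trans pq. Qed.
Let p0 : 0 < p. Proof. exact: lt_trans p1. Qed.
Let q0 : 0 < q. Proof. exact: lt_trans q1. Qed.

Lemma calH_ge0 x t : Omega x -> 0 <= H x t.
Proof. by move=> Ox; rewrite addr_ge0 ?mulr_ge0 ?powR_ge0 ?mu0. Qed.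

Lemma le_calH x s t : Omega x -> 0 <= s -> s <= t -> H x s <= H x t.
Proof.
move=> Ox s0 st; have t0 := le_trans s0 st.
apply: lerD; last apply: ler_wpM2l; rewrite ?mu0//;
  by apply: ge0_ler_powR; rewrite ?nnegrE// ltW.
Qed.

Lemma powR_le_calH x t : Omega x -> t `^ p <= H x t.
Proof. by move=> Ox; rewrite lerDl mulr_ge0 ?powR_ge0 ?mu0. Qed.

Lemma le_1DcalH x t : Omega x -> t <= 1 + H x t.
Proof.
move=> Ox; have [t1|t1] := leP t 1.
  by rewrite (le_trans t1)// lerDl calH_ge0.
have := powR_le_calH t Ox; have := le1r_powR (ltW t1) (ltW p1); lra.
Qed.

Lemma calHZ_le x lam t : Omega x -> 0 <= lam <= 1 -> 0 <= t ->
  H x (lam * t) <= lam * H x t.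
Proof.
move=> Ox /andP[l0 l1] t0; rewrite mulrDr /calH !powRM//.
have le_pow a : 1 < a -> lam `^ a <= lam.
  move=> a1; have [->|ln0] := eqVneq lam 0.
    by rewrite powR0// gt_eqF// (lt_trans _ a1).
  by rewrite ge1r_powR ?l1 ?(ltW a1)// lt0r ln0 l0.
rewrite lerD//; first by rewrite ler_wpM2r ?powR_ge0 ?le_pow.
by rewrite mulrCA ler_wpM2r ?mulr_ge0 ?mu0 ?powR_ge0 ?le_pow.
Qed.

(** The sum is at most twice the larger term; this monotonicity argument takes the place of
    convexity. *)
Lemma calHD_le x s t : Omega x -> 0 <= s -> 0 <= t ->
  H x (s + t) <= H x (2 * s) + H x (2 * t).
Proof.
move=> Ox s0 t0; have [st|/ltW ts] := leP s t.
  rewrite (@le_trans _ _ (H x (2 * t)))// ?lerDr ?calH_ge0//.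
  by apply: le_calH => //; [exact: addr_ge0|lra].
rewrite (@le_trans _ _ (H x (2 * s)))// ?lerDl ?calH_ge0//.
by apply: le_calH => //; [exact: addr_ge0|lra].
Qed.

Lemma calHZ_ge1_le x c t : Omega x -> 1 <= c -> 0 <= t ->
  H x (c * t) <= c `^ q * H x t.
Proof.
move=> Ox c1 t0; have c0 : 0 <= c by lra.
rewrite mulrDr /calH !powRM// mulrCA lerD// ler_wpM2r ?powR_ge0//.
by apply: ler_powR => //; exact: ltW.
Qed.

Lemma mfun_on_calH w : mfun_on Omega w -> mfun_on Omega (fun x => H x (w x)).
Proof.
by move=> mw; apply: mfun_onD; [|apply: mfun_onM => //]; exact: mfun_on_powR.
Qed.

Section modulars.
Hypothesis mOmega : measurable (Omega : set (lebesgue_space R N)).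
Hypothesis fOmega : (lebesgue (Omega : set (lebesgue_space R N)) < +oo)%E.
Implicit Types w : 'rV[R]_N -> R.
Local Open Scope ereal_scope.

Lemma le_modular w1 w2 : mfun_on Omega w1 -> mfun_on Omega w2 ->
  (forall x, Omega x -> `|w1 x| <= `|w2 x|)%R ->
  modular Omega p q mu w1 <= modular Omega p q mu w2.
Proof.
move=> m1 m2 w12; apply: le_int_on => //.
- by apply: mfun_on_calH; exact: mfun_on_norm.
- by apply: mfun_on_calH; exact: mfun_on_norm.
- by move=> x Ox; exact: calH_ge0.
- by move=> x Ox; apply: le_calH => //; exact: w12.
Qed.

Lemma modularZ_le w lam : mfun_on Omega w -> (0 <= lam <= 1)%R ->
  modular Omega p q mu (fun x => lam * w x)%R <= lam%:E * modular Omega p q mu w.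
Proof.
move=> mw l01; have /andP[l0 _] := l01.
rewrite -[modular _ _ _ _ w]/(int_on Omega (fun x => H x `|w x|)) -int_onZ//.
- apply: le_int_on => //.
  + by apply: mfun_on_calH; apply: mfun_on_norm; apply: mfun_onM => //; exact: mfun_on_cst.
  + apply: mfun_onM; first exact: mfun_on_cst.
    by apply: mfun_on_calH; exact: mfun_on_norm.
  + by move=> x Ox; exact: calH_ge0.
  + by move=> x Ox; rewrite normrM (ger0_norm l0); exact: calHZ_le.
- by apply: mfun_on_calH; exact: mfun_on_norm.
- by move=> x Ox; exact: calH_ge0.
Qed.

Lemma modularZ_lty w c : mfun_on Omega w -> modular Omega p q mu w < +oo ->
  modular Omega p q mu (fun x => c * w x)%R < +oo.
Proof.
move=> mw woo; pose d := (`|c| + 1)%R.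
have d1 : (1 <= d)%R by rewrite lerDr.
apply: (@le_lt_trans _ _ ((d `^ q)%:E * modular Omega p q mu w)).
  rewrite -[modular _ _ _ _ w]/(int_on Omega (fun x => H x `|w x|)) -int_onZ//.
  - apply: le_int_on => //.
    + by apply: mfun_on_calH; apply: mfun_on_norm; apply: mfun_onM => //; exact: mfun_on_cst.
    + apply: mfun_onM; first exact: mfun_on_cst.
      by apply: mfun_on_calH; exact: mfun_on_norm.
    + by move=> x Ox; exact: calH_ge0.
    + move=> x Ox; apply: le_trans (calHZ_ge1_le Ox d1 (normr_ge0 _)).
      by apply: le_calH => //; rewrite normrM ler_wpM2r// lerDl.
  - by apply: mfun_on_calH; exact: mfun_on_norm.
  - exact: powR_ge0.
  - by move=> x Ox; exact: calH_ge0.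
by apply: lte_mul_pinfty; rewrite ?lee_fin ?powR_ge0.
Qed.

(** Some t < e^2 has w/t of modular at most 1, and w/e is w/t scaled by t/e <= e <= 1. The square in
    the hypothesis pays once for the factor 1/e and once for the bound e. *)
Lemma normH_lt w (e : R) : mfun_on Omega w -> (0 < e)%R ->
  normH Omega p q mu w < (e ^+ 2)%:E -> (e <= 1)%R ->
  modular Omega p q mu (fun x => e^-1 * w x)%R <= e%:E.
Proof.
move=> mw e0 /ereal_inf_lt[_ [t [t0 wt] <-]]; rewrite lte_fin => te e1.
have mwt : mfun_on Omega (fun x => w x / t)%R.
  by apply: mfun_onM => //; exact: mfun_on_cst.
have lete : (t / e <= e)%R by rewrite ler_pdivrMr// -expr2 ltW.
have l01 : (0 <= t / e <= 1)%R by apply/andP; split; [apply: divr_ge0; exact: ltW|exact: le_trans e1].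
have := modularZ_le mwt l01.
rewrite (_ : (fun x => _) = (fun x => e^-1 * w x)%R); last first.
  by apply/funext => x; field; rewrite !gt_eqF.
move=> /le_trans; apply; apply: (@le_trans _ _ ((t / e)%:E * 1)).
  by apply: lee_wpmul2l => //; rewrite lee_fin; case/andP: l01.
by rewrite mule1 lee_fin.
Qed.

Lemma normH_le w (e : R) : (0 < e)%R ->
  modular Omega p q mu (fun x => w x / e)%R <= 1 -> normH Omega p q mu w <= e%:E.
Proof. by move=> e0 we; apply: ereal_inf_lbound; exists e. Qed.

Lemma normH_ge0 w : 0 <= normH Omega p q mu w.
Proof.
by apply: le_ereal_inf_tmp => _ [t [t0 _] <-]; rewrite lee_fin ltW.
Qed.

Lemma int_on_le_modular w c : mfun_on Omega w -> (0 < c)%R ->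
  int_on Omega (fun x => `|w x|)%R <= (c^-1)%:E *
    (lebesgue (Omega : set (lebesgue_space R N)) +
     modular Omega p q mu (fun x => c * w x)%R).
Proof.
move=> mw c0.
have mcw : mfun_on Omega (fun x => c * w x)%R.
  by apply: mfun_onM => //; exact: mfun_on_cst.
have mH : mfun_on Omega (fun x => H x `|c * w x|)%R.
  by apply: mfun_on_calH; exact: mfun_on_norm.
have -> : lebesgue (Omega : set (lebesgue_space R N)) = int_on Omega (fun=> 1%R).
  by rewrite int_on_cst// mul1e.
rewrite -[modular _ _ _ _ _]/(int_on Omega (fun x => H x `|c * w x|)%R) -int_onD//.
- rewrite -int_onZ//.
  + apply: le_int_on => //.
    * exact: mfun_on_norm.
    * apply: mfun_onM; first exact: mfun_on_cst.
      by apply: mfun_onD; first exact: mfun_on_cst.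
    * move=> x Ox; have := le_1DcalH `|c * w x|%R Ox.
      by rewrite normrM (gtr0_norm c0) -ler_pdivlMl.
  + by apply: mfun_onD; first exact: mfun_on_cst.
  + by rewrite invr_ge0 ltW.
  + by move=> x Ox; rewrite addr_ge0// calH_ge0.
- exact: mfun_on_cst.
- by move=> x Ox; exact: calH_ge0.
Qed.

Lemma in_LH_integrable w : in_LH Omega p q mu w ->
  lebesgue.-integrable (Omega : set (lebesgue_space R N)) (EFin \o w).
Proof.
move=> [mw woo]; apply/integrableP; split; first exact: mfun_on_EFin.
apply: (@le_lt_trans _ _ (int_on Omega (fun x => `|w x|)%R)); first by [].
apply: le_lt_trans (int_on_le_modular mw ltr01) _.
rewrite invr1 mul1e; apply: lte_add_pinfty; first exact: fOmega.
by rewrite (_ : (fun x => _) = w)//; apply/funext => x; rewrite mul1r.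
Qed.

End modulars.

End double_phase.

(** * Rapidly converging approximations *)

Section double_phase_sequences.
Variables (R : realType) (N : nat) (Omega : set 'rV[R]_N) (p q : R).
Variable mu : 'rV[R]_N -> R.
Hypotheses (p1 : 1 < p) (pq : p < q).
Hypothesis mu0 : forall x, Omega x -> 0 <= mu x.
Hypothesis mmu : mfun_on Omega mu.
Hypothesis oOmega : open Omega.
Hypothesis fOmega : (lebesgue (Omega : set (lebesgue_space R N)) < +oo)%E.
Local Notation H := (calH p q mu).
Local Notation modular := (modular Omega p q mu).
Local Notation half k := (2^-1 ^+ k : R).

Let mOmega : measurable (Omega : set (lebesgue_space R N)).
Proof. exact: measurable_Omega. Qed.
Let p0 : 0 < p. Proof. exact: lt_trans p1. Qed.

Lemma half_gt0 k : 0 < half k.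
Proof. by rewrite exprn_gt0// invr_gt0 ltr0n. Qed.

Lemma half_le1 k : half k <= 1.
Proof. by rewrite exprn_ile1// ?invr_ge0// invf_le1// ler1n. Qed.

Lemma cvg_half : half k @[k --> \oo] --> 0.
Proof. by apply: cvg_expr; rewrite gtr0_norm ?invr_gt0 ?ltr0n// invf_lt1// ltr1n. Qed.

Lemma near_half (e : R) : 0 < e -> \forall k \near \oo, half k <= e.
Proof.
move=> e0; have /cvgr0Pnorm_lt/(_ e e0) := cvg_half.
by apply: filterS => k; rewrite gtr0_norm ?half_gt0// => /ltW.
Qed.

Section rapid_sequence.
Variable w : nat -> 'rV[R]_N -> R.
Hypothesis mw : forall k, mfun_on Omega (w k).
Hypothesis rw : forall k,
  (modular (fun x => (half k)^-1 * w k x)%R <= (half k)%:E)%E.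

Let mHw k : mfun_on Omega (fun x => H x `|(half k)^-1 * w k x|).
Proof.
apply: mfun_on_calH => //; apply: mfun_on_norm; apply: mfun_onM => //.
exact: mfun_on_cst.
Qed.

(** The modulars of 2^k [w k] are bounded by 2^-k, so almost everywhere H(x, 2^k |w k x|) is
    eventually at most 1, which forces |w k x| <= 2^-k. No subsequence has to be extracted. *)
Lemma rapid_ae_cvg : {ae lebesgue, forall x, Omega x -> w k x @[k --> \oo] --> 0}.
Proof.
have Hw0 k x : Omega x -> 0 <= H x `|(half k)^-1 * w k x|.
  by move=> Ox; exact: (calH_ge0 _ _ mu0).
have := ae_eventually_le1 mOmega mHw Hw0 rw.
apply: filterS => x Hx Ox.
apply: (@squeeze_cvgr _ _ _ _ (fun k => - half k) (fun k => half k)); last exact: cvg_half.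
  apply: filterS (Hx Ox) => k Hk; rewrite -ler_norml.
  have : `|(half k)^-1 * w k x| <= 1.
    rewrite leNgt; apply/negP => lt1.
    have := le1r_powR (ltW lt1) (ltW p1).
    have := powR_le_calH p q mu0 `|(half k)^-1 * w k x| Ox.
    by move: lt1 Hk; lra.
  by rewrite normrM gtr0_norm ?invr_gt0 ?half_gt0// mulrC ler_pdivrMr ?half_gt0// mul1r.
by rewrite -oppr0; apply: cvgN; exact: cvg_half.
Qed.

Lemma rapid_int_cvg : int_on Omega (fun x => `|w k x|) @[k --> \oo] --> 0%E.
Proof.
have fin : lebesgue (Omega : set (lebesgue_space R N)) \is a fin_num.
  by rewrite ge0_fin_numE.
set V := fine (lebesgue (Omega : set (lebesgue_space R N))).
apply: (@squeeze_cvge _ _ _ _ (cst 0%E) _ (fun k => (half k * (V + 1))%:E)).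
- apply: nearW => k; rewrite int_on_ge0//=.
  have ik0 : 0 < (half k)^-1 by rewrite invr_gt0 half_gt0.
  apply: (le_trans (int_on_le_modular q p1 mu0 mmu mOmega (mw k) ik0)).
  rewrite invrK EFinM; apply: lee_wpmul2l; first by rewrite lee_fin ltW// half_gt0.
  rewrite EFinD /V fineK//; apply: leeD2l; apply: (le_trans (rw k)).
  by rewrite lee_fin half_le1.
- exact: cvg_cst.
- apply: cvg_EFin; first exact: nearW.
  by rewrite -[X in _ --> X](mul0r (V + 1)); apply: cvgMl; exact: cvg_half.
Qed.

(** The scaling 2^k contained in the hypothesis eventually exceeds any constant. *)
Lemma rapid_modular (c : R) : \forall k \near \oo,
  (modular (fun x => c * w k x)%R <= (half k)%:E)%E.
Proof.
have c0 : 0 < (`|c| + 1)^-1 by rewrite invr_gt0 ltr_wpDl.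
apply: filterS (near_half c0) => k; rewrite -[leRHS]invrK invrK => hk.
apply: le_trans (rw k); apply: le_modular => //.
- by apply: mfun_onM => //; exact: mfun_on_cst.
- by apply: mfun_onM => //; exact: mfun_on_cst.
move=> x _; rewrite !normrM ler_wpM2r// (gtr0_norm (_ : 0 < (half k)^-1)) ?invr_gt0 ?half_gt0//.
apply: (@le_trans _ _ (`|c| + 1)); first by rewrite lerDl.
by rewrite -[leLHS]invrK lef_pV2// ?posrE ?half_gt0.
Qed.

End rapid_sequence.

Lemma mfun_on_test phi : test_function Omega phi -> mfun_on Omega phi.
Proof.
move=> tphi; apply: measurable_funTS; apply: continuous_lebesgue.
exact: test_function_continuous tphi.
Qed.

Lemma mfun_on_grad phi i : test_function Omega phi ->
  mfun_on Omega (fun x => grad phi x 0 i).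
Proof.
move=> tphi; rewrite (_ : (fun x => _) = partial i phi).
  exact: mfun_on_test (test_function_partial i tphi).
by apply/funext => x; rewrite mxE.
Qed.

Lemma mfun_on_coordB (V W : 'rV[R]_N -> 'rV[R]_N) :
  (forall i, mfun_on Omega (fun x => V x 0 i)) ->
  (forall i, mfun_on Omega (fun x => W x 0 i)) ->
  mfun_on Omega (fun x => enorm (V x - W x)).
Proof.
move=> mV mW; apply: measurable_enorm => i.
rewrite (_ : (fun x => _) = (fun x => V x 0 i - W x 0 i)); first exact: mfun_onB.
by apply/funext => x; rewrite !mxE.
Qed.

(* An approximating sequence so fast that it converges almost everywhere, in L^1
   and in modular after scaling by any constant. *)
Definition approximates (u : 'rV[R]_N -> R) (Du : 'rV[R]_N -> 'rV[R]_N)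
    (psi : nat -> 'rV[R]_N -> R) : Prop :=
  forall k, [/\ test_function Omega (psi k),
    (modular (fun x => (half k)^-1 * (psi k x - u x))%R <= (half k)%:E)%E &
    (modular (fun x => (half k)^-1 * enorm (grad (psi k) x - Du x))%R
       <= (half k)%:E)%E].

Lemma in_W1H0_approximates u Du : in_W1H0 Omega p q mu u Du ->
  exists psi, approximates u Du psi.
Proof.
move=> [[[mu_ _] mDu _ _] [phi [tphi phicv]]].
pose P k psi := [/\ test_function Omega psi,
    (modular (fun x => (half k)^-1 * (psi x - u x))%R <= (half k)%:E)%E &
    (modular (fun x => (half k)^-1 * enorm (grad psi x - Du x))%R
       <= (half k)%:E)%E].
suff /choice[psi psiP] : forall k, exists psi, P k psi by exists psi.
move=> k.
(* The squared tolerance is the one from which [normH_lt] yields both the scaling by 2^k and the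
   bound 2^-k. *)
have e2 : (0 < ((half k) ^+ 2)%:E)%E by rewrite lte_fin exprn_gt0// half_gt0.
have nb : nbhs (0%E : \bar R) [set y | (y < ((half k) ^+ 2)%:E)%E].
  exact: open_ereal_lt'.
have [n _ /(_ n (leqnn n)) /= lt] := phicv _ nb.
have n1 : (normH Omega p q mu (fun x => phi n x - u x)%R < ((half k) ^+ 2)%:E)%E.
  by apply: le_lt_trans lt; rewrite /norm1H leeDr//; exact: normH_ge0.
have n2 : (normH Omega p q mu (fun x => enorm (grad (phi n) x - Du x)) <
    ((half k) ^+ 2)%:E)%E.
  by apply: le_lt_trans lt; rewrite /norm1H leeDl//; exact: normH_ge0.
have m1 := mfun_onB (mfun_on_test (tphi n)) mu_.
have m2 := mfun_on_coordB (fun i => mfun_on_grad i (tphi n)) mDu.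
exists (phi n); split; first exact: tphi.
  exact: (normH_lt p1 pq mu0 mmu mOmega m1 (half_gt0 k) n1 (half_le1 k)).
exact: (normH_lt p1 pq mu0 mmu mOmega m2 (half_gt0 k) n2 (half_le1 k)).
Qed.

(** * Chain rule for smooth functions of elements of W^{1,H}_0 *)

Section chain_rule.
Variables (u : 'rV[R]_N -> R) (Du : 'rV[R]_N -> 'rV[R]_N).
Variable psi : nat -> 'rV[R]_N -> R.
Hypotheses (uW : in_W1H Omega p q mu u Du) (uapp : approximates u Du psi).
Variable G : nat -> R -> R.
Hypotheses (dG : derivative_chain G) (G00 : G 0%N 0 = 0).
Hypothesis G01 : forall s, 0 <= G 1%N s <= 1.

Let tpsi k : test_function Omega (psi k). Proof. by case: (uapp k). Qed.
Let mu_ : mfun_on Omega u. Proof. by case: uW => -[]. Qed.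
Let mDu i : mfun_on Omega (fun x => Du x 0 i). Proof. by case: uW => _ mDu _ _; exact: mDu. Qed.
Let mG1u : mfun_on Omega (fun x => G 1%N (u x)).
Proof. exact: (@mfun_on_comp _ _ _ (G 1%N) u (derivative_chain_continuous dG) mu_). Qed.

Let normG1 s : `|G 1%N s| <= 1.
Proof. by have /andP[? ?] := G01 s; rewrite ger0_norm. Qed.

Let normG0 s : `|G 0%N s| <= `|s|.
Proof.
by have := derivative_chain_lipschitz s 0 dG normG1; rewrite G00 !subr0.
Qed.

Let w k x := psi k x - u x.
Let e k x := enorm (grad (psi k) x - Du x).
(** The part of the gradient error due to the change of G' falls on the fixed function Du with this
    weight; it is at most 1 and tends to 0 almost everywhere, so dominated convergence disposes of
    it. *)
Let lam k x := `|G 1%N (psi k x) - G 1%N (u x)|.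

Let mw k : mfun_on Omega (w k). Proof. exact: mfun_onB (mfun_on_test _) mu_. Qed.
Let me k : mfun_on Omega (e k).
Proof. exact: (mfun_on_coordB (fun i => mfun_on_grad i (tpsi k)) mDu). Qed.
Let mlam k : mfun_on Omega (lam k).
Proof.
apply: mfun_on_norm; apply: mfun_onB mG1u.
exact: (@mfun_on_comp _ _ _ (G 1%N) (psi k) (derivative_chain_continuous dG)
  (mfun_on_test (tpsi k))).
Qed.
Let mN : mfun_on Omega (fun x => enorm (Du x)).
Proof. by apply: measurable_enorm => i; exact: mDu. Qed.
Let rw k : (modular (fun x => (half k)^-1 * w k x)%R <= (half k)%:E)%E.
Proof. by have [_ rw _] := uapp k. Qed.
Let re k : (modular (fun x => (half k)^-1 * e k x)%R <= (half k)%:E)%E.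
Proof. by have [_ _ re] := uapp k. Qed.

Let lam01 k x : 0 <= lam k x <= 1.
Proof.
rewrite normr_ge0/= /lam ler_norml.
have /andP[a0 a1] := G01 (psi k x); have /andP[b0 b1] := G01 (u x).
by apply/andP; split; lra.
Qed.

Let lam_cvg : {ae lebesgue, forall x, Omega x -> lam k x @[k --> \oo] --> 0}.
Proof.
apply: filterS (rapid_ae_cvg mw rw) => x H Ox; have := H Ox => {H} wx.
have psix : psi k x @[k --> \oo] --> u x.
  rewrite (_ : (fun k => _) = (fun k => w k x + u x)); last first.
    by apply/funext => k; rewrite /w subrK.
  by rewrite -[X in _ --> X]add0r; apply: cvgD => //; exact: cvg_cst.
rewrite -[X in _ --> X](normr0 R); apply: cvg_norm.
rewrite -(subrr (G 1%N (u x))); apply: cvgB; last exact: cvg_cst.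
exact: (continuous_cvg _ (@derivative_chain_continuous _ G 1%N dG (u x)) psix).
Qed.

Let v x := G 0%N (u x).
Let Dv x := G 1%N (u x) *: Du x.
Let chi k := G 0%N \o psi k.

Let tchi k : test_function Omega (chi k). Proof. exact: test_function_comp. Qed.

Let grad_chi k x : grad (chi k) x = G 1%N (psi k x) *: grad (psi k) x.
Proof.
apply/rowP => i; rewrite !mxE; apply: partial_comp; last exact: dG.
by apply: smooth_derivable; case: (tpsi k).
Qed.

Let chi_v k x : `|chi k x - v x| <= `|w k x|.
Proof. exact: derivative_chain_lipschitz. Qed.

Let grad_chi_Dv k x :
  enorm (grad (chi k) x - Dv x) <= e k x + lam k x * enorm (Du x).
Proof.
rewrite grad_chi (_ : _ - _ = G 1%N (psi k x) *: (grad (psi k) x - Du x) +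
  (G 1%N (psi k x) - G 1%N (u x)) *: Du x).
  apply: (le_trans (ler_enormD _ _)); rewrite !enormZ lerD2r.
  by rewrite ler_piMl ?enorm_ge0.
by apply/rowP => i; rewrite /Dv !mxE; ring.
Qed.

Let mv : mfun_on Omega v.
Proof. exact: (@mfun_on_comp _ _ _ (G 0%N) u (derivative_chain_continuous dG) mu_). Qed.

Let mDv i : mfun_on Omega (fun x => Dv x 0 i).
Proof.
rewrite (_ : (fun x => _) = (fun x => G 1%N (u x) * Du x 0 i)); first exact: (mfun_onM mG1u (mDu i)).
by apply/funext => x; rewrite /Dv mxE.
Qed.

Let mNDv : mfun_on Omega (fun x => enorm (Dv x)).
Proof. by apply: measurable_enorm => i; exact: mDv. Qed.

Lemma chain_in_LH : in_LH Omega p q mu v /\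
  in_LH Omega p q mu (fun x => enorm (Dv x)).
Proof.
have [[_ uoo] _ [_ Duoo] _] := uW.
split; split.
- exact: mv.
- by apply: le_lt_trans uoo; apply: (le_modular p1 pq mu0 mmu mOmega mv mu_) => x _; exact: normG0.
- exact: mNDv.
- apply: le_lt_trans Duoo; apply: (le_modular p1 pq mu0 mmu mOmega mNDv mN) => x _.
  by rewrite enormZ normrM normr_id ler_piMl.
Qed.

Let int_grad : int_on Omega (fun x => enorm (grad (chi k) x - Dv x)) @[k --> \oo] --> 0%E.
Proof.
have [_ _ DuL _] := uW.
have Duoo : (int_on Omega (fun x => enorm (Du x)) < +oo)%E.
  have := integrable_int_on (in_LH_integrable p1 mu0 mmu mOmega fOmega DuL).
  rewrite (_ : (fun x => `|enorm (Du x)|) = (fun x => enorm (Du x)))//.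
  by apply/funext => x; rewrite ger0_norm ?enorm_ge0.
have c1 := rapid_int_cvg me re.
have c2 := cvg_integral_weight mOmega mlam mN (fun k x _ => lam01 k x)
  (fun x _ => enorm_ge0 _) Duoo lam_cvg.
apply: (@squeeze_cvge _ _ _ _ (cst 0%E) _ (fun k => (int_on Omega (fun x => `|e k x|%R) +
  int_on Omega (fun x => (lam k x * enorm (Du x))%R))%E)).
- apply: nearW => k; apply/andP; split.
    by apply: int_on_ge0 => x _; exact: enorm_ge0.
  rewrite -int_onD//; last 3 first.
  - exact: mfun_on_norm.
  - exact: (mfun_onM (mlam k) mN).
  - by move=> x _; rewrite mulr_ge0 ?enorm_ge0//; have /andP[] := lam01 k x.
  apply: le_int_on => //.
  + exact: (mfun_on_coordB (fun i => mfun_on_grad i (tchi k)) mDv).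
  + by apply: mfun_onD; [exact: (mfun_on_norm (me k))|exact: (mfun_onM (mlam k) mN)].
  + by move=> x _; exact: enorm_ge0.
  + by move=> x _; rewrite (ger0_norm (enorm_ge0 _)).
- exact: cvg_cst.
- by rewrite -[X in _ --> X]adde0; apply: cvgeD.
Qed.

(** Integration by parts holds for the test functions [chi k]. Both sides pass to the limit, as
    [chi k] and its gradient converge in L^1 and are integrated against bounded functions. *)
Lemma chain_weak_gradient : weak_gradient Omega v Dv.
Proof.
move=> phi i tphi.
have [vL DvL] := chain_in_LH.
have tdphi := test_function_partial i tphi.
have int_test f : test_function Omega f ->
    lebesgue.-integrable (Omega : set (lebesgue_space R N)) (EFin \o f).
  move=> tf; apply: (@integrableS _ _ _ _ setT) => //.
  exact: integrable_test_function tf.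
have c1 : (\int[lebesgue]_(x in Omega) (chi k x * partial i phi x)%:E @[k --> \oo] -->
    \int[lebesgue]_(x in Omega) (v x * partial i phi x)%:E)%E.
  have [M M0 phiM] := test_function_bounded tdphi.
  apply: (@cvg_integral_mulr _ _ _ mOmega chi v _ M).
  - by move=> k; exact: int_test.
  - exact: in_LH_integrable vL.
  - exact: mfun_on_test.
  - by move=> x _; exact: phiM.
  - have := rapid_int_cvg mw rw.
    apply: squeeze_cvge; last exact: cvg_cst.
    apply: nearW => k; rewrite int_on_ge0//=; apply: le_int_on => //.
    + by apply: mfun_on_norm; exact: mfun_onB (mfun_on_test _) mv.
    + exact: mfun_on_norm.
have c2 : (\int[lebesgue]_(x in Omega) (partial i (chi k) x * phi x)%:E @[k --> \oo] -->
    \int[lebesgue]_(x in Omega) (Dv x 0%R i * phi x)%:E)%E.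
  have [M M0 phiM] := test_function_bounded tphi.
  apply: (@cvg_integral_mulr _ _ _ mOmega (fun k => partial i (chi k)) (fun x => Dv x 0 i) _ M).
  - by move=> k; apply: int_test; exact: test_function_partial.
  - apply: (le_integrable mOmega _ _ (in_LH_integrable p1 mu0 mmu mOmega fOmega DvL)).
      exact: (mfun_on_EFin (mDv i)).
    move=> x _; rewrite /= lee_fin (ger0_norm (enorm_ge0 _)); exact: coord_le_enorm.
  - exact: mfun_on_test.
  - by move=> x _; exact: phiM.
  - have := int_grad.
    apply: squeeze_cvge; last exact: cvg_cst.
    apply: nearW => k; rewrite int_on_ge0//=; apply: le_int_on => //.
    + apply: mfun_on_norm; apply: mfun_onB => //; apply: mfun_on_test.
      exact: test_function_partial.
    + exact: (mfun_on_coordB (fun i => mfun_on_grad i (tchi k)) mDv).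
    + move=> x _; have := coord_le_enorm (grad (chi k) x - Dv x) i.
      by rewrite !mxE.
have E : (fun k => \int[lebesgue]_(x in Omega) (chi k x * partial i phi x)%:E)%E =
    (fun k => - \int[lebesgue]_(x in Omega) (partial i (chi k) x * phi x)%:E)%E.
  by apply/funext => k; exact: integral_by_parts.
rewrite E in c1; have c3 := cvgeN c2.
exact: (cvg_unique _ c1 (c3 _)).
Qed.

Lemma chain_in_W1H0 : in_W1H0 Omega p q mu v Dv.
Proof.
have [vL DvL] := chain_in_LH.
split; first by split; [exact: vL|exact: mDv|exact: DvL|exact: chain_weak_gradient].
exists chi; split=> //.
have [_ _ [_ Duoo] _] := uW.
suff H (t : R) : 0 < t -> \forall k \near \oo,
    (norm1H Omega p q mu (fun x => (chi k x - v x)%R)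
      (fun x => (grad (chi k) x - Dv x)%R) <= (t + t)%:E)%E.
  apply/fine_cvgP; split.
    apply: filterS (H 1 ltr01) => k Hk; rewrite ge0_fin_numE.
      by apply: le_lt_trans Hk _; exact: ltry.
    by rewrite adde_ge0// normH_ge0.
  apply/cvgr0Pnorm_lt => t t0.
  have t4 : 0 < t / 4 by rewrite divr_gt0.
  apply: filterS (H _ t4) => k Hk /=.
  have nn : (0 <= norm1H Omega p q mu (fun x => (chi k x - v x)%R)
      (fun x => (grad (chi k) x - Dv x)%R))%E by rewrite adde_ge0// normH_ge0.
  move: (norm1H _ _ _ _ _ _) nn Hk => [a| |]//=; rewrite !lee_fin => a0 at4.
  by rewrite ger0_norm//; lra.
move=> t0.
have Hv := rapid_modular mw rw t^-1.
(* The norm is at most t once the modular of the quotient by t is at most 1; the factor 2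
   anticipates the splitting of a sum by [calHD_le]. Each of the two parts of the gradient error
   will contribute at most 1/2. *)
have He := rapid_modular me re (2 / t).
have hoo : (modular (fun x => (2 / t) * enorm (Du x))%R < +oo)%E.
  exact: modularZ_lty.
have mh : mfun_on Omega (fun x => H x `|2 / t * enorm (Du x)|).
  apply: mfun_on_calH => //; apply: mfun_on_norm; apply: mfun_onM => //.
  exact: mfun_on_cst.
have h0 x : Omega x -> 0 <= H x `|2 / t * enorm (Du x)|.
  by move=> Ox; exact: (calH_ge0 _ _ mu0).
have Hl := cvg_integral_weight mOmega mlam mh (fun k x _ => lam01 k x) h0 hoo lam_cvg.
have nb : nbhs (0%E : \bar R) [set y | (y < (2^-1)%:E)%E].
  by apply: open_ereal_lt'; rewrite lte_fin invr_gt0.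
have {}Hl : \forall k \near \oo,
    (int_on Omega (fun x => (lam k x * H x `|2 / t * enorm (Du x)|)%R) < (2^-1)%:E)%E.
  exact: Hl _ nb.
have h2 : 0 < 2^-1 :> R by rewrite invr_gt0.
apply: filterS3 Hv He (filterI Hl (near_half h2)) => k Hvk Hek [Hlk hk1].
rewrite EFinD; apply: leeD; apply: normH_le => //.
  apply: (@le_trans _ _ ((2^-1)%:E + (2^-1)%:E)%E); last first.
    by rewrite -EFinD lee_fin; lra.
  have E1 : (modular (fun x => (2 / t) * e k x)%R <= (2^-1)%:E)%E.
    by apply: (le_trans Hek); rewrite lee_fin.
  have E2 : (int_on Omega (fun x => (lam k x * H x `|2 / t * enorm (Du x)|)%R) <= (2^-1)%:E)%E.
    exact: ltW Hlk.
  apply: le_trans (leeD E1 E2).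
  have mek : mfun_on Omega (fun x => H x `|2 / t * e k x|).
    apply: mfun_on_calH => //; apply: mfun_on_norm; apply: mfun_onM => //.
    exact: mfun_on_cst.
  have mlk : mfun_on Omega (fun x => lam k x * H x `|2 / t * enorm (Du x)|).
    exact: mfun_onM.
  have hek0 x : Omega x -> 0 <= H x `|2 / t * e k x|.
    by move=> Ox; exact: (calH_ge0 _ _ mu0).
  have hlk0 x : Omega x -> 0 <= lam k x * H x `|2 / t * enorm (Du x)|.
    by move=> Ox; rewrite mulr_ge0 ?h0//; have /andP[] := lam01 k x.
  rewrite -[X in (_ <= X + _)%E]/(int_on Omega (fun x => H x `|2 / t * e k x|)).
  rewrite -(int_onD mOmega mek mlk hek0 hlk0).
  apply: (le_int_on mOmega).
  - apply: mfun_on_calH => //; apply: mfun_on_norm; apply: mfun_onM; last exact: mfun_on_cst.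
    exact: (mfun_on_coordB (fun i => mfun_on_grad i (tchi k)) mDv).
  - exact: (mfun_onD mek mlk).
  - by move=> x Ox; exact: (calH_ge0 _ _ mu0).
  - move=> x Ox.
    have ek0 : 0 <= e k x := enorm_ge0 _.
    have l0 : 0 <= lam k x by have /andP[] := lam01 k x.
    have D0 := enorm_ge0 (Du x).
    have it0 : 0 <= t^-1 by rewrite invr_ge0 ltW.
    apply: (@le_trans _ _ (H x (t^-1 * e k x + t^-1 * (lam k x * enorm (Du x))))).
      apply: (le_calH p1 pq mu0) => //.
      rewrite normrM (ger0_norm it0) (ger0_norm (enorm_ge0 _)) -mulrDr mulrC.
      by rewrite ler_wpM2l// grad_chi_Dv.
    apply: (le_trans (calHD_le p1 pq mu0 Ox _ _)); rewrite ?mulr_ge0//.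
    rewrite ger0_norm ?mulr_ge0// ger0_norm ?mulr_ge0// -mulrA lerD2l.
    rewrite (_ : 2 * (t^-1 * _) = lam k x * (2 * t^-1 * enorm (Du x))); last by ring.
    by apply: (calHZ_le p1 pq mu0 Ox (lam01 k x)); rewrite mulr_ge0// mulr_ge0.
apply: (@le_trans _ _ (half k)%:E); last by rewrite lee_fin half_le1.
apply: (le_trans _ Hvk); apply: (le_modular p1 pq mu0 mmu mOmega).
- apply: mfun_onM; last exact: mfun_on_cst.
  exact: mfun_onB (mfun_on_test _) mv.
- by apply: mfun_onM => //; exact: mfun_on_cst.
- by move=> x _; rewrite mulrC !normrM ler_wpM2l.
Qed.

End chain_rule.

End double_phase_sequences.

(** * Sobolev's inequality in W^{1,H}_0 *)

Lemma powRD_le (R : realType) (p a b : R) : 0 <= p -> 0 <= a -> 0 <= b ->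
  (a + b) `^ p <= (2 * a) `^ p + (2 * b) `^ p.
Proof.
move=> p0 a0 b0; have [ab|/ltW ba] := leP a b.
  apply: (@le_trans _ _ ((2 * b) `^ p)); last by rewrite lerDr powR_ge0.
  by apply: ge0_ler_powR; rewrite ?nnegrE//; lra.
apply: (@le_trans _ _ ((2 * a) `^ p)); last by rewrite lerDl powR_ge0.
by apply: ge0_ler_powR; rewrite ?nnegrE//; lra.
Qed.

Section fatou_eventually.
Variables (R : realType) (N : nat) (Omega : set 'rV[R]_N).
Hypothesis mOmega : measurable (Omega : set (lebesgue_space R N)).
Local Open Scope ereal_scope.

Lemma limn_einf_le (v : nat -> \bar R) c :
  (\forall k \near \oo, v k <= c) -> limn_einf v <= c.
Proof.
move=> vc; rewrite limn_einf_lim; apply: lime_le; first exact: is_cvg_einfs.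
apply: filterS vc => k; apply: le_trans; apply: ereal_inf_lbound.
by exists k => //=.
Qed.

Lemma fatou_int_on (f : nat -> 'rV[R]_N -> R) (h : 'rV[R]_N -> R) (c : \bar R) :
  (forall k, mfun_on Omega (f k)) -> mfun_on Omega h ->
  (forall k x, (0 <= f k x)%R) -> (forall x, (0 <= h x)%R) ->
  {ae lebesgue, forall x, Omega x -> f k x @[k --> \oo] --> h x} ->
  (\forall k \near \oo, int_on Omega (f k) <= c) -> int_on Omega h <= c.
Proof.
move=> mf mh f0 h0 fh fc.
pose F k x := (f k x)%:E.
have mF k : measurable_fun (Omega : set (lebesgue_space R N)) (F k).
  exact: mfun_on_EFin (mf k).
have F0 k x : Omega x -> 0 <= F k x by rewrite lee_fin.
have lF0 x : 0 <= limn_einf (F ^~ x).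
  rewrite limn_einf_lim; apply: lime_ge; first exact: is_cvg_einfs.
  by apply: nearW => k; apply: le_ereal_inf_tmp => _ [j _ <-]; rewrite lee_fin.
have mlF : measurable_fun (Omega : set (lebesgue_space R N)) (fun x => limn_einf (F ^~ x)).
  apply: (emeasurable_fun_cvg
    (fun n (x : lebesgue_space R N) => einfs (F ^~ x) n)).
    by move=> m; exact: (@measurable_fun_einfs _ (lebesgue_space R N) _ Omega F mF m).
  by move=> x _; rewrite limn_einf_lim; exact: is_cvg_einfs.
apply: (@le_trans _ _ (\int[lebesgue]_(x in Omega) limn_einf (F ^~ x))).
  apply: (ae_ge0_le_integral mOmega).
  - by move=> x _; rewrite lee_fin.
  - exact: mfun_on_EFin.
  - by move=> x _; exact: lF0.
  - exact: mlF.
  - apply: filterS fh => x fx Ox.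
    have Fx : F k x @[k --> \oo] --> (h x)%:E.
      by apply: cvg_EFin; [exact: nearW|exact: fx].
    by rewrite (cvg_limn_einf_sup Fx).1.
apply: (le_trans (fatou lebesgue mOmega mF F0)).
exact: limn_einf_le fc.
Qed.

End fatou_eventually.

Section sobolev_W1H0.
Variables (R : realType) (N : nat) (Omega : set 'rV[R]_N) (p q : R).
Variable mu : 'rV[R]_N -> R.
Hypotheses (N2 : (2 <= N)%N) (p1 : 1 < p) (pq : p < q) (pn : p < N%:R).
Hypothesis mu0 : forall x, Omega x -> 0 <= mu x.
Hypothesis mmu : mfun_on Omega mu.
Hypothesis oOmega : open Omega.
Local Notation s := (N%:R * p / (N%:R - p)).

Let mOmega : measurable (Omega : set (lebesgue_space R N)).
Proof. exact: measurable_Omega. Qed.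
Let p0 : 0 < p. Proof. exact: lt_trans p1. Qed.
Let s0 : 0 < s. Proof. exact: (sobolev_exponent_gt0 p1 pn). Qed.

(** Sobolev's inequality for the approximating test functions passes to v by Fatou's lemma, which
    also yields the integrability of |v|^s. Stating it with a bound b > 0 leaves room for the
    approximation error even when the gradient integral vanishes. *)
Lemma sobolev_W1H0 : exists2 C : R, 0 < C & forall v Dv (b : R), 0 < b ->
  in_W1H0 Omega p q mu v Dv ->
  (int_on Omega (fun x => enorm (Dv x) `^ p)%R <= b%:E)%E ->
  (int_on Omega (fun x => `|v x| `^ s)%R <= (C * b `^ (s / p))%:E)%E.
Proof.
pose A : R := (N%:R * (p * (N%:R - 1) / (N%:R - p))) `^ s.
have A0 : 0 < A.
  have := sobolev_gam_gt1 p1 pn => g1; apply: powR_gt0.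
  by rewrite mulr_gt0 ?ltr0n ?(ltn_trans _ N2)// (lt_trans _ g1).
have c0 : 0 < 1 + 2 `^ p :> R by rewrite ltr_pwDl// powR_ge0.
exists (A * (1 + 2 `^ p) `^ (s / p)) => [|v Dv b b0 vW vb].
  by rewrite mulr_gt0// powR_gt0.
have [psi app] := in_W1H0_approximates p1 pq mu0 mmu oOmega vW.
have [[[mv _] mDv _ _] _] := vW.
have tpsi k : test_function Omega (psi k) by case: (app k).
pose e k x := enorm (grad (psi k) x - Dv x).
have me k : mfun_on Omega (e k).
  exact: (mfun_on_coordB (fun i => mfun_on_grad i (tpsi k)) mDv).
have mw k : mfun_on Omega (fun x => psi k x - v x).
  exact: mfun_onB (mfun_on_test (tpsi k)) mv.
have rw k : (modular Omega p q mu (fun x => (2^-1 ^+ k)^-1 * (psi k x - v x))%R <=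
    (2^-1 ^+ k)%:E)%E by have [_ rw _] := app k.
have re k : (modular Omega p q mu (fun x => (2^-1 ^+ k)^-1 * e k x)%R <=
    (2^-1 ^+ k)%:E)%E by have [_ _ re] := app k.
have mgrad k : mfun_on Omega (fun x => enorm (grad (psi k) x) `^ p).
  by apply: mfun_on_powR; apply: measurable_enorm => i; exact: mfun_on_grad.
have mD : mfun_on Omega (fun x => enorm (Dv x)) by exact: measurable_enorm.
apply: (@fatou_int_on _ _ _ mOmega (fun k x => `|psi k x| `^ s)).
- by move=> k; apply: mfun_on_powR; apply: mfun_on_norm; exact: mfun_on_test.
- by apply: mfun_on_powR; exact: mfun_on_norm.
- by move=> k x; exact: powR_ge0.
- by move=> x; exact: powR_ge0.
- apply: filterS (rapid_ae_cvg p1 mu0 mmu oOmega mw rw) => x wx Ox.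
  apply: (continuous_cvg _ (@continuous_powR_norm _ s s0 (v x))).
  rewrite (_ : (fun k => _) = (fun k => (psi k x - v x) + v x)); last first.
    by apply/funext => k; rewrite subrK.
  by rewrite -[X in _ --> X]add0r; apply: cvgD; [exact: wx|exact: cvg_cst].
have Hb := near_half b0.
have He := rapid_modular p1 pq mu0 mmu oOmega me re 2.
apply: filterS2 Hb He => k Hbk Hek.
apply: (le_trans (sobolev_test_phi N2 erefl p1 pn (tpsi k))).
rewrite -[in leRHS]mulrA [in leRHS]EFinM; apply: lee_wpmul2l; first by rewrite lee_fin ltW.
rewrite -powRM ?(ltW c0) ?(ltW b0)//.
apply: (@le_trans _ _ (((1 + 2 `^ p) * b)%:E `^ (s / p))%E); last by [].
apply: le_poweR; first by rewrite divr_ge0// ltW.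
  by apply: int_on_ge0 => x _; exact: powR_ge0.
have m2e : mfun_on Omega (fun x => (2 * e k x) `^ p).
  by apply: mfun_on_powR; apply: mfun_onM; [exact: mfun_on_cst|exact: me].
have m2D : mfun_on Omega (fun x => (2 * enorm (Dv x)) `^ p).
  by apply: mfun_on_powR; apply: mfun_onM; [exact: mfun_on_cst|exact: mD].
(* The error part is at most 2^-k <= b and the gradient part at most 2^p b, whence the constant 1 +
   2^p. *)
apply: (@le_trans _ _ (int_on Omega (fun x => (2 * e k x) `^ p)%R +
    int_on Omega (fun x => (2 * enorm (Dv x)) `^ p)%R)%E).
  rewrite -(int_onD mOmega m2e m2D); last 2 first.
  - by move=> x _; exact: powR_ge0.
  - by move=> x _; exact: powR_ge0.
  apply: (le_int_on mOmega (mgrad k)).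
  - exact: (mfun_onD m2e m2D).
  - by move=> x _; exact: powR_ge0.
  - move=> x _; apply: le_trans (powRD_le (ltW p0) (enorm_ge0 _) (enorm_ge0 _)).
    apply: ge0_ler_powR; rewrite ?nnegrE ?addr_ge0 ?enorm_ge0 ?(ltW p0)//.
    by apply: le_trans (ler_enormD _ _); rewrite subrK.
rewrite mulrDl mul1r EFinD; apply: leeD.
  apply: (@le_trans _ _ (modular Omega p q mu (fun x => 2 * e k x)%R)).
    apply: (le_int_on mOmega m2e).
    - apply: (mfun_on_calH p q mmu); apply: mfun_on_norm; apply: mfun_onM; last exact: me.
      exact: mfun_on_cst.
    - by move=> x _; exact: powR_ge0.
    - move=> x Ox; apply: le_trans (powR_le_calH p q mu0 _ Ox).
      by rewrite ger0_norm// mulr_ge0 ?enorm_ge0.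
  by apply: (le_trans Hek); rewrite lee_fin.
rewrite (@eq_int_on _ _ _ _ (fun x => 2 `^ p * enorm (Dv x) `^ p)); last first.
  by move=> x _; rewrite powRM ?enorm_ge0.
rewrite (int_onZ mOmega); last 3 first.
- by apply: mfun_on_powR; exact: mD.
- exact: powR_ge0.
- by move=> x _; exact: powR_ge0.
by rewrite EFinM; apply: lee_wpmul2l; first rewrite lee_fin powR_ge0.
Qed.

End sobolev_W1H0.

Import HBNNSimple.

Section integral_domination.
Variables (R : realType) (N : nat) (Omega : set 'rV[R]_N).
Hypothesis mOmega : measurable (Omega : set (lebesgue_space R N)).
Local Open Scope ereal_scope.

(* Spares proving that [g x (u x) (Du x) * v x] is measurable: the integral of a
   positive part is a supremum over the simple functions below it. *)
Lemma integral_le_int_on (f h : 'rV[R]_N -> R) :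
  mfun_on Omega h -> (forall x, Omega x -> (0 <= h x)%R) ->
  {ae lebesgue, forall x, Omega x -> (f x <= h x)%R} ->
  \int[lebesgue]_(x in Omega) (f x)%:E <= int_on Omega h.
Proof.
move=> mh h0 fh; rewrite integralE.
apply: (@le_trans _ _ (\int[lebesgue]_(x in Omega) (EFin \o f)^\+ x)).
  rewrite -[leRHS]sube0; apply: leeB => //.
  by apply: integral_ge0 => x _; exact: funeneg_ge0.
rewrite ge0_integralE; last by move=> x _; exact: funepos_ge0.
apply: ge_ereal_sup => _ [k kf <-].
have {}kf x : (k x)%:E <= ((EFin \o f)^\+ \_ Omega) x by exact: kf.
rewrite (_ : sintegral _ _ = \int[lebesgue]_x (k x)%:E); last first.
  by rewrite integral_nnsfun// patch_setT.
rewrite /int_on [leRHS]integral_mkcond.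
have mhO : measurable_fun (setT : set (lebesgue_space R N))
    ((fun x => (h x)%:E) \_ Omega).
  by apply/(measurable_restrictT _ mOmega); exact: mfun_on_EFin.
apply: (ae_ge0_le_integral measurableT).
- by move=> x _; rewrite lee_fin.
- by apply/measurable_EFinP.
- by move=> x _; rewrite patchE; case: ifPn => // /set_mem Ox; rewrite lee_fin h0.
- exact: mhO.
- apply: filterS fh => x fx _; apply: (le_trans (kf x)).
  rewrite !patchE; case: ifPn => // /set_mem Ox.
  rewrite funeposE /= ge_max !lee_fin fx//=; exact: h0.
Qed.

Lemma int_on_eq0 (f : 'rV[R]_N -> R) : mfun_on Omega f ->
  (forall x, Omega x -> (0 <= f x)%R) -> int_on Omega f = 0 ->
  {ae lebesgue, forall x, Omega x -> f x = 0%R}.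
Proof.
move=> mf f0 intf.
have [H _] := ae_eq_integral_abs lebesgue mOmega (mfun_on_EFin mf).
have : \int[lebesgue]_(x in Omega) `|(EFin \o f) x| = 0.
  rewrite -[RHS]intf; apply: eq_integral => x /set_mem Ox.
  by rewrite /= ger0_norm// f0.
move=> /H; apply: filterS => x fx Ox.
by have := fx Ox => -[].
Qed.

End integral_domination.

(** * The De Giorgi iteration *)

Section above.
Variable R : realType.
Implicit Types k y : R.

Definition above k y : R := if k < y then 1 else 0.

Lemma above01 k y : 0 <= above k y <= 1.
Proof. by rewrite /above; case: ifP; rewrite ?lexx ?ler01. Qed.

Lemma measurable_above k : measurable_fun setT (above k).
Proof.
rewrite (_ : above k = \1_(`]k, +oo[%classic)); first exact: measurable_indic.
by apply/funext => y; rewrite indicE mem_setE in_itv/= andbT /above; case: ifP.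
Qed.

End above.

Section pointwise_estimates.
Variable R : realType.

(** Put y = D^(p/r), so that the two powers of D become y^(r-1) and y^r. If y >= 2 c1 t, then c1
    y^(r-1) t is at most half of y^r; otherwise y^(r-1) is at most (2 c1 t)^(r-1), the origin of the
    constant. As t >= 1, every remaining power of t is at most t^s. *)
Lemma young_growth (p r s c1 c2 c3 D t : R) :
  0 < c1 -> 0 < c2 -> 0 < c3 -> 1 < r -> r <= s -> 0 <= D -> 1 <= t ->
  (c1 * D `^ (p * ((r - 1) / r)) + c2 * t `^ (r - 1) + c3) * t <=
  2^-1 * D `^ p + (c1 * (2 * c1) `^ (r - 1) + c2 + c3) * t `^ s.
Proof.
move=> c1_gt0 c2_gt0 c3_gt0 r1 rs D0 t1.
have r0 : 0 < r by lra.
have t0 : 0 <= t by lra.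
have r10 : 0 <= r - 1 by lra.
pose y := D `^ (p / r).
have y0 : 0 <= y by exact: powR_ge0.
have -> : D `^ (p * ((r - 1) / r)) = y `^ (r - 1).
  by rewrite -powRrM; congr (_ `^ _); field; rewrite gt_eqF.
have -> : D `^ p = y `^ r.
  by rewrite -powRrM; congr (_ `^ _); field; rewrite gt_eqF.
have trs : t `^ r <= t `^ s by exact: ler_powR.
have tr1 : t `^ (r - 1) * t = t `^ r by rewrite mulrC mulr_powRB1.
have t_le : t <= t `^ s by apply: le1r_powR => //; lra.
have yr1 : y `^ (r - 1) * y = y `^ r by rewrite mulrC mulr_powRB1.
have yr0 : 0 <= y `^ r by exact: powR_ge0.
have Y0 : 0 <= y `^ (r - 1) by exact: powR_ge0.
set B := (2 * c1) `^ (r - 1).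
have B0 : 0 <= B by exact: powR_ge0.
have E1 : c1 * y `^ (r - 1) * t <= 2^-1 * y `^ r + c1 * B * t `^ s.
  have cB0 : 0 <= c1 * B * t `^ s by rewrite !mulr_ge0 ?powR_ge0// ltW.
  have [cy|/ltW yc] := leP (2 * c1 * t) y.
    have : y `^ (r - 1) * (2 * c1 * t) <= y `^ (r - 1) * y by rewrite ler_wpM2l.
    by rewrite yr1; lra.
  have : y `^ (r - 1) <= (2 * c1 * t) `^ (r - 1).
    by apply: ge0_ler_powR; rewrite ?nnegrE// !mulr_ge0// ltW.
  rewrite powRM ?mulr_ge0 ?(ltW c1_gt0)// -/B => yB.
  have : c1 * t * y `^ (r - 1) <= c1 * t * (B * t `^ (r - 1)).
    by rewrite ler_wpM2l// mulr_ge0// ltW.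
  have -> : c1 * t * (B * t `^ (r - 1)) = c1 * B * (t `^ (r - 1) * t) by ring.
  rewrite tr1 => E.
  have : c1 * B * t `^ r <= c1 * B * t `^ s by rewrite ler_wpM2l// mulr_ge0// ltW.
  by move: E yr0; lra.
have E2 : c2 * t `^ (r - 1) * t <= c2 * t `^ s.
  by rewrite -mulrA tr1 ler_wpM2l// ltW.
have E3 : c3 * t <= c3 * t `^ s by rewrite ler_wpM2l// ltW.
by rewrite !mulrDl; move: E1 E2 E3; lra.
Qed.

(** At xi = 0 both sides vanish, whatever the value of the powers with exponents p - 2 and q - 2. *)
Lemma dotv_flux (N : nat) (p q : R) (mu : 'rV[R]_N -> R) x xi a :
  0 < p -> 0 < q ->
  dotv (flux p q mu x xi) (a *: xi) = a * calH p q mu x (enorm xi).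
Proof.
move=> p0 q0.
have pow_sqr b : 0 < b -> enorm xi `^ (b - 2) * enorm xi ^+ 2 = enorm xi `^ b.
  move=> b0; have [->|xi0] := eqVneq (enorm xi) 0.
    by rewrite expr0n/= mulr0 powR0// gt_eqF.
  rewrite -powR_mulrn ?enorm_ge0// -powRD ?xi0 ?implybT//.
  by rewrite subrK.
rewrite /flux dotvDl !dotvZl ![dotv xi (a *: xi)]dotvC !dotvZl -!enorm_sqr.
rewrite /calH -(pow_sqr p p0) -(pow_sqr q q0); ring.
Qed.

End pointwise_estimates.

Section de_giorgi_sequence.
Variable R : realType.

Lemma powR_root (a alpha : R) : 0 < a -> 0 < alpha -> exists2 x : R, 0 < x & x `^ alpha = a.
Proof.
move=> a0 al0; exists (a `^ alpha^-1); first exact: powR_gt0.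
by rewrite -powRrM mulVf ?gt_eqF// powRr1// ltW.
Qed.

(* [rho] and [z0] solve [b rho ^ (al - 1) = 1] and [A z0 ^ (al - 1) = rho]. *)
Lemma geometric_iteration (A b al : R) : 0 < A -> 1 < b -> 1 < al ->
  exists z0 rho : R, [/\ 0 < z0, 0 < rho, rho < 1 &
    forall n : nat, A * b ^+ n * (z0 * rho ^+ n) `^ al <= z0 * rho ^+ n.+1].
Proof.
move=> A0 b1 al1; have al0 : 0 < al - 1 by lra.
have b0 : 0 < b by lra.
have ib0 : 0 < b^-1 by rewrite invr_gt0.
have [rho rho0 rhoE] := powR_root ib0 al0.
have rA : 0 < rho / A by rewrite divr_gt0.
have [z z0 zE] := powR_root rA al0.
have step (x a : R) : 0 < x -> x `^ (al - 1) = a -> x `^ al = x * a.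
  by move=> x0 <-; rewrite mulr_powRB1 ?(ltW x0)//; lra.
have rho1 : rho < 1.
  rewrite ltNge; apply/negP => r1.
  have : 1 `^ (al - 1) <= rho `^ (al - 1).
    by apply: ge0_ler_powR; rewrite ?nnegrE ?(ltW al0) ?(ltW rho0).
  by rewrite powR1 rhoE leNgt invf_lt1// b1.
exists z, rho; split=> // n.
rewrite powRM ?exprn_ge0 ?(ltW z0) ?(ltW rho0)//.
rewrite -(powR_mulrn n (ltW rho0)) powRAC powR_mulrn ?powR_ge0//.
rewrite (step _ _ rho0 rhoE) (step _ _ z0 zE) exprMn exprVn.
rewrite (_ : A * b ^+ n * _ = z * rho * rho ^+ n); last first.
  by field; rewrite !gt_eqF ?exprn_gt0.
by rewrite exprS mulrA.
Qed.

End de_giorgi_sequence.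

(** * Caccioppoli estimate and iteration over the levels *)

Section weak_solution_bound.
Variables (R : realType) (N : nat) (Omega : set 'rV[R]_N) (p q r c1 c2 c3 : R).
Variables (mu : 'rV[R]_N -> R) (g : 'rV[R]_N -> R -> 'rV[R]_N -> R).
Hypotheses (N2 : (2 <= N)%N) (p1 : 1 < p) (pq : p < q) (pn : p < N%:R).
Hypotheses (r1 : 1 < r) (rs : r <= N%:R * p / (N%:R - p)).
Hypotheses (c1_gt0 : 0 < c1) (c2_gt0 : 0 < c2) (c3_gt0 : 0 < c3).
Hypothesis mu0 : forall x, Omega x -> 0 <= mu x.
Hypothesis mmu : mfun_on Omega mu.
Hypothesis oOmega : open Omega.
Hypothesis fOmega : (lebesgue (Omega : set (lebesgue_space R N)) < +oo)%E.
Hypothesis growth : {ae lebesgue, forall x, Omega x ->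
  forall (t : R) (xi : 'rV[R]_N),
    `|g x t xi| <= c1 * enorm xi `^ (p * ((r - 1) / r)) + c2 * `|t| `^ (r - 1) + c3}.
Variables (u : 'rV[R]_N -> R) (Du : 'rV[R]_N -> 'rV[R]_N).
Hypothesis uW : in_W1H0 Omega p q mu u Du.
Hypothesis weak : forall v Dv, in_W1H0 Omega p q mu v Dv ->
  (\int[lebesgue]_(x in Omega) (dotv (flux p q mu x (Du x)) (Dv x))%:E =
   \int[lebesgue]_(x in Omega) (g x (u x) (Du x) * v x)%:E)%E.
Local Notation s := (N%:R * p / (N%:R - p)).
Local Notation H := (calH p q mu).
Local Notation D := (fun x => enorm (Du x)).

Let mOmega : measurable (Omega : set (lebesgue_space R N)).
Proof. exact: measurable_Omega. Qed.
Let p0 : 0 < p. Proof. exact: lt_trans p1. Qed.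
Let q0 : 0 < q. Proof. exact: lt_trans pq. Qed.
Let s0 : 0 < s. Proof. exact: (sobolev_exponent_gt0 p1 pn). Qed.
Let mu_ : mfun_on Omega u. Proof. by case: uW => -[[]]. Qed.
Let mD : mfun_on Omega D.
Proof. by case: uW => -[_ mDu _ _] _; apply: measurable_enorm => i; exact: mDu. Qed.
Let mHD : mfun_on Omega (fun x => H x (D x)). Proof. exact: mfun_on_calH. Qed.
Let HD0 x : Omega x -> 0 <= H x (D x).
Proof. by move=> Ox; exact: (calH_ge0 _ _ mu0). Qed.
Let HDoo : (int_on Omega (fun x => H x (D x)) < +oo)%E.
Proof.
have [[_ _ [_ fin] _] _] := uW.
rewrite -(@eq_int_on _ _ Omega (fun x => H x `|D x|)); first exact: fin.
by move=> x _; rewrite ger0_norm ?enorm_ge0.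
Qed.

Let us x := `|u x| `^ s.
Let mus : mfun_on Omega us.
Proof. by apply: mfun_on_powR; exact: mfun_on_norm mu_. Qed.
Let us0 x : 0 <= us x. Proof. exact: powR_ge0. Qed.

(** Sobolev's inequality for u itself. It makes every [Z k] finite and provides the majorant for its
    convergence to 0. The 1 added to the modular keeps the bound positive when Du = 0. *)
Lemma weak_solution_Ls : (int_on Omega us < +oo)%E.
Proof.
have [C C0 sob] := sobolev_W1H0 N2 p1 pq pn mu0 mmu oOmega.
have fin : int_on Omega (fun x => H x (D x)) \is a fin_num.
  by rewrite ge0_fin_numE; [exact: HDoo|exact: int_on_ge0 HD0].
pose b := fine (int_on Omega (fun x => H x (D x))) + 1.
have b0 : 0 < b by rewrite ltr_wpDl// fine_ge0//; exact: int_on_ge0 HD0.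
apply: le_lt_trans (sob u Du b b0 uW _) (ltry _).
apply: (@le_trans _ _ (int_on Omega (fun x => H x (D x)))).
  apply: (le_int_on mOmega _ mHD) => [|x _|x Ox]; last exact: (powR_le_calH p q mu0 _ Ox).
    exact: mfun_on_powR.
  exact: powR_ge0.
by rewrite -(fineK fin) lee_fin lerDl.
Qed.

Section one_sign.
Variable sg : R.
Hypothesis sg1 : sg ^+ 2 = 1.

Let normsg : `|sg| = 1.
Proof. by apply/eqP; rewrite -(@eqrXn2 _ 2)// ?expr1n// -normrX sg1 normr1. Qed.

(** The weight is |u|^s and not a power of the truncated function, since the growth of g yields
    |u|^s; in return, passing from one level to the next costs a factor (k + d)/d. *)
Let Z k := int_on Omega (fun x => above k (sg * u x) * us x).

Let mabove k : mfun_on Omega (fun x => above k (sg * u x)).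
Proof.
apply: (measurableT_comp (measurable_above k)).
exact: mfun_onM (mfun_on_cst _) mu_.
Qed.

Let mZ k : mfun_on Omega (fun x => above k (sg * u x) * us x).
Proof. exact: mfun_onM (mabove k) mus. Qed.

Let Z_ge0 x k : 0 <= above k (sg * u x) * us x.
Proof. by rewrite mulr_ge0 ?us0//; have /andP[] := above01 k (sg * u x). Qed.

Let Cg := c1 * (2 * c1) `^ (r - 1) + c2 + c3.

Let Cg0 : 0 < Cg.
Proof. by rewrite /Cg ltr_wpDl// addr_ge0// ?(ltW c2_gt0)// mulr_ge0 ?powR_ge0// ltW. Qed.

Section one_level.
Variables (k d : R).
Hypotheses (k1 : 1 <= k) (d0 : 0 < d).

Let k0 : 0 <= k. Proof. exact: le_trans k1. Qed.
Let G1 s := dtrunc sg k d s.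
Let v x := trunc sg k d (u x).
Let Dv x := G1 (u x) *: Du x.
Let G1_ge0 t : 0 <= G1 t. Proof. exact: dtrunc_ge0. Qed.
Let G1_le1 t : G1 t <= 1. Proof. exact: dtrunc_le1. Qed.
Let mG1 : mfun_on Omega (fun x => G1 (u x)).
Proof. exact: mfun_on_comp (@continuous_dtrunc _ sg k d) mu_. Qed.

Lemma trunc_in_W1H0 : in_W1H0 Omega p q mu v Dv.
Proof.
have [psi app] := in_W1H0_approximates p1 pq mu0 mmu oOmega uW.
apply: (@chain_in_W1H0 _ _ _ _ _ _ p1 pq mu0 mmu oOmega fOmega _ _ _ _ app
  (trunc_chain sg k d)).
- by case: uW.
- exact: derivative_chain_trunc.
- exact: trunc0.
- by move=> t; apply/andP; split; [exact: G1_ge0|exact: G1_le1].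
Qed.

Let X := int_on Omega (fun x => G1 (u x) * H x (D x)).
Let mX : mfun_on Omega (fun x => G1 (u x) * H x (D x)).
Proof. exact: mfun_onM mG1 mHD. Qed.
Let X0 x : Omega x -> 0 <= G1 (u x) * H x (D x).
Proof. by move=> Ox; rewrite mulr_ge0// HD0. Qed.

Let Xoo : (X < +oo)%E.
Proof.
apply: le_lt_trans HDoo; apply: (le_int_on mOmega mX mHD) => // x Ox.
by rewrite ler_piMl// HD0.
Qed.

(* Only the points with [sg u > k >= 1] count, where [|u| ^ r] and [|u|] are at
   most [|u| ^ s]. *)
Let X_le : (X <= (2^-1)%:E * X + Cg%:E * Z k)%E.
Proof.
have E : (X = \int[lebesgue]_(x in Omega) (g x (u x) (Du x) * v x)%:E)%E.
  rewrite -(weak trunc_in_W1H0); apply: eq_int_on => x _.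
  by rewrite dotv_flux.
rewrite [leLHS]E {E}.
have mh1 : mfun_on Omega (fun x => 2^-1 * (G1 (u x) * H x (D x))).
  exact: mfun_onM (mfun_on_cst _) mX.
have mh2 : mfun_on Omega (fun x => Cg * (above k (sg * u x) * us x)).
  exact: mfun_onM (mfun_on_cst _) (mZ k).
have i2 : 0 <= 2^-1 :> R by rewrite invr_ge0.
have h10 x : Omega x -> 0 <= 2^-1 * (G1 (u x) * H x (D x)).
  by move=> Ox; rewrite mulr_ge0// X0.
have h20 x : Omega x -> 0 <= Cg * (above k (sg * u x) * us x).
  by move=> Ox; apply: mulr_ge0; [exact: ltW|exact: Z_ge0].
have -> : ((2^-1)%:E * X = int_on Omega (fun x => (2^-1 * (G1 (u x) * H x (D x)))%R))%E.
  by rewrite (int_onZ mOmega mX i2 X0).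
have -> : (Cg%:E * Z k = int_on Omega (fun x => (Cg * (above k (sg * u x) * us x))%R))%E.
  by rewrite (int_onZ mOmega (mZ k) (ltW Cg0) (fun x _ => Z_ge0 x k)).
rewrite -(int_onD mOmega mh1 mh2 h10 h20).
apply: (integral_le_int_on mOmega (mfun_onD mh1 mh2)).
  by move=> x Ox; rewrite addr_ge0// ?h10// h20.
apply: filterS growth => x gx Ox.
have [uk|ku] := leP (sg * u x) k.
  by rewrite /v trunc_out// mulr0 addr_ge0 ?h10 ?h20.
have sgu : sg * u x = `|u x|.
  have : 0 <= sg * u x by move: k0 ku; lra.
  by move=> /ger0_norm <-; rewrite normrM normsg mul1r.
rewrite /above ku mul1r.
have u1 : 1 <= `|u x| by rewrite -sgu; move: k1 ku; lra.
have := young_growth p c1_gt0 c2_gt0 c3_gt0 r1 rs (enorm_ge0 (Du x)) u1.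
set M := (c1 * _ + _ + _) => Y.
have gM : `|g x (u x) (Du x)| <= M by exact: gx.
have M0 : 0 <= M by exact: le_trans gM.
(* The factor [G1] has to stay with the gradient term, which then becomes one half of the integrand
   of [X]; in the other term it is merely bounded by 1. *)
apply: (@le_trans _ _ (M * (`|u x| * G1 (u x)))).
  apply: (le_trans (ler_norm _)); rewrite normrM ler_pM//.
  exact: trunc_le_dtrunc.
have DH := powR_le_calH p q mu0 (D x) Ox.
apply: (@le_trans _ _ ((2^-1 * H x (D x) + Cg * us x) * G1 (u x))).
  rewrite mulrA ler_wpM2r//; apply: (le_trans Y).
  by rewrite -/Cg -/(us x) lerD2r ler_wpM2l.
rewrite mulrDl; apply: lerD; first by rewrite -mulrA [H _ _ * _]mulrC.
by rewrite ler_piMr// mulr_ge0// ltW.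
Qed.

(** Since 0 <= G1 <= 1 and p > 1, G1^p <= G1, so the left-hand side is at most [X]. As [X] is
    finite, one half of it can be subtracted in [X_le]. *)
Lemma caccioppoli :
  (int_on Omega (fun x => enorm (Dv x) `^ p)%R <= (2 * Cg)%:E * Z k)%E.
Proof.
apply: (@le_trans _ _ X).
  apply: (le_int_on mOmega _ mX) => [|x _|x Ox].
  - apply: mfun_on_powR; case: uW => -[_ mDu _ _] _; apply: measurable_enorm => i.
    rewrite (_ : (fun x => _) = (fun x => G1 (u x) * Du x 0 i)).
      exact: mfun_onM mG1 (mDu i).
    by apply/funext => x; rewrite /Dv mxE.
  - exact: powR_ge0.
  - rewrite /Dv enormZ (ger0_norm (G1_ge0 _)) powRM ?enorm_ge0//.
    apply: ler_pM; [exact: powR_ge0|exact: powR_ge0| |exact: (powR_le_calH p q mu0 _ Ox)].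
    have [->|Gn0] := eqVneq (G1 (u x)) 0; first by rewrite powR0// gt_eqF.
    by apply: ge1r_powR; rewrite ?(ltW p1)// lt0r Gn0 G1_ge0 G1_le1.
have := X_le; have : (0 <= X)%E by exact: int_on_ge0.
have : (0 <= Z k)%E by apply: int_on_ge0 => x _; exact: Z_ge0.
have : (Z k < +oo)%E.
  apply: le_lt_trans weak_solution_Ls; apply: (le_int_on mOmega (mZ k) mus) => x _.
    exact: Z_ge0.
  by rewrite ler_piMl//; have /andP[] := above01 k (sg * u x).
move: X Xoo (Z k) => [a| |]// _ [b| |]// _ _ _.
by rewrite -!EFinM -EFinD !lee_fin; lra.
Qed.

End one_level.

(** Where sg u > k + d, |u| is at most (k + d)/d times |u| - k, which in turn is at most e times the
    truncation at level k. The integral of the s-th power of that truncation is bounded by Sobolev's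
    inequality and the Caccioppoli estimate. *)
Lemma de_giorgi_step : exists2 C : R, 0 < C & forall k d z : R,
  1 <= k -> 0 < d -> 0 < z -> (Z k <= z%:E)%E ->
  (Z (k + d) <= (C * ((k + d) / d) `^ s * z `^ (s / p))%:E)%E.
Proof.
have [C C0 sob] := sobolev_W1H0 N2 p1 pq pn mu0 mmu oOmega.
exists (expR 1 `^ s * (C * (2 * Cg) `^ (s / p))).
  apply: mulr_gt0; first by apply: powR_gt0; exact: expR_gt0.
  by apply: mulr_gt0 => //; apply: powR_gt0; rewrite mulr_gt0.
move=> k d z k1 d0 z0 Zz.
have k0 : 0 < k by exact: lt_le_trans k1.
have kd0 : 0 < k + d by rewrite addr_gt0.
have Cz0 : 0 < 2 * Cg * z by rewrite !mulr_gt0.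
have cac : (int_on Omega (fun x => enorm (dtrunc sg k d (u x) *: Du x) `^ p)%R
    <= (2 * Cg * z)%:E)%E.
  apply: (le_trans (caccioppoli k1 d0)); rewrite [leRHS]EFinM; apply: lee_wpmul2l => //.
  by rewrite lee_fin mulr_ge0// ltW.
have := sob _ _ _ Cz0 (trunc_in_W1H0 k1 d0) cac.
pose E := (k + d) / d * expR 1.
have E0 : 0 <= E by rewrite mulr_ge0 ?expR_ge0// divr_ge0// ltW.
have mv : mfun_on Omega (fun x => `|trunc sg k d (u x)| `^ s).
  apply: mfun_on_powR; apply: mfun_on_norm.
  exact: mfun_on_comp (@continuous_trunc _ sg k d) mu_.
move=> sobv.
apply: (@le_trans _ _ ((E `^ s)%:E * int_on Omega (fun x => `|trunc sg k d (u x)| `^ s)%R)%E).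
  rewrite -(int_onZ mOmega mv); last 2 first.
  - exact: powR_ge0.
  - by move=> x _; exact: powR_ge0.
  apply: (le_int_on mOmega (mZ _)) => [|x _|x Ox].
  - exact: mfun_onM (mfun_on_cst _) mv.
  - exact: Z_ge0.
  - rewrite /above; case: ifPn => [kdu|_]; last first.
      by rewrite mul0r mulr_ge0 ?powR_ge0.
    rewrite mul1r -powRM//.
    apply: ge0_ler_powR; [exact: ltW|by rewrite nnegrE|by rewrite nnegrE mulr_ge0|].
    have sgu : sg * u x = `|u x|.
      have : 0 <= sg * u x by move: kd0 kdu; lra.
      by move=> /ger0_norm <-; rewrite normrM normsg mul1r.
    have := trunc_ge sg1 d0 (ltW kdu); rewrite sgu expRN => tg.
    have e0 := expR_gt0 (1 : R).
    have {tg} tg : `|u x| - k <= expR 1 * `|trunc sg k d (u x)|.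
      by move: tg; rewrite -ler_pdivlMr ?invr_gt0// invrK mulrC.
    have ukd : `|u x| * d <= (k + d) * (`|u x| - k).
      have : 0 <= k * (`|u x| - (k + d)) by rewrite mulr_ge0 ?subr_ge0 -?sgu ?ltW.
      lra.
    rewrite /E -mulrA mulrAC ler_pdivlMr//.
    by apply: (le_trans ukd); rewrite ler_wpM2l// ltW.
apply: (@le_trans _ _ ((E `^ s)%:E * (C * (2 * Cg * z) `^ (s / p))%:E)%E).
  by apply: lee_wpmul2l => //; rewrite lee_fin powR_ge0.
rewrite -EFinM lee_fin /E powRM ?expR_ge0 ?divr_ge0 ?(ltW kd0) ?(ltW d0)//.
rewrite (@powRM _ (2 * Cg)) ?(ltW z0) ?mulr_ge0 ?(ltW Cg0)//.
by rewrite le_eqVlt; apply/orP; left; apply/eqP; ring.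
Qed.

Lemma Z_cvg0 : Z n%:R @[n --> \oo] --> 0%E.
Proof.
apply: (@cvg_integral_weight _ _ _ mOmega (fun n x => above n%:R (sg * u x)) us).
- by move=> n; exact: mabove.
- exact: mus.
- by move=> n x _; exact: above01.
- by move=> x _; exact: us0.
- exact: weak_solution_Ls.
- apply: aeW => x Ox; apply: cvg_near_cst.
  near=> n; rewrite /above ltNge (_ : sg * u x <= n%:R)//.
  by near: n; exact: nbhs_infty_ger.
Unshelve. all: by end_near. Qed.

Lemma bounded_above : exists M : R,
  {ae lebesgue, forall x, Omega x -> sg * u x <= M}.
Proof.
have [C C0 step] := de_giorgi_step.
have ps : 1 < s / p.
  by rewrite ltr_pdivlMr// mul1r ltr_pdivlMr ?subr_gt0// mulrC ltr_pM2r//; move: p0; lra.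
have b1 : 1 < 2 `^ s :> R.
  by have := @gt0_ltr_powR R s s0 1 2; rewrite !nnegrE powR1; apply; rewrite ?ltr1n.
(* With level k_(n+1) <= 2K and increment d = K 2^-(n+1), the quotient k_(n+1)/d is at most 4 times
   2^n: hence the constant 4^s and the ratio 2^s. *)
have A0 : 0 < C * 4 `^ s by rewrite mulr_gt0// powR_gt0.
have [z0 [rho [z00 rho0 rho1 geo]]] := geometric_iteration A0 b1 ps.
have nb : nbhs (0%E : \bar R) [set y | (y < z0%:E)%E].
  by apply: open_ereal_lt'; rewrite lte_fin.
have [m _ Hm] := Z_cvg0 nb.
(* Beyond the index m the value of [Z] is below the threshold z0; the maximum with 1 ensures K >= 1,
   as the step requires. *)
pose K : R := (maxn m 1)%:R.
have K1 : 1 <= K by rewrite ler1n leq_maxr.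
have K0 : 0 < K by exact: lt_le_trans K1.
have ZK : (Z K <= z0%:E)%E by apply: ltW; apply: (Hm (maxn m 1)) => /=; exact: leq_maxl.
pose k n := K * (2 - (2^-1) ^+ n).
have kS n : k n.+1 = k n + K * (2^-1) ^+ n.+1.
  by rewrite /k exprS; field.
have half_gt n : 0 < (2^-1 : R) ^+ n by rewrite exprn_gt0// invr_gt0.
have half_le n : (2^-1 : R) ^+ n <= 1 by exact: half_le1.
have k_ge1 n : 1 <= k n.
  apply: (le_trans K1); rewrite /k ler_peMr ?(ltW K0)//.
  by have := half_le n; lra.
have Zk n : (Z (k n) <= (z0 * rho ^+ n)%:E)%E.
  elim: n => [|n IH]; first by rewrite /k expr0 mulr1 (_ : 2 - 1 = 1) ?mulr1//; ring.
  have zn0 : 0 < z0 * rho ^+ n by rewrite mulr_gt0// exprn_gt0.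
  have d0 : 0 < K * (2^-1) ^+ n.+1 by rewrite mulr_gt0.
  have := step _ _ _ (k_ge1 n) d0 zn0 IH; rewrite -kS => /le_trans; apply.
  rewrite lee_fin; apply: le_trans (geo n); rewrite ler_wpM2r ?powR_ge0//.
  rewrite -[leRHS]mulrA ler_wpM2l ?(ltW C0)//.
  have -> : (2 `^ s) ^+ n = (2 ^+ n) `^ s :> R.
    by rewrite -powR_mulrn ?powR_ge0// powRAC powR_mulrn.
  rewrite -powRM ?exprn_ge0//; apply: ge0_ler_powR; rewrite ?(ltW s0) ?nnegrE//.
    by rewrite divr_ge0 ?(ltW d0)// (le_trans _ (k_ge1 n.+1)).
  rewrite ler_pdivrMr// exprVn exprS invfM.
  rewrite (_ : 4 * 2 ^+ n * (K * (2^-1 * (2 ^+ n)^-1)) = 2 * K); last first.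
    by field; rewrite gt_eqF// exprn_gt0.
  by rewrite /k mulrC ler_wpM2r ?(ltW K0)//; have := half_gt n.+1; lra.
have mono a b : a <= b -> (Z b <= Z a)%E.
  move=> ab; apply: (le_int_on mOmega (mZ b) (mZ a)) => [x _|x _]; first exact: Z_ge0.
  rewrite ler_wpM2r//; rewrite /above; case: ifPn => bu.
    by rewrite (le_lt_trans ab bu).
  by case: ifP.
have ZE : Z (2 * K) = 0%E.
  apply/eqP; rewrite eq_le; apply/andP; split; last first.
    by apply: int_on_ge0 => x _; exact: Z_ge0.
  (* [Z] is nonincreasing and all levels k n are at most 2K, so Z(2K) lies below every term of this
     null sequence. *)
  have cv : (z0 * rho ^+ n)%:E @[n --> \oo] --> (0 : \bar R)%E.
    apply: cvg_EFin; first exact: nearW.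
    rewrite -[X in _ --> X](mulr0 z0); apply: cvgMr.
    by apply: cvg_expr; rewrite gtr0_norm.
  rewrite -(cvg_lim _ cv)//; apply: lime_ge; first by apply/cvg_ex; exists 0%E.
  apply: nearW => n; apply: le_trans (Zk n); apply: mono.
  by rewrite /k mulrC ler_wpM2r ?(ltW K0)//; have := half_gt n; lra.
exists (2 * K).
have := int_on_eq0 mOmega (mZ (2 * K)) (fun x _ => Z_ge0 x _) ZE.
(* A point with sg u > 2K > 0 has |u|^s > 0, which the vanishing integrand excludes almost
   everywhere. *)
apply: filterS => x Zx Ox; rewrite leNgt; apply/negP => Ku.
have := Zx Ox; rewrite /above Ku mul1r => /eqP.
rewrite /us powR_eq0 => /andP[/eqP/normr0_eq0 u0 _].
by move: Ku; rewrite u0 mulr0 ltNge mulr_ge0// ltW.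
Qed.

End one_sign.

Lemma weak_solution_in_Linfty : in_Linfty Omega u.
Proof.
have [M1 H1] := @bounded_above 1 (expr1n _ _).
have [M2 H2] := @bounded_above (-1) (etrans (sqrrN _) (expr1n _ _)).
(* The signs of M1 and M2 are unknown, and the extension of u by 0 has to be covered as well; the
   sum of absolute values serves all cases. *)
have bnd : {ae lebesgue, forall x, (`|(u \_ Omega) x| <= `|M1| + `|M2|)}.
  apply: filterS2 H1 H2 => x h1 h2; rewrite patchE; case: ifPn => [/set_mem Ox|_].
    have := h1 Ox; have := h2 Ox; rewrite mul1r mulN1r ler_norml => a b.
    have := ler_norm M1; have := ler_norm M2.
    by have := normr_ge0 M1; have := normr_ge0 M2; move: a b => *; apply/andP; split; lra.
  by rewrite normr0 addr_ge0.
rewrite /in_Linfty inE /=; apply/andP; split.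
  by apply/mem_set; apply/(measurable_restrictT _ mOmega); exact: mu_.
rewrite inE /= /finite_norm unlock; case: ifP => // _.
apply: (@le_lt_trans _ _ (`|M1| + `|M2|)%:E); last exact: ltry.
apply/ess_supP; apply: filterS bnd => x hx.
by rewrite /= lee_fin.
Qed.

End weak_solution_bound.

Theorem theorem3p1 (R : realType) (N : nat) (Omega : set 'rV[R]_N)
    (p q r c1 c2 c3 : R) (mu : 'rV[R]_N -> R)
    (g : 'rV[R]_N -> R -> 'rV[R]_N -> R)
    (hN : (2 <= N)%N)
    (hOmega : is_domain Omega) (hbounded : bounded_set Omega)
    (hC2 : has_C2_boundary Omega)
    (hp : 1 < p) (hpq : p < q) (hqN : q < N%:R)
    (hratio : q / p < 1 + 1 / N%:R)
    (hmu0 : forall x, closure Omega x -> 0 <= mu x)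
    (hmu : [lipschitz mu x | x in closure Omega])
    (hg : caratheodory_function Omega g)
    (hc1 : 0 < c1) (hc2 : 0 < c2) (hc3 : 0 < c3)
    (hqr : q < r) (hr : r <= N%:R * p / (N%:R - p))
    (hgrowth : {ae lebesgue, forall x, Omega x ->
       forall (s : R) (xi : 'rV[R]_N),
         `|g x s xi| <= c1 * enorm xi `^ (p * ((r - 1) / r))
                        + c2 * `|s| `^ (r - 1) + c3}) :
  forall u, weak_solution Omega p q mu g u -> in_Linfty Omega u.
Proof.
move=> u [Du uW weak].
have [oOmega _ _] := hOmega.
apply: (weak_solution_in_Linfty hN hp hpq (lt_trans hpq hqN) _ hr hc1 hc2 hc3 _ _
  oOmega _ hgrowth uW weak).
- by apply: lt_trans hqr; exact: lt_trans hpq.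
- by move=> x Ox; apply: hmu0; exact: subset_closure.
- exact: lipschitz_mfun_on.
- exact: bounded_lebesgue_lty.
Qed.
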